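(* Let $K$ be the $3$-dimensional simplicial complex on the $12$ vertices $0,1,\dots,7,p_0,p_1,p_2,p_3$ whose $48$ tetrahedra are the following. Cone vertex $p_0$: $(0\,1\,4\,p_0),(2\,3\,7\,p_0),(1\,4\,5\,p_0),(2\,6\,7\,p_0),(0\,1\,2\,p_0),(4\,5\,7\,p_0),(1\,2\,3\,p_0),(4\,6\,7\,p_0),(0\,2\,4\,p_0),(1\,3\,7\,p_0),(2\,4\,6\,p_0),(1\,5\,7\,p_0)$. Cone vertex $p_1$: $(0\,2\,5\,p_1),(1\,3\,6\,p_1),(0\,5\,7\,p_1),(3\,4\,6\,p_1),(1\,5\,6\,p_1),(0\,3\,4\,p_1),(2\,5\,6\,p_1),(0\,3\,7\,p_1),(0\,2\,4\,p_1),(1\,3\,7\,p_1),(2\,4\,6\,p_1),(1\,5\,7\,p_1)$. Cone vertex $p_2$: $(0\,1\,4\,p_2),(2\,3\,7\,p_2),(1\,4\,5\,p_2),(2\,6\,7\,p_2),(1\,5\,6\,p_2),(0\,3\,4\,p_2),(2\,5\,6\,p_2),(0\,3\,7\,p_2),(0\,1\,6\,p_2),(2\,3\,5\,p_2),(0\,6\,7\,p_2),(3\,4\,5\,p_2)$. Cone vertex $p_3$: $(0\,2\,5\,p_3),(1\,3\,6\,p_3),(0\,5\,7\,p_3),(3\,4\,6\,p_3),(0\,1\,2\,p_3),(4\,5\,7\,p_3),(1\,2\,3\,p_3),(4\,6\,7\,p_3),(0\,1\,6\,p_3),(2\,3\,5\,p_3),(0\,6\,7\,p_3),(3\,4\,5\,p_3)$.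 Then $K$, which is a $12$-vertex equilibrium triangulation of $\mathbb{R}P^3$, is a subdivision of the $24$-cell under antipodal identification. That is, $K$ is obtained from the polyhedral complex given by the boundary complex of the $24$-cell modulo the antipodal map by subdividing its cells (each pair of tetrahedra of $K$ forming a pyramid over a triangulated square, and each two such pyramids over the same square forming one octahedron of the $24$-cell quotient).
   Context: The vertices $0,\dots,7$ arise from the $16$ vertices of the $4$-cube $[0,1]^4$ after antipodal identification, where vertex labels are the cube coordinates read in binary. The vertex $p_i$ is the centre of the $i$-th of the four $3$-cubes into which the boundary of the $4$-cube decomposes modulo antipodal identification. For $\mathbb{R}P^3$, the equilibrium subsets are $B_i=\{[x_0,\dots,x_3] : |x_i|\ge|x_j| \ \forall j\}$ and their intersections. An equilibrium triangulation is a combinatorial triangulation realising all of these as subcomplexes. The $24$-cell is the regular convex $4$-polytope with Schläfli symbol $\{3,4,3\}$. It has $24$ vertices and $24$ octahedral facets and is centrally symmetric. *)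

(* Defs.v *)
From HB Require Import structures.
From mathcomp Require Import all_boot all_order all_algebra.
From mathcomp Require Import all_classical all_reals.
From mathcomp Require Import topology normedtype.

Set Implicit Arguments.
Unset Strict Implicit.
Unset Printing Implicit Defensive.

Import Order.TTheory GRing.Theory Num.Theory.
Import numFieldNormedType.Exports.
Local Open Scope classical_set_scope.
Local Open Scope ring_scope.
Local Open Scope quotient_scope.
Local Open Scope card_scope.

Section Complexes.
Variable n : nat.
Implicit Types (K L : {set {set 'I_n}}) (s t : {set 'I_n}) (v : 'I_n).

Definition is_complex K : Prop :=
  finset.set0 \notin K /\
  forall s t, s \in K -> t \subset s -> t != finset.set0 -> t \in K.

Definition is_subcomplex L K : Prop := is_complex L /\ L \subset K.

Definition vertices K : {set 'I_n} := [set v | [set v]%SET \in K]%SET.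

Definition link v K : {set {set 'I_n}} :=
  [set s in K | (v \notin s) && (v |: s \in K)]%SET.

Definition complex_of_facets (fs : seq (seq nat)) : {set {set 'I_n}} :=
  [set s | (s != finset.set0) && has (fun f => s \subset [set v | val v \in f]%SET) fs]%SET.

End Complexes.

(* The boundary complex of the d-simplex, a (d-1)-sphere. *)
Definition boundary_simplex (d : nat) : {set {set 'I_d.+1}} :=
  [set s | (s != finset.set0) && (s != finset.setT)]%SET.

(* Points are barycentric coordinate vectors whose support is a simplex. *)
Definition realization (R : realType) (n : nat) (K : {set {set 'I_n}}) :
    set 'rV[R]_n :=
  [set x | (forall i, 0 <= x 0 i) /\ \sum_i x 0 i = 1 /\
           [set i | x 0 i != 0]%SET \in K].
Arguments realization R {n} K.

Section Realization.
Variables (R : realType) (n : nat) (K : {set {set 'I_n}}).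

Definition closed_simplex (s : {set 'I_n}) : set (realization R K) :=
  [set x : realization R K |
    forall i, i \notin s -> (set_val x : 'rV_n) 0 i = 0].

Definition subpolyhedron (L : {set {set 'I_n}}) : set (realization R K) :=
  [set x : realization R K | realization R L (set_val x)].

End Realization.

Definition homeomorphism (X Y : topologicalType) (f : X -> Y) : Prop :=
  continuous f /\
  exists g : Y -> X, [/\ continuous g, cancel f g & cancel g f].

Section Polytopes.
Variables (R : realType) (n : nat).
Implicit Types (P F : set 'rV[R]_n).

Definition dot (x y : 'rV[R]_n) : R := (x *m y^T) 0 0.

Definition hull (s : seq 'rV[R]_n) : set 'rV[R]_n :=
  [set x | exists w : 'I_(size s) -> R,
    [/\ forall i, 0 <= w i, \sum_i w i = 1 & x = \sum_i w i *: s`_i]].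

Definition affine_dim (d : nat) F : Prop :=
  exists (x : 'rV[R]_n) (M : 'M[R]_(d, n)),
    [/\ F x, row_free M, forall i, F (x + row i M)
      & forall y, F y -> (y - x <= M)%MS].

Definition is_polytope P : Prop :=
  (exists s, P = hull s) /\ affine_dim n P.

(* The empty set and P itself are (improper) faces. *)
Definition face P F : Prop :=
  exists (c : 'rV[R]_n) (b : R),
    (forall x, P x -> dot c x <= b) /\ F = P `&` [set x | dot c x = b].

Definition proper_face P F : Prop := [/\ face P F, F !=set0 & F <> P].

Definition dface P (d : nat) F : Prop := face P F /\ affine_dim d F.

(* The underlying set of the boundary complex. *)
Definition boundary P : set 'rV[R]_n :=
  [set x | exists F, proper_face P F /\ F x].

Definition is_flag P (F : 'I_n -> set 'rV[R]_n) : Prop :=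
  (forall i : 'I_n, dface P i (F i)) /\
  (forall i j : 'I_n, (i <= j)%N -> F i `<=` F j).

Definition is_symmetry P (g : 'rV[R]_n -> 'rV[R]_n) : Prop :=
  (exists (A : 'M[R]_n) (b : 'rV[R]_n),
     A *m A^T = 1%:M /\ forall x, g x = x *m A + b) /\
  g @` P = P.

Definition is_regular P : Prop :=
  is_polytope P /\
  forall F G : 'I_n -> set 'rV[R]_n, is_flag P F -> is_flag P G ->
    exists g, is_symmetry P g /\ forall i, g @` F i = G i.

Definition centrally_symmetric P : Prop := forall x, P x -> P (- x).

(* A, B, C, D in cyclic order. *)
Definition is_square (A B C D : 'rV[R]_n) : Prop :=
  [/\ A <> B, B - A = C - D, dot (B - A) (D - A) = 0
    & dot (B - A) (B - A) = dot (D - A) (D - A)].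

End Polytopes.

(* Schlaefli symbol {p, q, r}: every 2-face is a p-gon, q of the 2-faces of
   any facet meet at each of its vertices, and r facets meet at each edge. *)
Definition schlafli (R : realType) (P : set 'rV[R]_4) (p q r : nat) : Prop :=
  [/\ forall F2, dface P 2 F2 ->
        [set F | dface P 0 F /\ F `<=` F2] #= `I_p,
      forall F0 F3, dface P 0 F0 -> dface P 3 F3 -> F0 `<=` F3 ->
        [set F | dface P 2 F /\ F0 `<=` F /\ F `<=` F3] #= `I_q
    & forall F1, dface P 1 F1 ->
        [set F | dface P 3 F /\ F1 `<=` F] #= `I_r].

Definition is_24_cell (R : realType) (P : set 'rV[R]_4) : Prop :=
  is_regular P /\ schlafli P 3 4 3.

(* For finite unions of polytopes. Continuity of f and of its inverse follows
   from the finite closed cover. *)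
Definition PL_homeomorphic (R : realType) (m n : nat)
    (X : set 'rV[R]_m) (Y : set 'rV[R]_n) : Prop :=
  exists f : 'rV[R]_m -> 'rV[R]_n,
    set_bij X Y f /\
    exists cells : seq (seq 'rV[R]_m),
      (forall x, X x <-> exists2 s, s \in cells & hull s x) /\
      forall s, s \in cells -> exists (A : 'M[R]_(m, n)) (b : 'rV[R]_n),
        forall x, hull s x -> f x = x *m A + b.

Definition combinatorial_manifold (R : realType) (d n : nat)
    (K : {set {set 'I_n}}) : Prop :=
  is_complex K /\
  forall v, v \in vertices K ->
    PL_homeomorphic (realization R (link v K))
                    (realization R (boundary_simplex d)).

Section ProjectiveSpace.
Variables (R : realType) (n : nat).

Definition nonzero : set 'rV[R]_n.+1 := [set x | x <> 0].

Definition proportional (x y : nonzero) : bool :=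
  `[< exists2 c : R, c != 0 & set_val y = c *: set_val x >].

Lemma proportional_refl : reflexive proportional.
Proof. by move=> x; apply/asboolP; exists 1; rewrite ?oner_eq0// scale1r. Qed.

Lemma proportional_sym : symmetric proportional.
Proof.
move=> x y; apply/asboolP/asboolP => -[c c0 ->];
  by exists c^-1; rewrite ?invr_eq0// scalerA mulVf// scale1r.
Qed.

Lemma proportional_trans : transitive proportional.
Proof.
move=> y x z /asboolP[c c0 xy] /asboolP[d d0 yz]; apply/asboolP.
by exists (d * c); rewrite ?mulf_neq0// yz xy scalerA.
Qed.

Definition proportional_equiv :=
  EquivRel proportional proportional_refl proportional_sym proportional_trans.

Definition RP : topologicalType :=
  quotient_topology {eq_quot proportional_equiv}.

(* The intersection of the B_i, i in I. *)
Definition equilibrium_set (I : {set 'I_n.+1}) : set RP :=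
  [set q | exists x : nonzero, q = \pi x /\
     forall i j, i \in I -> `|(set_val x : 'rV_n.+1) 0 j| <= `|(set_val x : 'rV_n.+1) 0 i|].

End ProjectiveSpace.

Definition equilibrium_triangulation (R : realType) (d n : nat)
    (K : {set {set 'I_n}}) : Prop :=
  combinatorial_manifold R d K /\
  exists h : realization R K -> RP R d,
    homeomorphism h /\
    forall I : {set 'I_d.+1}, I != finset.set0 ->
      exists L, is_subcomplex L K /\
                h @` subpolyhedron L = equilibrium_set (R := R) I.

Section AntipodalQuotient.
Variables (R : realType) (n : nat) (A : set 'rV[R]_n).

Definition antipodal (x y : A) : bool :=
  (set_val x == set_val y) || (set_val x == - set_val y).

Lemma antipodal_refl : reflexive antipodal.
Proof. by move=> x; rewrite /antipodal eqxx. Qed.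

Lemma antipodal_sym : symmetric antipodal.
Proof.
move=> x y; rewrite /antipodal; congr (_ || _); first exact: eq_sym.
by rewrite -eqr_oppLR eq_sym.
Qed.

Lemma antipodal_trans : transitive antipodal.
Proof.
move=> y x z; rewrite /antipodal.
by move=> /orP[]/eqP-> /orP[]/eqP->; rewrite ?opprK eqxx ?orbT.
Qed.

Definition antipodal_equiv :=
  EquivRel antipodal antipodal_refl antipodal_sym antipodal_trans.

Definition antipodal_quotient : topologicalType :=
  quotient_topology {eq_quot antipodal_equiv}.

(* The image of F, a subset of A, in the quotient. *)
Definition antipodal_image (F : set 'rV[R]_n) : set antipodal_quotient :=
  [set q | exists y : A, F (set_val y) /\ q = \pi y].

End AntipodalQuotient.

Section Subdivision.
Variables (R : realType) (m n : nat) (K : {set {set 'I_m}}) (P : set 'rV[R]_n).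
Implicit Type h : realization R K -> antipodal_quotient (boundary P).

(* h maps the simplex s affinely into the cell of F: it lifts on s to the
   linear map sending the vertex v to the row v of M. *)
Definition straight_in h (F : set 'rV[R]_n) (M : 'M[R]_(m, n))
    (s : {set 'I_m}) : Prop :=
  forall x, closed_simplex s x -> exists y : boundary P,
    [/\ set_val y = set_val x *m M, F (set_val y) & h x = \pi y].

Definition antipodal_subdivision h : Prop :=
  [/\ homeomorphism h,
      forall s, s \in K ->
        exists F M, proper_face P F /\ straight_in h F M s
    & forall F, proper_face P F -> exists L,
        is_subcomplex L K /\
        h @` subpolyhedron L = antipodal_image (A := boundary P) F].

End Subdivision.

Definition base_triangles : seq (seq (seq nat)) :=
  [:: [:: [:: 0; 1; 4]; [:: 2; 3; 7]; [:: 1; 4; 5]; [:: 2; 6; 7];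
          [:: 0; 1; 2]; [:: 4; 5; 7]; [:: 1; 2; 3]; [:: 4; 6; 7];
          [:: 0; 2; 4]; [:: 1; 3; 7]; [:: 2; 4; 6]; [:: 1; 5; 7]];
      [:: [:: 0; 2; 5]; [:: 1; 3; 6]; [:: 0; 5; 7]; [:: 3; 4; 6];
          [:: 1; 5; 6]; [:: 0; 3; 4]; [:: 2; 5; 6]; [:: 0; 3; 7];
          [:: 0; 2; 4]; [:: 1; 3; 7]; [:: 2; 4; 6]; [:: 1; 5; 7]];
      [:: [:: 0; 1; 4]; [:: 2; 3; 7]; [:: 1; 4; 5]; [:: 2; 6; 7];
          [:: 1; 5; 6]; [:: 0; 3; 4]; [:: 2; 5; 6]; [:: 0; 3; 7];
          [:: 0; 1; 6]; [:: 2; 3; 5]; [:: 0; 6; 7]; [:: 3; 4; 5]];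
      [:: [:: 0; 2; 5]; [:: 1; 3; 6]; [:: 0; 5; 7]; [:: 3; 4; 6];
          [:: 0; 1; 2]; [:: 4; 5; 7]; [:: 1; 2; 3]; [:: 4; 6; 7];
          [:: 0; 1; 6]; [:: 2; 3; 5]; [:: 0; 6; 7]; [:: 3; 4; 5]]]%N.

(* The vertex p_i has the label 8 + i. *)
Definition tetrahedra : seq (seq nat) :=
  flatten [seq [seq rcons t (8 + i)%N | t <- nth [::] base_triangles i]
          | i <- iota 0 4].

Definition K : {set {set 'I_(8 + 4)}} := complex_of_facets (8 + 4) tetrahedra.

Definition cube_vertex (a : 'I_8) : 'I_(8 + 4) := lshift 4 a.
Definition center_vertex (i : 'I_4) : 'I_(8 + 4) := rshift 8 i.

Definition tetrahedron (a b c : 'I_8) (i : 'I_4) : {set 'I_(8 + 4)} :=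
  [set cube_vertex a; cube_vertex b; cube_vertex c; center_vertex i]%SET.

(* The tetrahedra of K in each facet F of P are a b c p_i and b c d p_i,
   which form a pyramid over the square a b d c triangulated by its diagonal
   b c, and a b c p_j and b c d p_j, which form the opposite pyramid; the three
   equatorial squares say that F is a regular octahedron. *)
Definition octahedra_from_pyramids (R : realType) (P : set 'rV[R]_4)
    (h : realization R K -> antipodal_quotient (boundary P)) : Prop :=
  forall F, dface P 3 F ->
  exists (a b c d : 'I_8) (i j : 'I_4) (M : 'M[R]_(8 + 4, 4)),
  let A := row (cube_vertex a) M in let B := row (cube_vertex b) M in
  let C := row (cube_vertex c) M in let D := row (cube_vertex d) M in
  let U := row (center_vertex i) M in let W := row (center_vertex j) M in
  let T := [:: tetrahedron a b c i; tetrahedron b c d i;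
               tetrahedron a b c j; tetrahedron b c d j] in
  [/\ uniq [:: a; b; c; d] /\ i != j,
      forall s, (s \in K /\ #|s| = 4%N /\
                 h @` closed_simplex s `<=` antipodal_image (A := boundary P) F)
                <-> s \in T,
      forall s, s \in T -> straight_in h F M s,
      [/\ is_square A B D C, is_square A U D W & is_square B U C W]
    & [/\ hull [:: A; B; C; D] = hull [:: A; B; C] `|` hull [:: B; C; D],
          hull [:: A; B; C; D; U] = hull [:: A; B; C; U] `|` hull [:: B; C; D; U],
          hull [:: A; B; C; D; W] = hull [:: A; B; C; W] `|` hull [:: B; C; D; W],
          F = hull [:: A; B; C; D; U] `|` hull [:: A; B; C; D; W]
        & F = hull [:: A; B; C; D; U; W]]].

(* Main.v *)
Require Import Defs.
From HB Require Import structures.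
From mathcomp Require Import all_boot all_order all_algebra.
From mathcomp Require Import all_classical all_reals.
From mathcomp Require Import topology normedtype.
From mathcomp Require Import ring.

(* Lift the cube vertices 0, ..., 7 to points of {1, -1}^4 and p_i to 2 e_i, up
   to sign. These points and their negatives are the vertices of a 24-cell
   whose facets are cut out by the 24 roots r of D4, as the sets where <r, x>
   attains its maximum 2. On each tetrahedron of K the signs can be chosen so
   that its lift lies in one facet; the cones over these lifts and their
   negatives form a complete, centrally symmetric simplicial fan, because any
   two of them are separated by D4 roots, and every cone has D4 roots as facet
   normals. Radial projection along this fan gives both homeomorphisms: onto
   RP^3, where B_i is the union of the cones with apex p_i, and onto the
   boundary of the 24-cell modulo the antipodal map, where the fan refines the
   face fan. The faces of the 24-cell are classified by folding linear
   functionals into a Weyl chamber of F4, and the links of K are spheres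
   because they arise from the boundary of a tetrahedron by stellar
   subdivisions. *)

Set Implicit Arguments.
Unset Strict Implicit.
Unset Printing Implicit Defensive.

Import Order.TTheory GRing.Theory Num.Theory.
Import numFieldNormedType.Exports.
Local Open Scope classical_set_scope.
Local Open Scope ring_scope.
Local Open Scope quotient_scope.
Local Open Scope card_scope.

(** * Stellar subdivisions and vertex links *)

(** No choice of signs lifts all of [K] at once, since a loop in RP^3 may exchange a point with its
    antipode. The lift of a cube vertex is therefore fixed only relative to an apex, by making the
    coordinate of that apex positive, and every comparison of two tetrahedra carries a boolean for
    the remaining sign. [sign_check] and [agree_check] are the finite facts that make the local
    lifts fit together in the quotient. Nothing can be evaluated over the abstract field [R], so the
    combinatorics is decided on integer lists and carried over by [vecR]. Halved, the roots give the
    dual bases of the simplicial cones; hence the barycentric coordinates in the fan have an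
    explicit formula, [Lam], and continuity of the inverse maps is read off from it. The vertices of
    the 24-cell are twice the 24 Hurwitz units. Quaternion multiplication moves any of them to [e0],
    and the 48 signed permutations of the other coordinates fix [e0]; the 24 * 48 = 1152 products
    form the Weyl group of F4. They serve both to fold functionals and to move flags. *)

Section Facets.
Variables (R : realType) (n : nat).
Implicit Types (fs : seq (seq nat)) (x : 'rV[R]_n).

Lemma in_complex_of_facets fs (s : {set 'I_n}) :
  s \in complex_of_facets n fs =
  (s != finset.set0) &&
  has (fun f => s \subset [set v : 'I_n | val v \in f]%SET) fs.
Proof. by rewrite inE. Qed.

Lemma is_complex_of_facets fs : is_complex (complex_of_facets n fs).
Proof.
split=> [|s t]; first by rewrite inE eqxx.
rewrite !inE => /andP[_ /hasP[f ffs sf]] ts -> /=.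
by apply/hasP; exists f => //; exact: (fintype.subset_trans ts).
Qed.

Lemma realization_facets fs x :
  realization R (complex_of_facets n fs) x <->
  [/\ forall i, 0 <= x 0 i, \sum_i x 0 i = 1
    & exists2 f, f \in fs & forall i : 'I_n, val i \notin f -> x 0 i = 0].
Proof.
split=> [[x0 [x1]]|[x0 x1 [f ffs xf]]].
  rewrite inE => /andP[_ /hasP[f ffs /fintype.subsetP sf]]; split=> //.
  exists f => // i; apply: contraNeq => xi.
  by have := sf i; rewrite !inE; apply.
split=> //; split=> //; rewrite inE; apply/andP; split.
  apply/eqP => s0; have : \sum_i x 0 i = 0.
    apply: big1 => i _; apply/eqP; apply: contraT => xi.
    by have := finset.in_set0 i; rewrite -s0 inE xi.
  by rewrite x1 => /eqP; rewrite oner_eq0.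
apply/hasP; exists f => //; apply/fintype.subsetP => i; rewrite !inE.
by apply: contraNT => /xf ->.
Qed.

Lemma complex_of_facets_mono fs gs :
  all (fun f => has (fun g => all (mem g) f) gs) fs ->
  complex_of_facets n fs \subset complex_of_facets n gs.
Proof.
move=> /allP sub; apply/fintype.subsetP => s; rewrite !inE => /andP[-> /hasP[f ffs sf]] /=.
have /hasP[g ggs /allP fg] := sub f ffs.
apply/hasP; exists g => //; apply: (fintype.subset_trans sf).
by apply/fintype.subsetP => v; rewrite !inE => /fg.
Qed.

Definition link_facets (v : nat) fs :=
  [seq [seq w <- f | w != v] | f <- fs & v \in f].

Lemma link_complex_of_facets (v : 'I_n) fs :
  link v (complex_of_facets n fs) = complex_of_facets n (link_facets v fs).
Proof.
apply/setP => s; rewrite /link inE !in_complex_of_facets.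
apply/andP/andP => [[/andP[s0 _] /andP[vs /andP[_ /hasP[f ffs sf]]]]|].
  split=> //; apply/hasP; exists [seq w <- f | w != val v].
    apply/mapP; exists f => //; rewrite mem_filter ffs andbT.
    by have /fintype.subsetP /(_ v) := sf; rewrite !inE eqxx; apply.
  apply/fintype.subsetP => w ws; rewrite inE mem_filter; apply/andP; split.
    by apply: contraNneq vs => /val_inj <-.
  by have /fintype.subsetP /(_ w) := sf; rewrite !inE ws orbT; apply.
move=> [s0 /hasP[g /mapP[f]]]; rewrite mem_filter => /andP[vf ffs] -> /fintype.subsetP sf.
have sf' : s \subset [set w : 'I_n | val w \in f]%SET.
  by apply/fintype.subsetP => w /sf; rewrite !inE mem_filter => /andP[].
rewrite s0; split; first by apply/hasP; exists f.
apply/and3P; split.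
- by apply/negP => /sf; rewrite inE mem_filter eqxx.
- by apply/set0Pn; exists v; rewrite !inE eqxx.
apply/hasP; exists f => //; rewrite finset.subUset sf' andbT.
by apply/fintype.subsetP => w; rewrite !inE => /eqP ->.
Qed.

(** [op] pairs the face to be subdivided with the new vertex. In a facet containing the face, the
    new vertex takes the place of each vertex of the face in turn. *)
Definition stellar (op : seq nat * nat) fs : seq (seq nat) :=
  flatten [seq if all (mem f) op.1
               then [seq op.2 :: [seq w <- f | w != u] | u <- op.1]
               else [:: f] | f <- fs].

Definition stellar_ok (op : seq nat * nat) fs :=
  [&& op.2 < n, op.2 \notin flatten fs, op.1 != [::], uniq op.1
    & all (fun u => (u < n) && (u != op.2)) op.1]%N.

Lemma mem_stellar op fs g : (g \in stellar op fs) <->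
  exists2 f, f \in fs &
   (all (mem f) op.1 /\ exists2 u, u \in op.1 & g = op.2 :: [seq w <- f | w != u])
   \/ (~~ all (mem f) op.1 /\ g = f).
Proof.
split=> [/flattenP[t /mapP[f ffs ->]]|[f ffs fg]].
  case: ifPn => [Ff /mapP[u uF ->]|nF].
    by exists f => //; left; split=> //; exists u.
  by rewrite inE => /eqP ->; exists f => //; right.
apply/flattenP; exists (if all (mem f) op.1
               then [seq op.2 :: [seq w <- f | w != u] | u <- op.1]
               else [:: f]); first by apply/mapP; exists f.
case: fg => [[-> [u uF ->]]|[/negbTE -> ->]]; last by rewrite inE.
by apply/mapP; exists u.
Qed.

(* The new vertex goes to the barycenter of the subdivided face. *)
Definition stellar_mx (op : seq nat * nat) : 'M[R]_n :=
  \matrix_(i, j) (if val i == op.2 then (val j \in op.1)%:R / (size op.1)%:R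
                  else (i == j)%:R).

Section StellarBij.
Variables (op : seq nat * nat) (fs : seq (seq nat)).
Hypothesis ok : stellar_ok op fs.
Let F := op.1.
Let pn : (op.2 < n)%N. Proof. by case/and5P: ok. Qed.
Let p : 'I_n := Ordinal pn.
Let k : R := (size F)%:R.

Let k0 : 0 < k.
Proof. by case/and5P: ok => _ _ F0 _ _; rewrite /k ltr0n lt0n size_eq0. Qed.

Let pF : val p \notin F.
Proof.
case/and5P: ok => _ _ _ _ /allP Fn; apply/negP => /Fn /andP[_].
by rewrite eqxx.
Qed.

Let pf f : f \in fs -> val p \notin f.
Proof.
case/and5P: ok => _ + _ _ _ ffs; apply: contra => pf.
by apply/flattenP; exists f.
Qed.

Lemma stellar_mxE x j : (x *m stellar_mx op) 0 j =
  (if j == p then 0 else x 0 j) + x 0 p * (val j \in F)%:R / k.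
Proof.
rewrite mxE (bigD1 p) //= mxE eqxx mulrA [LHS]addrC; congr (_ + _).
case: eqVneq => [->|jp].
  rewrite big1 // => i ip; rewrite mxE; case: eqP => [ip'|_].
    by rewrite (_ : i = p) ?eqxx // in ip; apply/val_inj.
  by rewrite (negbTE ip) mulr0.
rewrite (bigD1 j) //= mxE; case: eqP => [ip'|_].
  by rewrite (_ : j = p) ?eqxx // in jp; apply/val_inj.
rewrite eqxx mulr1 big1 ?addr0 // => i /andP[ip ij].
rewrite mxE; case: eqP => [ip'|_]; last by rewrite (negbTE ij) mulr0.
by rewrite (_ : i = p) ?eqxx // in ip; apply/val_inj.
Qed.

Let sumF : \sum_(j < n) (val j \in F)%:R = k.
Proof.
case/and5P: ok => _ _ _ uF /allP Fn.
rewrite -natr_sum /k; congr (_%:R).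
have -> : \sum_(j < n) (val j \in F : nat) = count (mem F) (iota 0 n).
  by rewrite -sumn_count sumnE big_map -val_enum_ord big_map big_enum.
rewrite -size_filter; apply/perm_size/uniq_perm => //.
  by rewrite filter_uniq ?iota_uniq.
move=> u; rewrite mem_filter mem_iota add0n /= andb_idr // => uF'.
by have /andP[] := Fn u uF'.
Qed.


Let argminF (y : 'rV[R]_n) :
  exists2 u : 'I_n, val u \in F & forall w : 'I_n, val w \in F -> y 0 u <= y 0 w.
Proof.
case/and5P: ok => _ _ + _ /allP Fn; rewrite -/F in Fn *.
case: F Fn => [//|a F' Fn _].
have /andP[an _] := Fn a (mem_head _ _).
have aF : [pred i : 'I_n | val i \in a :: F'] (Ordinal an) by exact: mem_head.
by case: (arg_minP (fun i : 'I_n => y 0 i) aF) => u uF umin; exists u.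
Qed.

Let stellar_zero x : realization R (complex_of_facets n (stellar op fs)) x ->
  exists2 u : 'I_n, val u \in F & x 0 u = 0.
Proof.
move=> /realization_facets[x0 x1 [g /mem_stellar[f ffs fg] xg]].
case/and5P: ok => _ _ _ _ /allP Fn.
case: fg => [[_ [u uF gE]]|[/allPn[u uF uf] gE]];
  have /andP[un up] := Fn u uF; exists (Ordinal un) => //; apply: xg; rewrite gE //=.
by rewrite inE (negbTE up) mem_filter eqxx.
Qed.

(** No simplex of the subdivision contains all of the face [F], so every point has a zero coordinate
    on [F]. Hence the weight of the new vertex divided by [k] is the minimum over [F] of the
    coordinates of the image, and the inverse map splits off this minimum. *)
Lemma stellar_bij :
  set_bij (realization R (complex_of_facets n (stellar op fs)))
          (realization R (complex_of_facets n fs))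
          (fun x => x *m stellar_mx op).
Proof.
split.
- move=> x /realization_facets[x0 x1 [g /mem_stellar[f ffs fg] xg]].
  apply/realization_facets; split.
  + move=> i; rewrite stellar_mxE addr_ge0 //; first by case: ifP.
    by rewrite divr_ge0 ?mulr_ge0 // ltW.
  + transitivity (\sum_j ((if j == p then 0 else x 0 j) + x 0 p * (val j \in F)%:R / k)).
      by apply: eq_bigr => j _; exact: stellar_mxE.
    rewrite big_split /= -mulr_suml -mulr_sumr sumF mulfK ?gt_eqF //.
    rewrite -[RHS]x1 [RHS](bigD1 p) //= addrC; congr (_ + _).
    by rewrite (bigD1 p) //= eqxx add0r; apply: eq_bigr => j /negbTE ->.
  + exists f => // j jf; rewrite stellar_mxE.
    case: fg => [[/allP Ff [u uF gE]]|[nF gE]].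
      rewrite (negbTE (_ : val j \notin F)); last by apply: contra jf => /Ff.
      rewrite mulr0 mul0r addr0; case: eqP => // /eqP jp; apply: xg.
      by rewrite gE inE negb_or mem_filter negb_and jf orbT andbT.
    rewrite [x 0 p]xg ?mul0r ?addr0; last by rewrite gE pf.
    by case: eqP => // _; apply: xg; rewrite gE.
- move=> x x'; rewrite !inE => Xx Xx' /rowP E.
  have Ej j : (if j == p then 0 else x 0 j) + x 0 p * (val j \in F)%:R / k =
              (if j == p then 0 else x' 0 j) + x' 0 p * (val j \in F)%:R / k.
    by rewrite -!stellar_mxE E.
  have /realization_facets[x0 _ _] := Xx.
  have /realization_facets[x0' _ _] := Xx'.
  have Fp (u : 'I_n) : val u \in F -> u == p = false.
    by move=> uF; apply/eqP => up; rewrite up (negbTE pF) in uF.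
  (* The equations at a zero of [x] and at a zero of [x'] give the two inequalities between the new
     weights. *)
  have xp : x 0 p = x' 0 p.
    have [u uF xu] := stellar_zero Xx; have [u' uF' xu'] := stellar_zero Xx'.
    have := Ej u; have := Ej u'; rewrite !Fp // uF uF' xu xu' !mulr1 !add0r => e1 e2.
    have ik : 0 < k^-1 by rewrite invr_gt0.
    apply/eqP; rewrite eq_le -(ler_pM2r ik) -[X in _ && X](ler_pM2r ik).
    by rewrite -{1}e1 e2 lerDr lerDr x0 x0'.
  apply/rowP => j; have := Ej j; case: (eqVneq j p) => [->//|_].
  by rewrite xp => /addIr.
- move=> y /realization_facets[y0 y1 [f ffs yf]].
  have [u uF umin] := argminF y.
  have yp : y 0 p = 0 by apply: yf; exact: pf.
  pose x : 'rV[R]_n := \row_j (if j == p then k * y 0 u else y 0 j - (val j \in F)%:R * y 0 u).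
  have Fp (w : 'I_n) : val w \in F -> w == p = false.
    by move=> wF; apply/eqP => up; rewrite up (negbTE pF) in wF.
  exists x; last first.
    apply/rowP => j; rewrite stellar_mxE !mxE eqxx.
    case: (eqVneq j p) => [->|jp].
      by rewrite (negbTE pF) mulr0 mul0r addr0 yp.
    by field; rewrite gt_eqF.
  apply/realization_facets; split.
  + move=> i; rewrite mxE; case: ifP => _; first by rewrite mulr_ge0 // ltW.
    by case: (boolP (val i \in F)) => [/umin ui|_]; rewrite ?mul1r ?mul0r ?subr0 ?subr_ge0.
  + rewrite (bigD1 p) //= mxE eqxx.
    rewrite (eq_bigr (fun j => y 0 j - (val j \in F)%:R * y 0 u)); last first.
      by move=> j /negbTE jp; rewrite mxE jp.
    rewrite sumrB -mulr_suml.
    have -> : \sum_(i | i != p) y 0 i = 1 by rewrite -y1 [RHS](bigD1 p) //= yp add0r.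
    have -> : \sum_(i < n | i != p) (val i \in F)%:R = k.
      by rewrite -sumF [RHS](bigD1 p) //= (negbTE pF) add0r.
    by ring.
  + have [Ff|nF] := boolP (all (mem f) F).
      exists (op.2 :: [seq w <- f | w != val u]).
        by apply/mem_stellar; exists f => //; left; split=> //; exists (val u).
      move=> i; rewrite inE negb_or mem_filter negb_and negbK => /andP[ip iuf].
      rewrite mxE; case: eqP => [ip'|_]; first by rewrite ip' eqxx in ip.
      case/orP: iuf => [/eqP/val_inj ->|iF]; first by rewrite uF mul1r subrr.
      rewrite yf // (negbTE (_ : val i \notin F)) ?mul0r ?subr0 //.
      by apply: contra iF; move/allP: Ff => /[apply].
    (* A vertex of [F] outside [f] has coordinate 0, so the minimum is 0 and [y] stays where it
       is. *)
    have yu : y 0 u = 0.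
      apply/eqP; rewrite eq_le y0 andbT.
      have [w wF wf] := allPn nF.
      case/and5P: ok => _ _ _ _ /allP /(_ w wF) /andP[wn _].
      by rewrite -(yf (Ordinal wn) wf) umin.
    exists f; first by apply/mem_stellar; exists f => //; right.
    by move=> i /yf yi; rewrite mxE yu !mulr0 yi subr0 if_same.
Qed.

End StellarBij.

Fixpoint stellars (ops : seq (seq nat * nat)) fs :=
  if ops is op :: ops' then stellars ops' (stellar op fs) else fs.

Fixpoint stellars_ok (ops : seq (seq nat * nat)) fs :=
  if ops is op :: ops' then stellar_ok op fs && stellars_ok ops' (stellar op fs)
  else true.

Lemma stellars_bij ops fs : stellars_ok ops fs ->
  exists M : 'M[R]_n,
    set_bij (realization R (complex_of_facets n (stellars ops fs)))
            (realization R (complex_of_facets n fs)) (fun x => x *m M).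
Proof.
elim: ops fs => [|op ops IH] fs /=.
  move=> _; exists 1%:M; split.
  - by move=> x; rewrite mulmx1.
  - by move=> x y _ _; rewrite !mulmx1.
  - by move=> x Xx; exists x; rewrite ?mulmx1.
move=> /andP[ok /IH[M Mbij]]; exists (M *m stellar_mx op).
have := set_bij_comp Mbij (stellar_bij ok).
by congr set_bij; apply/funext => x /=; rewrite mulmxA.
Qed.

Definition boundary_facets (W : seq nat) := [seq [seq w <- W | w != u] | u <- W].

End Facets.

(** The matrix reads off the coordinates at the vertices of [W]; the boundary of the simplex is
    where one of them vanishes. *)
Lemma boundary_facets_bij (R : realType) (n d : nat) (W : d.+1.-tuple 'I_n) : uniq W ->
  exists M : 'M[R]_(n, d.+1),
    set_bij (realization R (complex_of_facets n (boundary_facets (map val W))))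
            (realization R (boundary_simplex d)) (fun x => x *m M).
Proof.
move=> uW; pose M : 'M[R]_(n, d.+1) := \matrix_(i, j) (i == tnth W j)%:R.
have ME (x : 'rV[R]_n) j : (x *m M) 0 j = x 0 (tnth W j).
  rewrite mxE (bigD1 (tnth W j)) //= mxE eqxx mulr1 big1 ?addr0 // => i ij.
  by rewrite mxE (negbTE ij) mulr0.
have injW : injective (tnth W) by exact/tuple_uniqP.
have memW i : (val i \in map val W) = [exists j, i == tnth W j].
  rewrite mem_map; last exact: val_inj.
  apply/idP/existsP => [/tnthP[j ->]|[j /eqP ->]]; [by exists j|exact: mem_tnth].
have bdP (y : 'rV[R]_d.+1) : realization R (boundary_simplex d) y <->
  [/\ forall i, 0 <= y 0 i, \sum_i y 0 i = 1 & exists j, y 0 j = 0].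
  split=> [[y0 [y1]]|[y0 y1 [j yj]]].
    rewrite inE => /andP[_ /eqP nT]; split=> //; apply: contrapT => ny.
    apply: nT; apply/setP => j; rewrite !inE; apply/eqP => yj.
    by apply: ny; exists j.
  split=> //; split=> //; rewrite inE; apply/andP; split; last first.
    by apply/eqP => /setP /(_ j); rewrite !inE yj eqxx.
  apply/eqP => s0; have : \sum_i y 0 i = 0.
    apply: big1 => i _; apply/eqP; apply: contraT => xi.
    by have := finset.in_set0 i; rewrite -s0 inE xi.
  by rewrite y1 => /eqP; rewrite oner_eq0.
have sumW (x : 'rV[R]_n) : (forall i, val i \notin map val W -> x 0 i = 0) ->
    \sum_j x 0 (tnth W j) = \sum_i x 0 i.
  move=> xW; rewrite -(big_tuple _ _ W xpredT (fun i => x 0 i)) big_uniq //=.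
  rewrite [RHS](bigID [in W]) /= [X in _ + X]big1 ?addr0 // => i iW; apply: xW.
  by rewrite mem_map //; exact: val_inj.
exists M; split.
- move=> x /realization_facets[x0 x1 [f /mapP[u uWW ->] xf]]; apply/bdP; split.
  + by move=> i; rewrite ME.
  + rewrite (eq_bigr (fun j => x 0 (tnth W j))) => [|j _]; last exact: ME.
    by rewrite sumW // => i iW; apply: xf; rewrite mem_filter (negbTE iW) andbF.
  + have /mapP[w wW uw] := uWW; have /tnthP[j wj] := wW; exists j.
    by rewrite ME -wj xf // mem_filter uw eqxx.
- move=> x x'; rewrite !inE => /realization_facets[_ _ [f /mapP[u _ ->] xf]].
  move=> /realization_facets[_ _ [f' /mapP[u' _ ->] xf']] /rowP E.
  apply/rowP => i; have [/tnthP[j ->]|iW] := boolP (i \in W).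
    by rewrite -!ME E.
  rewrite xf ?xf' // mem_filter negb_and orbC (_ : (val i \in map val W) = false) //;
    by rewrite mem_map ?(negbTE iW) //; exact: val_inj.
- move=> y /bdP[y0 y1 [j yj]].
  pose x : 'rV[R]_n := \row_i \sum_j (i == tnth W j)%:R * y 0 j.
  have xW l : x 0 (tnth W l) = y 0 l.
    rewrite mxE (bigD1 l) //= eqxx mul1r big1 ?addr0 // => m ml.
    by rewrite (inj_eq injW) eq_sym (negbTE ml) mul0r.
  have xn i : val i \notin map val W -> x 0 i = 0.
    rewrite memW negb_exists => /forallP iW; rewrite mxE big1 // => m _.
    by rewrite (negbTE (iW m)) mul0r.
  exists x; last by apply/rowP => l; rewrite ME xW.
  apply/realization_facets; split.
  + by move=> i; rewrite mxE sumr_ge0 // => m _; rewrite mulr_ge0.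
  + by rewrite -sumW // -[RHS]y1; apply: eq_bigr => l _.
  + exists [seq w <- map val W | w != val (tnth W j)].
      by apply/mapP; exists (val (tnth W j)) => //; rewrite map_f ?mem_tnth.
    move=> i; rewrite mem_filter negb_and negbK => /orP[/eqP/val_inj ->|/xn //].
    by rewrite xW.
Qed.

(** [hull] attaches weights to positions in a list. For a list without repetitions they can be
    attached to the elements, which makes combinations over different lists comparable. *)
Lemma hull_mapP (R : realType) (n : nat) (T : eqType) (f : T -> 'rV[R]_n)
    (l : seq T) (x : 'rV[R]_n) : uniq l ->
  hull (map f l) x <->
  exists w : T -> R, [/\ forall t, t \in l -> 0 <= w t, \sum_(t <- l) w t = 1
    & x = \sum_(t <- l) w t *: f t].
Proof.
case: l => [|t0 l'].
  move=> _; split=> -[w [_ + _]]; rewrite ?big_ord0 ?big_nil => /eqP;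
  by rewrite eq_sym oner_eq0.
set l := t0 :: l' => ul.
have sE (V : nmodType) (G : nat -> V) :
    \sum_(i < size (map f l)) G i = \sum_(0 <= i < size l) G i.
  by rewrite -(big_mkord xpredT G) size_map.
split=> [[w [w0 w1 ->]]|[w [w0 w1 ->]]].
  pose wn i : R := if insub i is Some j then w j else 0.
  have wnE (i : 'I_(size (map f l))) : w i = wn i by rewrite /wn valK.
  exists (fun t => wn (index t l)); split.
  - by move=> t _; rewrite /wn; case: insubP.
  - rewrite -w1 (eq_bigr (fun i => wn (val i))) // sE (big_nth t0).
    by apply: eq_big_nat => i /andP[_ il]; rewrite index_uniq.
  - rewrite (eq_bigr (fun i : 'I__ => wn i *: (map f l)`_i)); last first.
      by move=> i _; rewrite wnE.
    rewrite (sE _ (fun i => wn i *: (map f l)`_i)) (big_nth t0).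
    by apply: eq_big_nat => i /andP[_ il]; rewrite index_uniq // (nth_map t0).
exists (fun i => w (nth t0 l i)); split.
- by move=> i; apply/w0/mem_nth; rewrite -(size_map f).
- by rewrite (sE _ (fun i => w (nth t0 l i))) -w1 [RHS](big_nth t0).
- rewrite (sE _ (fun i => w (nth t0 l i) *: (map f l)`_i)) (big_nth t0).
  by apply: eq_big_nat => i /andP[_ il]; rewrite (nth_map t0).
Qed.

(** The cells are the simplices themselves, as hulls of standard basis vectors, and the same matrix
    serves on all of them. *)
Lemma PL_homeomorphic_linear (R : realType) (m n : nat) (L : {set {set 'I_m}})
    (Y : set 'rV[R]_n) (M : 'M[R]_(m, n)) :
  is_complex L -> set_bij (realization R L) Y (fun x => x *m M) ->
  PL_homeomorphic (realization R L) Y.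
Proof.
move=> [L0 Ls] Mbij; exists (fun x => x *m M); split=> //.
pose cell (s : {set 'I_m}) : seq 'rV[R]_m := [seq delta_mx 0 i | i <- enum s].
exists [seq cell s | s <- enum L]; split; last first.
  by move=> s _; exists M, 0 => x _; rewrite addr0.
have cellP s x : hull (cell s) x <->
    [/\ forall i, 0 <= x 0 i, \sum_i x 0 i = 1 & forall i, i \notin s -> x 0 i = 0].
  rewrite /cell hull_mapP ?enum_uniq //; split=> [[w [w0 w1 xE]]|[x0 x1 xs]].
    have xw a : x 0 a = if a \in s then w a else 0.
      rewrite xE summxE big_enum /=; case: ifPn => aS.
        rewrite (bigD1 a) //= !mxE !eqxx mulr1 big1 ?addr0 // => b /andP[_ ba].
        by rewrite !mxE eqxx /= eq_sym (negbTE ba) mulr0.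
      rewrite big1 // => b bs; rewrite !mxE eqxx /=.
      by case: eqP => [ab|_]; rewrite ?mulr0 // -ab (negbTE aS) in bs *.
    split=> [a||a /negbTE aS]; last by rewrite xw aS.
      by rewrite xw; case: ifPn => // aS; apply: w0; rewrite mem_enum.
    rewrite -w1 [RHS]big_enum /= [RHS]big_mkcond /=.
    by apply: eq_bigr => a _; rewrite xw.
  exists (fun a => x 0 a); split=> //.
    rewrite -x1 big_enum /= big_mkcond /=.
    by apply: eq_bigr => a _; case: ifPn => // /xs.
  rewrite big_enum /= big_mkcond [LHS]row_sum_delta; apply: eq_bigr => a _.
  by case: ifPn => // /xs ->; rewrite scale0r.
move=> x; split=> [[x0 [x1 xL]]|[c /mapP[s sL ->] /cellP[x0 x1 xs]]].
  exists (cell [set i | x 0 i != 0]%SET); first by rewrite map_f // mem_enum.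
  by apply/cellP; split=> // i; rewrite inE negbK => /eqP.
split=> //; split=> //; apply: (Ls s); first by rewrite mem_enum in sL.
  by apply/fintype.subsetP => i; rewrite inE; apply: contraNT => /xs ->.
apply/eqP => s0; have : \sum_i x 0 i = 0.
  apply: big1 => i _; apply/eqP; apply: contraT => xi.
  by have := finset.in_set0 i; rewrite -s0 inE xi.
by rewrite x1 => /eqP; rewrite oner_eq0.
Qed.

(** Entry [v] is a certificate for the link of [v]: the vertices of a starting tetrahedron, then the
    stellar subdivisions that turn its boundary into the link. Each subdivision adds two triangles,
    so seven of them give the 18 triangles around a cube vertex and four give the 12 around a
    centre. *)
Definition link_data : seq (seq nat * seq (seq nat * nat)) := [::
([:: 1; 2; 3; 4], [:: ([:: 2; 3], 9); ([:: 1; 2; 9], 5); ([:: 1; 9], 7); ([:: 1; 3], 10); ([:: 1; 5], 11); ([:: 1; 7], 6); ([:: 1; 2; 4], 8)]);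
([:: 0; 2; 3; 4], [:: ([:: 2; 4], 8); ([:: 3; 4], 5); ([:: 0; 3; 5], 6); ([:: 3; 5; 8], 7); ([:: 3; 5], 9); ([:: 0; 5], 10); ([:: 0; 3], 11)]);
([:: 0; 1; 3; 4], [:: ([:: 1; 4], 8); ([:: 3; 4], 6); ([:: 0; 3; 6], 5); ([:: 3; 6; 8], 7); ([:: 0; 6], 9); ([:: 3; 6], 10); ([:: 0; 3], 11)]);
([:: 0; 1; 2; 4], [:: ([:: 2; 4], 5); ([:: 0; 5], 10); ([:: 0; 2], 7); ([:: 0; 1], 9); ([:: 1; 5], 11); ([:: 1; 4], 6); ([:: 1; 2; 7], 8)]);
([:: 0; 1; 2; 3], [:: ([:: 1; 2], 8); ([:: 1; 3], 5); ([:: 2; 3], 6); ([:: 3; 8], 7); ([:: 0; 6], 9); ([:: 0; 5], 10); ([:: 3; 7], 11)]);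
([:: 0; 1; 2; 3], [:: ([:: 0; 1; 3], 4); ([:: 0; 3], 11); ([:: 0; 4], 7); ([:: 0; 1], 9); ([:: 1; 3], 10); ([:: 1; 2], 6); ([:: 1; 4; 7], 8)]);
([:: 0; 1; 2; 3], [:: ([:: 2; 3], 4); ([:: 0; 3], 11); ([:: 0; 4], 7); ([:: 1; 4], 9); ([:: 0; 2], 10); ([:: 1; 2], 5); ([:: 2; 4; 7], 8)]);
([:: 0; 1; 2; 3], [:: ([:: 1; 2], 8); ([:: 0; 1; 8], 4); ([:: 1; 4], 5); ([:: 0; 8], 6); ([:: 0; 1], 9); ([:: 0; 2], 10); ([:: 0; 4], 11)]);
([:: 0; 1; 2; 3], [:: ([:: 0; 3], 4); ([:: 3; 4], 7); ([:: 1; 4; 7], 5); ([:: 2; 4; 7], 6)]);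
([:: 0; 1; 2; 3], [:: ([:: 1; 2], 6); ([:: 2; 3], 4); ([:: 0; 6], 5); ([:: 0; 1], 7)]);
([:: 0; 1; 2; 3], [:: ([:: 1; 2], 5); ([:: 1; 3], 4); ([:: 0; 5], 6); ([:: 0; 2], 7)]);
([:: 0; 1; 2; 3], [:: ([:: 0; 2; 3], 4); ([:: 2; 4], 5); ([:: 0; 3], 6); ([:: 0; 4], 7)])]%N.

(** Facets are compared by mutual containment because the subdivisions produce them in a different
    order. *)
Definition link_check (v : nat) : bool :=
  let: (W, ops) := nth ([::], [::]) link_data v in
  let fs := stellars ops (boundary_facets W) in
  let gs := link_facets v tetrahedra in
  [&& size W == 4, uniq W, all (fun u => u < 8 + 4)%N W,
      stellars_ok (8 + 4) ops (boundary_facets W),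
      all (fun f => has (fun g => all (mem g) f) gs) fs
    & all (fun f => has (fun g => all (mem g) f) fs) gs].

Lemma link_check_all : all link_check (iota 0 12).
Proof. by vm_compute. Qed.

Lemma combinatorial_manifold_K (R : realType) : combinatorial_manifold R 3 K.
Proof.
split; first exact: is_complex_of_facets.
move=> v _; rewrite /K link_complex_of_facets.
have := allP link_check_all v; rewrite mem_iota /= => /(_ (ltn_ord v)).
rewrite /link_check; case: (nth _ _ _) => W ops.
move=> /and5P[/eqP sW uW /allP Wn ok /andP[sub1 sub2]].
have -> : complex_of_facets (8 + 4) (link_facets v tetrahedra) =
          complex_of_facets (8 + 4) (stellars ops (boundary_facets W)).
  by apply/eqP; rewrite finset.eqEsubset !complex_of_facets_mono.
have [M Mbij] := stellars_bij R ok.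
pose W' : 3.+1.-tuple 'I_(8 + 4) := [tuple inord (nth 0%N W i) | i < 3.+1].
have WE : map val W' = W.
  rewrite /= -map_comp; apply: (@eq_from_nth _ 0%N).
    by rewrite size_map size_enum_ord sW.
  rewrite size_map size_enum_ord => i i4.
  rewrite (nth_map ord0) ?size_enum_ord //= nth_enum_ord // inordK //.
  by apply: Wn; rewrite mem_nth ?sW.
have [|N Nbij] := @boundary_facets_bij R (8 + 4) 3 W'.
  by rewrite -(map_inj_uniq val_inj) WE.
rewrite WE in Nbij; apply: (@PL_homeomorphic_linear _ _ _ _ _ (M *m N)).
  exact: is_complex_of_facets.
have := set_bij_comp Mbij Nbij.
by congr set_bij; apply/funext => x /=; rewrite mulmxA.
Qed.

Lemma card_vertices_K : #|vertices K| = 12.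
Proof.
rewrite (_ : vertices K = finset.setT) ?cardsT ?card_ord //.
apply/setP => v; rewrite !inE; apply/andP; split.
  by apply/set0Pn; exists v; rewrite inE.
have : all (fun v => has (fun f => v \in f) tetrahedra) (iota 0 12) by [].
move=> /allP /(_ (val v)); rewrite mem_iota => /(_ (ltn_ord v)) /hasP[f ft vf].
by apply/hasP; exists f => //; apply/fintype.subsetP => w; rewrite !inE => /eqP ->.
Qed.

(** * The faces of the 24-cell *)

Definition dotz (u v : seq int) : int :=
  u`_0 * v`_0 + u`_1 * v`_1 + u`_2 * v`_2 + u`_3 * v`_3.

Definition axis (i : nat) (s : int) : seq int :=
  mkseq (fun k => if k == i then s else 0) 4.

Fixpoint sign_vectors (n : nat) : seq (seq int) :=
  if n is n'.+1 then [seq s :: w | s <- [:: 1; -1], w <- sign_vectors n']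
  else [:: [::]].

(* Locked to keep unification from evaluating the lists. *)
HB.lock Definition V24 : seq (seq int) :=
  [seq axis i s | i <- iota 0 4, s <- [:: 2; -2]] ++ sign_vectors 4.

HB.lock Definition roots : seq (seq int) :=
  [seq mkseq (fun k => if k == ij.1 then st`_0 else if k == ij.2 then st`_1 else 0) 4
  | ij <- [:: (0, 1); (0, 2); (0, 3); (1, 2); (1, 3); (2, 3)]%N,
    st <- sign_vectors 2].

Section Vectors.
Variable R : realType.
Implicit Types (u v : seq int) (c x y : 'rV[R]_4).

Definition vecR u : 'rV[R]_4 := \row_j (u`_j)%:~R.

Lemma dotE n (c x : 'rV[R]_n) : dot c x = \sum_j c 0 j * x 0 j.
Proof. by rewrite /dot mxE; apply: eq_bigr => j _; rewrite mxE. Qed.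

Lemma dotC n (c x : 'rV[R]_n) : dot c x = dot x c.
Proof. by rewrite !dotE; apply: eq_bigr => j _; rewrite mulrC. Qed.

Lemma dotDr n (c x y : 'rV[R]_n) : dot c (x + y) = dot c x + dot c y.
Proof. by rewrite /dot linearD mulmxDr mxE. Qed.

Lemma dotZr n a (c x : 'rV[R]_n) : dot c (a *: x) = a * dot c x.
Proof. by rewrite /dot linearZ -scalemxAr mxE. Qed.

Lemma dotNr n (c x : 'rV[R]_n) : dot c (- x) = - dot c x.
Proof. by rewrite -scaleN1r dotZr mulN1r. Qed.

Lemma dot0r n (c : 'rV[R]_n) : dot c 0 = 0.
Proof. by rewrite -(scale0r 0) dotZr mul0r. Qed.

Lemma dot_sumr n (c : 'rV[R]_n) (I : Type) (r : seq I) (P : pred I) (f : I -> 'rV[R]_n) :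
  dot c (\sum_(i <- r | P i) f i) = \sum_(i <- r | P i) dot c (f i).
Proof.
by apply: (big_morph (dot c)); [exact: dotDr|exact: dot0r].
Qed.

Lemma dot_mulmx n m (A : 'M[R]_(n, m)) (c : 'rV[R]_n) (x : 'rV[R]_m) :
  dot (c *m A) x = dot c (x *m A^T).
Proof. by rewrite /dot trmx_mul trmxK mulmxA. Qed.

Lemma dot_vecR u v : dot (vecR u) (vecR v) = (dotz u v)%:~R.
Proof.
rewrite dotE !big_ord_recl big_ord0 !mxE /= /bump /= addr0 !addrA.
by rewrite /dotz !rmorphD !rmorphM.
Qed.

Lemma vecR_inj u v : size u = 4%N -> size v = 4%N -> vecR u = vecR v -> u = v.
Proof.
move=> su sv /rowP uv; apply: (@eq_from_nth _ 0); first by rewrite su sv.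
move=> i; rewrite su => i4; have := uv (Ordinal i4).
by rewrite !mxE => /intr_inj.
Qed.

End Vectors.

Ltac compute_V24 := rewrite ?V24.unlock ?roots.unlock; vm_compute; reflexivity.

Lemma V24_size v : v \in V24 -> size v = 4%N.
Proof.
have : all (fun v => size v == 4%N) V24 by compute_V24.
by move=> /allP H /H /eqP.
Qed.

Lemma V24_neq0 : V24 != [::]. Proof. compute_V24. Qed.

Lemma V24_uniq : uniq V24. Proof. compute_V24. Qed.

Definition P24 (R : realType) : set 'rV[R]_4 := hull (map (vecR R) V24).
Arguments P24 : clear implicits.

Section Faces.
Variable R : realType.
Implicit Types (v : seq int) (c x : 'rV[R]_4) (b : R).
Local Notation vecR := (vecR R).
Local Notation P := (P24 R).

Lemma hull_sub (n : nat) (T : eqType) (f : T -> 'rV[R]_n) (l l' : seq T) :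
  uniq l -> uniq l' -> {subset l <= l'} -> hull (map f l) `<=` hull (map f l').
Proof.
move=> ul ul' ll' x /(hull_mapP _ _ ul)[w [w0 w1 xE]]; apply/(hull_mapP _ _ ul').
have sE (V : nmodType) (G : T -> V) :
    \sum_(t <- l') (if t \in l then G t else 0) = \sum_(t <- l) G t.
  rewrite -big_mkcond /= -big_filter; apply: perm_big; apply: uniq_perm => //.
    exact: filter_uniq.
  by move=> t; rewrite mem_filter andb_idr // => /ll'.
exists (fun t => if t \in l then w t else 0); split.
- by move=> t _; case: ifP => // /w0.
- by rewrite sE.
- rewrite xE -sE; apply: eq_bigr => t _; case: ifP => //.
  by rewrite scale0r.
Qed.

Lemma hull_eq (n : nat) (T : eqType) (f : T -> 'rV[R]_n) (l l' : seq T) :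
  uniq l -> uniq l' -> l =i l' -> hull (map f l) = hull (map f l').
Proof.
by move=> ul ul' ll'; apply/seteqP; split; apply: hull_sub => // t; rewrite ll'.
Qed.

Lemma mem_hull (n : nat) (T : eqType) (f : T -> 'rV[R]_n) (l : seq T) t :
  uniq l -> t \in l -> hull (map f l) (f t).
Proof.
move=> ul tl; apply/hull_mapP => //; exists (fun s => (s == t)%:R); split=> //.
  rewrite (bigD1_seq t) //= eqxx big1 ?addr0 // => s /negbTE -> //.
rewrite (bigD1_seq t) //= eqxx scale1r big1 ?addr0 // => s /negbTE ->.
by rewrite scale0r.
Qed.

Lemma hull_le (T : eqType) (n : nat) (f : T -> 'rV[R]_n) (l : seq T) (c x : 'rV[R]_n) b :
  uniq l -> (forall t, t \in l -> dot c (f t) <= b) -> hull (map f l) x -> dot c x <= b.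
Proof.
move=> ul cb /(hull_mapP _ _ ul)[w [w0 w1 ->]]; rewrite dot_sumr.
rewrite -[b]mul1r -w1 mulr_suml big_seq [leRHS]big_seq.
by apply: ler_sum => t tl; rewrite dotZr ler_wpM2l ?w0 ?cb.
Qed.

(** If a convex combination attains the bound [b], the nonnegative terms [w t * (b - dot c (f t))]
    sum to 0, so only points attaining [b] carry weight. *)
Lemma hull_face (T : eqType) (n : nat) (f : T -> 'rV[R]_n) (l : seq T) (c : 'rV[R]_n) b :
  uniq l -> (forall t, t \in l -> dot c (f t) <= b) ->
  hull (map f l) `&` [set x | dot c x = b] =
  hull (map f [seq t <- l | dot c (f t) == b]).
Proof.
move=> ul cb; have ul' : uniq [seq t <- l | dot c (f t) == b] by exact: filter_uniq.
apply/seteqP; split=> x; last first.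
  move=> xl; split.
    by apply: hull_sub xl => // t; rewrite mem_filter => /andP[].
  move: xl => /(hull_mapP _ _ ul')[w [w0 w1 ->]] /=; rewrite dot_sumr -[RHS]mul1r -w1 mulr_suml.
  apply: eq_big_seq => t; rewrite mem_filter => /andP[/eqP tb _].
  by rewrite dotZr tb.
move=> [/(hull_mapP _ _ ul)[w [w0 w1 xE]] /= cx]; apply/(hull_mapP _ _ ul').
have wz t : t \in l -> dot c (f t) != b -> w t = 0.
  have : \sum_(t <- l) w t * (b - dot c (f t)) == 0.
    rewrite (eq_bigr (fun t => w t * b - w t * dot c (f t))); last first.
      by move=> ? _; rewrite mulrBr.
    rewrite sumrB -mulr_suml w1 mul1r -cx xE dot_sumr subr_eq0.
    by apply/eqP/eq_bigr => ? _; rewrite dotZr.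
  rewrite big_seq psumr_eq0; last by move=> s sl; rewrite mulr_ge0 ?w0 ?subr_ge0 ?cb.
  move=> /allP H tl; have := H t tl; rewrite tl /= mulf_eq0 subr_eq0.
  by move=> /orP[/eqP //|/eqP ->]; rewrite eqxx.
exists w; split.
- by move=> t; rewrite mem_filter => /andP[_]; exact: w0.
- rewrite -w1 big_filter [RHS](bigID (fun t => dot c (f t) == b)) /=.
  rewrite [X in _ + X]big_seq_cond [X in _ + X]big1 ?addr0 // => t /andP[tl tb].
  exact: wz.
- rewrite xE big_filter [LHS](bigID (fun t => dot c (f t) == b)) /=.
  rewrite [X in _ + X]big_seq_cond [X in _ + X]big1 ?addr0 // => t /andP[tl tb].
  by rewrite wz ?scale0r.
Qed.

Definition faceV c b := [seq v <- V24 | dot c (vecR v) == b].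

Lemma mem_faceV c b v : (v \in faceV c b) = (dot c (vecR v) == b) && (v \in V24).
Proof. by rewrite /faceV mem_filter. Qed.

Lemma hull_faceV c b : (forall v, v \in V24 -> dot c (vecR v) <= b) ->
  P `&` [set x | dot c x = b] = hull (map vecR (faceV c b)).
Proof. exact: (hull_face V24_uniq). Qed.

Lemma faceV_uniq c b : uniq (faceV c b).
Proof. exact: (filter_uniq _ V24_uniq). Qed.

Lemma P24_vec v : v \in V24 -> P (vecR v).
Proof. by apply: mem_hull; exact: V24_uniq. Qed.

Lemma P24_le c b x : (forall v, v \in V24 -> dot c (vecR v) <= b) -> P x -> dot c x <= b.
Proof. by apply: hull_le; exact: V24_uniq. Qed.

Lemma faceP F : face P F <-> exists c b,
  (forall v, v \in V24 -> dot c (vecR v) <= b) /\ F = hull (map vecR (faceV c b)).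
Proof.
split=> [[c [b [cb ->]]]|[c [b [cb ->]]]]; exists c, b.
  have cb' v : v \in V24 -> dot c (vecR v) <= b by move=> vV; apply/cb/P24_vec.
  by split; [exact: cb'|exact: hull_faceV].
by split=> [x|]; [exact: P24_le|rewrite hull_faceV].
Qed.

Lemma mem_faceV_hull c b v : (forall v, v \in V24 -> dot c (vecR v) <= b) ->
  v \in V24 -> hull (map vecR (faceV c b)) (vecR v) -> v \in faceV c b.
Proof.
move=> cb vV; rewrite -(hull_faceV cb) => -[_ /= cv].
by rewrite mem_faceV vV andbT; apply/eqP.
Qed.

End Faces.

(* A matrix is given by its columns, scaled by 2. *)
Definition actz (m : seq (seq int)) (u : seq int) := [seq dotz u a | a <- m].
Definition acttz (m : seq (seq int)) (u : seq int) :=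
  mkseq (fun i => u`_0 * (nth [::] m 0)`_i + u`_1 * (nth [::] m 1)`_i
                + u`_2 * (nth [::] m 2)`_i + u`_3 * (nth [::] m 3)`_i) 4.

(** With entries scaled by 2, orthogonality says that the Gram matrix is 4 times the identity, and
    images are compared with doubled lists. The transposed action is tested too, which provides for
    inverses. *)
Definition sym_check (m : seq (seq int)) : bool :=
  let dV := map (map (fun a => 2 * a)) V24 in
  let dR := map (map (fun a => 2 * a)) roots in
  [&& size m == 4%N,
      [seq [seq dotz a b | b <- m] | a <- m] == [seq axis i 4 | i <- iota 0 4],
      all (fun v => (actz m v \in dV) && (acttz m v \in dV)) V24
    & all (fun v => (actz m v \in dR) && (acttz m v \in dR)) roots].

(* Right multiplication by the conjugate of the quaternion v. *)
Definition quaternion_mx (v : seq int) : seq (seq int) :=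
  let a := v`_0 in let b := v`_1 in let c := v`_2 in let d := v`_3 in
  [:: [:: a; b; c; d]; [:: - b; a; - d; c]; [:: - c; d; a; - b]; [:: - d; - c; b; a]].

(** The stabiliser of [e0] in the Weyl group of F4: a Weyl group of type B3, with 6 * 8 = 48
    elements. *)
Definition signed_perm_mxs : seq (seq (seq int)) :=
  [seq axis 0 2 :: [seq axis ks.1 (2 * ks.2) | ks <- zip p s]
  | p <- permutations [:: 1; 2; 3]%N, s <- sign_vectors 3].

Lemma quaternion_mx_sym : all (fun v => sym_check (quaternion_mx v)) V24.
Proof. rewrite /sym_check; compute_V24. Qed.

Lemma signed_perm_mxs_sym : all sym_check signed_perm_mxs.
Proof. rewrite /sym_check; compute_V24. Qed.


(** * Symmetries of the 24-cell *)

Section Symmetries.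
Variable R : realType.
Implicit Types (u v : seq int) (c x : 'rV[R]_4) (A B : 'M[R]_4).
Local Notation vecR := (vecR R).
Local Notation P := (P24 R).

Definition preserves (l : seq (seq int)) A : Prop :=
  forall v, v \in l -> exists2 v', v' \in l & vecR v *m A = vecR v'.

(** The condition is symmetric in [A] and its transpose, so it passes to inverses. The roots appear
    because they are the facet normals. *)
Definition is_sym A : Prop :=
  [/\ A *m A^T = 1%:M, preserves V24 A, preserves V24 A^T,
      preserves roots A & preserves roots A^T].

Definition matR (m : seq (seq int)) : 'M[R]_4 :=
  \matrix_(i, j) (((nth [::] m j)`_i)%:~R / 2).

Lemma vecR_matR m v w : size m = 4%N ->
  actz m v = [seq 2 * a | a <- w] -> vecR v *m matR m = vecR w.
Proof.
move=> sm vw; apply/rowP => j; rewrite mxE.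
have := congr1 (fun s => s`_j) vw; rewrite (nth_map [::]) ?sm //.
have -> : [seq 2 * a | a <- w]`_j = 2 * w`_j.
  have [jw|wj] := ltnP j (size w); first by rewrite (nth_map 0).
  by rewrite !nth_default ?mulr0 ?size_map.
move=> /(congr1 (fun a : int => a%:~R : R)); rewrite /dotz !rmorphD !rmorphM /= => E.
rewrite !big_ord_recl big_ord0 !mxE /= /bump /= addr0 !addrA !mulrA -!mulrDl E.
by rewrite mulrAC mulfV ?mul1r // pnatr_eq0.
Qed.

Lemma mulmx_matRT m v : vecR v *m (matR m)^T = 2^-1 *: vecR (acttz m v).
Proof.
apply/rowP => i; rewrite !mxE nth_mkseq // !rmorphD !rmorphM /=.
rewrite !big_ord_recl big_ord0 !mxE /= /bump /= addr0 !addrA.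
by field.
Qed.

Lemma vecR_double w : vecR [seq 2 * a | a <- w] = 2 *: vecR w.
Proof.
apply/rowP => j; rewrite !mxE.
have [jw|wj] := ltnP j (size w); first by rewrite (nth_map 0) // rmorphM.
by rewrite !nth_default ?mulr0 ?size_map.
Qed.

Lemma vecR_matRT m v w :
  acttz m v = [seq 2 * a | a <- w] -> vecR v *m (matR m)^T = vecR w.
Proof.
by move=> vw; rewrite mulmx_matRT vw vecR_double scalerA mulVf ?scale1r // pnatr_eq0.
Qed.

Lemma sym_checkP m : sym_check m -> is_sym (matR m).
Proof.
case/and4P => /eqP sm /eqP orth /allP Vm /allP Rm.
split.
- apply: mulmx1C; apply/matrixP => i j; rewrite !mxE.
  have := congr1 (fun s => (nth [::] s i)`_j) orth.
  rewrite (nth_map [::]) ?sm // (nth_map [::]) ?sm // (nth_map 0%N) ?size_iota //.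
  rewrite nth_iota // add0n nth_mkseq //.
  move=> /(congr1 (fun a : int => a%:~R : R)); rewrite /dotz !rmorphD !rmorphM /= => E.
  rewrite !big_ord_recl big_ord0 !mxE /= /bump /= addr0 !addrA.
  transitivity ((if j == i :> nat then 4 else 0 : int)%:~R / 4 : R).
    by rewrite -E; field.
  rewrite eq_sym (_ : (i == j :> nat) = (i == j)) //.
  by case: eqP => _ /=; rewrite ?mul0r // divff // pnatr_eq0.
- move=> v /Vm /andP[/mapP[w wV E] _]; exists w => //; exact: vecR_matR.
- move=> v /Vm /andP[_ /mapP[w wV E]]; exists w => //; exact: vecR_matRT.
- move=> v /Rm /andP[/mapP[w wV E] _]; exists w => //; exact: vecR_matR.
- move=> v /Rm /andP[_ /mapP[w wV E]]; exists w => //; exact: vecR_matRT.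
Qed.

Lemma is_symT A : is_sym A -> is_sym A^T.
Proof. by case=> /mulmx1C A1 A2 A3 A4 A5; split; rewrite ?trmxK. Qed.

Lemma preservesM l A B : preserves l A -> preserves l B -> preserves l (A *m B).
Proof. by move=> pA pB v /pA[v' /pB[w wl E] E']; exists w; rewrite // mulmxA E'. Qed.

Lemma is_symM A B : is_sym A -> is_sym B -> is_sym (A *m B).
Proof.
move=> [A1 A2 A3 A4 A5] [B1 B2 B3 B4 B5].
split; rewrite ?trmx_mul; try exact: preservesM.
by rewrite mulmxA -(mulmxA A) B1 mulmx1.
Qed.

Lemma sym_mulmxK A : is_sym A -> cancel (fun x => x *m A) (fun x => x *m A^T).
Proof. by case=> A1 _ _ _ _ x; rewrite -mulmxA A1 mulmx1. Qed.

Lemma sym_mulmxKT A : is_sym A -> cancel (fun x => x *m A^T) (fun x => x *m A).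
Proof. by move=> /is_symT/sym_mulmxK; rewrite trmxK. Qed.

Lemma dot_sym A c x : is_sym A -> dot (c *m A) (x *m A) = dot c x.
Proof. by move=> sA; rewrite dot_mulmx sym_mulmxK. Qed.

Lemma hull_convex n (l : seq 'rV[R]_n) (I : eqType) (r : seq I) (f : I -> 'rV[R]_n) (g : I -> R) :
  (forall i, i \in r -> hull l (f i)) -> (forall i, i \in r -> 0 <= g i) ->
  \sum_(i <- r) g i = 1 -> hull l (\sum_(i <- r) g i *: f i).
Proof.
move=> fl g0 g1.
have /choice[W HW] : forall i, exists w : 'I_(size l) -> R, i \in r ->
  [/\ forall j, 0 <= w j, \sum_j w j = 1 & f i = \sum_j w j *: l`_j].
  move=> i; case: (boolP (i \in r)) => [/fl[w' ?]|_]; first by exists w'.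
  by exists (fun=> 0).
exists (fun j => \sum_(i <- r) g i * W i j); split.
- by move=> j; rewrite big_seq sumr_ge0 // => i ir; rewrite mulr_ge0 ?g0 //; case: (HW i ir).
- rewrite exchange_big -g1; apply: eq_big_seq => i ir /=.
  by rewrite -mulr_sumr; case: (HW i ir) => _ -> _; rewrite mulr1.
- transitivity (\sum_(i <- r) \sum_j (g i * W i j) *: l`_j).
    apply: eq_big_seq => i ir; case: (HW i ir) => _ _ ->.
    by rewrite scaler_sumr; apply: eq_bigr => j _; rewrite scalerA.
  by rewrite exchange_big; apply: eq_bigr => j _; rewrite scaler_suml.
Qed.

Lemma P24_sym A x : is_sym A -> P x -> P (x *m A).
Proof.
case=> _ A2 _ _ _ /(hull_mapP _ _ V24_uniq)[w [w0 w1 ->]].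
rewrite mulmx_suml; under eq_bigr do rewrite -scalemxAl.
by apply: hull_convex => // v /A2[v' v'V ->]; exact: P24_vec.
Qed.

Lemma P24_symE A : is_sym A -> (fun x => x *m A) @` P = P.
Proof.
move=> sA; apply/seteqP; split=> [_ [x Px <-]|x Px]; first exact: P24_sym.
by exists (x *m A^T); [exact/P24_sym/Px/is_symT|exact: sym_mulmxKT].
Qed.

Lemma face_sym A F : is_sym A -> face P F -> face P ((fun x => x *m A) @` F).
Proof.
move=> sA [c [b [cb ->]]]; exists (c *m A), b; split.
  move=> x Px; rewrite dot_mulmx; apply: cb; exact/P24_sym/Px/is_symT.
apply/seteqP; split=> [_ [x [Px cx] <-]|x [Px cx]].
  by split; [exact: P24_sym|rewrite /= dot_sym].
exists (x *m A^T); last exact: sym_mulmxKT.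
by split; [exact/P24_sym/Px/is_symT|rewrite /= -dot_mulmx].
Qed.

Lemma affine_dim_sym A d F : is_sym A -> affine_dim d F ->
  affine_dim d ((fun x => x *m A) @` F).
Proof.
move=> sA [x [M [Fx fM FM Fy]]]; exists (x *m A), (M *m A); split.
- by exists x.
- have Au : A \in unitmx by case: sA => /mulmx1_unit[].
  by rewrite /row_free mxrankMfree // row_free_unit.
- by move=> i; exists (x + row i M); rewrite // mulmxDl row_mul.
- by move=> _ [y /Fy yM <-]; rewrite -mulmxBl submxMr.
Qed.

Lemma dface_sym A d F : is_sym A -> dface P d F -> dface P d ((fun x => x *m A) @` F).
Proof. by move=> sA [fF dF]; split; [exact: face_sym|exact: affine_dim_sym]. Qed.

Lemma image_symK A F : is_sym A -> (fun x => x *m A^T) @` ((fun x => x *m A) @` F) = F.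
Proof.
move=> sA; apply/seteqP; split=> [_ [_ [x Fx <-] <-]|x Fx].
  by rewrite sym_mulmxK.
by exists (x *m A); [exists x|rewrite sym_mulmxK].
Qed.

(** Each row of one direction matrix is a difference of two points of [F], hence lies in the row
    space of the other. *)
Lemma affine_dim_uniq n d e (F : set 'rV[R]_n) : affine_dim d F -> affine_dim e F -> d = e.
Proof.
suff le a b : affine_dim a F -> affine_dim b F -> (a <= b)%N.
  by move=> dF eF; apply/eqP; rewrite eqn_leq !le.
move=> [x [M [Fx /eqP fM FM Fy]]] [y [N [Gy _ _ Gz]]].
rewrite -fM; apply: (leq_trans _ (rank_leq_row N)); apply: mxrankS.
apply/row_subP => i.
have -> : row i M = (x + row i M - y) - (x - y) by rewrite opprB addrA subrK addrC addKr.
by rewrite addmx_sub ?eqmx_opp ?Gz.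
Qed.

End Symmetries.

Lemma seq_argmax (R : realType) (T : eqType) (f : T -> R) (s : seq T) : s != [::] ->
  exists2 t, t \in s & forall u, u \in s -> f u <= f t.
Proof.
elim: s => // a s IH _; have [->|/IH[t ts tmax]] := eqVneq s [::].
  by exists a; rewrite ?inE // => u; rewrite inE => /eqP ->.
have [at_|ta] := leP (f a) (f t).
  exists t; first by rewrite inE ts orbT.
  by move=> u; rewrite inE => /orP[/eqP -> //|/tmax].
exists a; first by rewrite inE eqxx.
by move=> u; rewrite inE => /orP[/eqP -> //|/tmax /le_trans -> //]; exact: ltW.
Qed.

(** * The Weyl chamber of F4 and the standard faces *)

Definition e0 : seq int := [:: 2; 0; 0; 0].

(** Simple roots of F4, with the short root (1, -1, -1, -1)/2 doubled to make it integral. The last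
    three are of type B3, and their reflections generate the stabiliser of [e0]. *)
Definition simple_root (k : nat) : seq int :=
  nth [::] [:: [:: 1; -1; -1; -1]; [:: 0; 0; 0; 1]; [:: 0; 0; 1; -1]; [:: 0; 1; -1; 0]] k.

(** The basis dual to [simple_root]. *)
Definition weight (k : nat) : seq int :=
  nth [::] [:: [:: 1; 0; 0; 0]; [:: 3; 1; 1; 1]; [:: 2; 1; 1; 0]; [:: 1; 1; 0; 0]] k.

(* The sum of the weights. *)
Definition rho : seq int := [:: 7; 3; 2; 1].

(* The reflection in a simple root maps rho to rho minus this multiple of it. *)
Definition rho_pairing (k : nat) : int := if k == 1%N then 2 else 1.

(** The matrix [h'] stands for [h] followed by the reflection in simple root [k]. Only the effect on
    [rho] is compared, since [fold_chamber] maximises the pairing with [rho]. *)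
Definition fold_check : bool :=
  all (fun h =>
    (actz h e0 == [:: 4; 0; 0; 0]) &&
    all (fun k =>
      let t := [seq x.1 - rho_pairing k * x.2
               | x <- zip (acttz h rho) (acttz h (simple_root k))] in
      has (fun h' => acttz h' rho == t) signed_perm_mxs)
    (iota 1 3)) signed_perm_mxs.

Lemma fold_checkT : fold_check.
Proof. by vm_compute. Qed.

(* Affine bases of the standard faces based at [e0], and their dual bases
   scaled by 4. *)
Definition aff_basis : seq (seq int) :=
  [:: [:: -1; 1; 1; 1]; [:: -1; 1; 1; -1]; [:: -2; 2; 0; 0]; [:: -4; 0; 0; 0]].
Definition aff_dual : seq (seq int) :=
  [:: [:: 0; 0; 2; 2]; [:: 0; 0; 2; -2]; [:: 0; 2; -2; 0]; [:: -1; -1; 0; 0]].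

Definition aff_check (d : nat) (l : seq (seq int)) : bool :=
  [&& e0 \in l,
      all (fun r => [seq x.1 + x.2 | x <- zip e0 r] \in l) (take d aff_basis)
    & all (fun v => let y := [seq x.1 - x.2 | x <- zip v e0] in
        all (fun j => 4 * y`_j ==
           foldr (fun i z => dotz y (nth [::] aff_dual i) * (nth [::] aff_basis i)`_j + z)
             0 (iota 0 d)) (iota 0 4)) l].

(** These four faces, of dimensions 0 to 3, form the flag at [e0] that belongs to the chamber. *)
Definition std (k : nat) := [seq v <- V24 | dotz (weight k) v == dotz (weight k) e0].

Fixpoint cliques (k : nat) (l : seq (seq int)) : seq (seq (seq int)) :=
  if k is k'.+1 then
    (fix loop l := if l is u :: l' then
        [seq u :: T | T <- cliques k' [seq w <- l' | dotz u w == 2]] ++ loop l'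
      else [::]) l
  else [:: [::]].

(** Two vertices are adjacent when their product is 2. Up to dimension 2 the faces are simplices,
    and every clique of the edge graph with at most three vertices spans one. Cliques are listed as
    subsequences of [V24], so each occurs once; the facets are cut out by the roots. *)
Definition faces (k : nat) : seq (seq (seq int)) :=
  if k == 3%N then [seq [seq v <- V24 | dotz n v == 2] | n <- roots]
  else cliques k.+1 V24.

(** Taken as a functional, the vertex sum of a face attains its maximum over [V24] exactly on that
    face. *)
Definition vsum (S : seq (seq int)) : seq int :=
  foldr (fun u v => [seq x.1 + x.2 | x <- zip u v]) [:: 0; 0; 0; 0] S.

Definition faces_size (k : nat) : nat := if k == 3%N then 6%N else k.+1.

Definition faces_check (k : nat) : bool :=
  [&& uniq (faces k), size (std k) == faces_size k
    & all (fun S => let c := vsum S in let b := dotz c (head [::] S) in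
       [&& size S == faces_size k, all (fun v => dotz c v <= b) V24
         & S == [seq v <- V24 | dotz c v == b]]) (faces k)].

Lemma faces_checkT : all faces_check (iota 0 4).
Proof. rewrite /faces_check /std /faces; compute_V24. Qed.

(* The lists are passed as arguments to let them be evaluated only once. *)
Definition flag_check (f1 f2 f3 : seq (seq (seq int))) (flags : seq (seq (seq (seq int)))) :=
  all (fun S1 => all (fun S2 => all (fun S3 => [:: S1; S2; S3] \in flags)
    [seq S3 <- f3 | all (mem S3) S2])
    [seq S2 <- f2 | all (mem S2) S1])
    [seq S1 <- f1 | e0 \in S1].

Definition flag_preimage (stds : seq (seq (seq int))) (h : seq (seq int)) :=
  [seq [seq v <- V24 | actz h v \in T] | T <- stds].

Definition double_stds := [seq map (map (fun a => 2 * a)) (std k) | k <- iota 1 3].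

(** The vertex figure at [e0] is a cube, and the 48 signed permutations act simply transitively on
    its 48 flags. So each flag at [e0] is carried to the standard one. *)
Lemma flag_checkT : flag_check (faces 1) (faces 2) (faces 3)
  (map (flag_preimage double_stds) signed_perm_mxs).
Proof. rewrite /double_stds /flag_preimage /std /faces; compute_V24. Qed.

Definition schlafli_check (f0 f1 f2 f3 : seq (seq (seq int))) : bool :=
  [&& all (fun S2 => size [seq T <- f0 | all (mem S2) T] == 3%N) f2,
      all (fun S0 => all (fun S3 =>
          size [seq T <- [seq T <- f2 | all (mem T) S0] | all (mem S3) T] == 4%N)
        [seq S3 <- f3 | all (mem S3) S0]) f0
    & all (fun S1 => size [seq T <- f3 | all (mem T) S1] == 3%N) f1].

Lemma schlafli_checkT : schlafli_check (faces 0) (faces 1) (faces 2) (faces 3).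
Proof. rewrite /faces; compute_V24. Qed.

Lemma weight_leT :
  all (fun k => all (fun v => dotz (weight k) v <= dotz (weight k) e0) V24) (iota 0 4).
Proof. compute_V24. Qed.

Lemma std_monoT :
  all (fun j => all (fun k => (j <= k)%N ==> all (mem (std k)) (std j)) (iota 0 4)) (iota 0 4).
Proof. rewrite /std; compute_V24. Qed.

Lemma std_cliqueT : all (fun k => all (fun u => all (fun v =>
  (u == v) || (dotz u v == 2)) (std k)) (std k)) (iota 0 3).
Proof. rewrite /std; compute_V24. Qed.

Lemma aff_checkT : all (fun k => aff_check k (std k)) (iota 0 4) && aff_check 4 V24.
Proof. rewrite /std; compute_V24. Qed.

Section Chamber.
Variable R : realType.
Implicit Types (u v : seq int) (c d x : 'rV[R]_4) (A B : 'M[R]_4).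
Local Notation vecR := (vecR R).
Local Notation P := (P24 R).

Definition in_chamber d := forall k, (k < 4)%N -> 0 <= dot d (vecR (simple_root k)).

Lemma e0V : e0 \in V24. Proof. compute_V24. Qed.

(** The product of [v] with its conjugate is its squared norm 4, which the factor 1/2 in [matR]
    turns into [e0]. *)
Lemma to_e0 v : v \in V24 ->
  is_sym (matR R (quaternion_mx v)) /\ vecR v *m matR R (quaternion_mx v) = vecR e0.
Proof.
move=> vV; split; first by apply: sym_checkP; exact: (allP quaternion_mx_sym).
apply: vecR_matR => //; apply/eqP.
have : all (fun v => actz (quaternion_mx v) v == [seq 2 * a | a <- e0]) V24 by compute_V24.
by move=> /allP; apply.
Qed.

(** A symmetry first brings a vertex maximising [c] to [e0]. Among the stabiliser of [e0], an
    element maximising the pairing with [rho] is then chosen: if the pairing with one of the last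
    three simple roots were negative, the reflection in that root would increase the maximum. *)
Lemma fold_chamber c : exists A, is_sym A /\ in_chamber (c *m A).
Proof.
have [v vV vmax] := seq_argmax (fun v => dot c (vecR v)) V24_neq0.
have [sA vA] := to_e0 vV; set A := matR R _ in sA vA.
have c1max u : u \in V24 -> dot (c *m A) (vecR u) <= dot (c *m A) (vecR e0).
  move=> uV; rewrite -vA dot_sym // dot_mulmx.
  by case: sA => _ _ /(_ u uV)[u' u'V ->] _ _; exact: vmax.
have [h hS hmax] := seq_argmax (fun h => dot (c *m A *m matR R h) (vecR rho))
  (isT : signed_perm_mxs != [::]).
have sh : is_sym (matR R h) by apply: sym_checkP; exact: (allP signed_perm_mxs_sym).
exists (A *m matR R h); split; first exact: is_symM.
have /andP[/eqP he0 /allP hk] := allP fold_checkT h hS.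
have he : vecR e0 *m matR R h = vecR e0.
  by apply: vecR_matR; [case/and4P: (allP signed_perm_mxs_sym h hS) => /eqP|].
move=> [_|k k4]; rewrite mulmxA.
  (* The first simple root is the difference of [e0] and this vertex, so its inequality is the
     maximality of [e0]. *)
  pose f : seq int := [:: 1; 1; 1; 1].
  have -> : vecR (simple_root 0) = vecR e0 - vecR f.
    by apply/rowP => j; rewrite !mxE; case: j => -[|[|[|[|//]]]] ?; rewrite /= -rmorphB.
  have fV : f \in V24 by compute_V24.
  rewrite dotDr dotNr subr_ge0 -[X in _ <= dot _ X]he dot_sym //.
  rewrite dot_mulmx; case: sh => _ _ /(_ f fV)[u uV ->] _ _; exact: c1max.
have /hk/hasP[h' h'S /eqP hm] : k.+1 \in iota 1 3 by rewrite mem_iota.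
have E : vecR (acttz h rho) - vecR (acttz h' rho) =
         (rho_pairing k.+1)%:~R *: vecR (acttz h (simple_root k.+1)).
  apply/rowP => j; rewrite !mxE hm (nth_map (0, 0)) ?size_zip ?size_mkseq //.
  by rewrite nth_zip ?size_mkseq //= rmorphB rmorphM opprB addrC subrK.
have := hmax h' h'S; rewrite (dot_mulmx (matR R h')) !(dot_mulmx (matR R h)) !mulmx_matRT !dotZr ler_pM2l ?invr_gt0 //.
rewrite -subr_ge0 -dotNr -dotDr E dotZr pmulr_rge0 ?ltr0z; last by rewrite /rho_pairing; case: ifP.
by move=> H; rewrite mulr_ge0 ?invr_ge0.
Qed.

Lemma weight_le k v : (k < 4)%N -> v \in V24 -> dotz (weight k) v <= dotz (weight k) e0.
Proof.
move=> k4; have := weight_leT.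
by move=> /allP /(_ k); rewrite mem_iota => /(_ k4) /allP; apply.
Qed.

Lemma std_mono j k v : (j <= k < 4)%N -> v \in std j -> v \in std k.
Proof.
have := std_monoT.
move=> /allP H /andP[jk k4].
have := H j; rewrite mem_iota (leq_ltn_trans jk k4) => /(_ isT) /allP /(_ k).
by rewrite mem_iota k4 => /(_ isT); rewrite jk => /allP; apply.
Qed.

(** This expands [v] in the simple roots, the coefficients being its pairings with the dual
    basis. *)
Lemma dot_weights d v : v \in V24 ->
  dot d (vecR v) = \sum_(k < 4) dot d (vecR (simple_root k)) * (dotz (weight k) v)%:~R.
Proof.
have : all (fun v => all (fun j => v`_j ==
   dotz (weight 0) v * (simple_root 0)`_j + dotz (weight 1) v * (simple_root 1)`_j
 + dotz (weight 2) v * (simple_root 2)`_j + dotz (weight 3) v * (simple_root 3)`_j)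
  (iota 0 4)) V24 by compute_V24.
move=> /allP H /H /allP vE.
have -> : vecR v = \sum_(k < 4) (dotz (weight k) v)%:~R *: vecR (simple_root k).
  apply/rowP => j; rewrite summxE !mxE.
  rewrite (eqP (vE j _)) ?mem_iota ?ltn_ord //.
  rewrite (eq_bigr (fun k : 'I_4 => (dotz (weight k) v * (simple_root k)`_j)%:~R)).
    rewrite -rmorph_sum; congr (_%:~R).
    by rewrite !big_ord_recl big_ord0 addr0 !addrA.
  by move=> k _; rewrite !mxE rmorphM.
by rewrite dot_sumr; apply: eq_bigr => k _; rewrite dotZr mulrC.
Qed.

(** The defect of [v] from the maximum at [e0] is a sum of nonnegative terms, one for each simple
    root. It vanishes when [v] lies in [std k] for every [k] with nonzero coefficient; as these
    faces are nested, the smallest such [k] decides. *)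
Lemma chamber_face d b : in_chamber d ->
  (forall v, v \in V24 -> dot d (vecR v) <= b) -> faceV d b != [::] ->
  faceV d b = V24 \/ exists2 k, (k < 4)%N & faceV d b = std k.
Proof.
move=> ch db S0; pose a k := dot d (vecR (simple_root k)).
have diff v : v \in V24 -> dot d (vecR e0) - dot d (vecR v) =
    \sum_(k < 4) a k * (dotz (weight k) e0 - dotz (weight k) v)%:~R.
  move=> vV; rewrite !dot_weights ?e0V // -sumrB.
  by apply: eq_bigr => k _; rewrite rmorphB mulrBr.
have tge0 v (k : 'I_4) : v \in V24 -> 0 <= a k * (dotz (weight k) e0 - dotz (weight k) v)%:~R.
  by move=> vV; rewrite mulr_ge0 ?ch // ler0z subr_ge0 weight_le.
have bE : b = dot d (vecR e0).
  apply/eqP; rewrite eq_le db ?e0V // andbT.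
  have /hasP[v vV vb] : has (fun v => dot d (vecR v) == b) V24 by rewrite has_filter.
  by rewrite -(eqP vb) -subr_ge0 diff // sumr_ge0 // => k _; exact: tge0.
have dE v : v \in V24 -> (dot d (vecR v) == b) = all (fun k => (a k == 0) || (v \in std k)) (iota 0 4).
  move=> vV; rewrite eq_sym -subr_eq0 bE diff // psumr_eq0 => [|k _]; last exact: tge0.
  have tE k : (a k * (dotz (weight k) e0 - dotz (weight k) v)%:~R == 0) = (a k == 0) || (v \in std k).
    by rewrite mulf_eq0 mem_filter vV andbT intr_eq0 subr_eq0 [_ == dotz _ v]eq_sym.
  apply/allP/allP => H k.
    rewrite mem_iota => /= k4; have := H (Ordinal k4) (mem_index_enum _).
    by rewrite /= tE.
  by move=> _ /=; rewrite tE; apply: H; rewrite mem_iota ltn_ord.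
have first_nz k : (k < 4)%N -> a k != 0 -> (forall j, (j < k)%N -> a j = 0) ->
    faceV d b = std k.
  move=> k4 ak aj; apply: eq_in_filter => v vV; rewrite dE //.
  have sE : (v \in std k) = (dotz (weight k) v == dotz (weight k) e0).
    by rewrite mem_filter vV andbT.
  rewrite -sE; apply/allP/idP => [H|vk j].
    by have := H k; rewrite mem_iota k4 (negbTE ak) => /(_ isT).
  rewrite mem_iota /= => j4; have [/aj ->|kj] := ltnP j k; first by rewrite eqxx.
  by rewrite (@std_mono k) ?orbT // kj.
have [a0|a0] := eqVneq (a 0) 0; last by right; exists 0%N; rewrite // (first_nz 0%N).
have [a1|a1] := eqVneq (a 1) 0; last first.
  by right; exists 1%N; rewrite // (first_nz 1%N) // => -[].
have [a2|a2] := eqVneq (a 2) 0; last first.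
  by right; exists 2%N; rewrite // (first_nz 2%N) // => -[|[]].
have [a3|a3] := eqVneq (a 3) 0; last first.
  by right; exists 3%N; rewrite // (first_nz 3%N) // => -[|[|[]]].
left; rewrite -[RHS]filter_predT; apply: eq_in_filter => v vV; rewrite dE //=.
by rewrite a0 a1 a2 a3 eqxx.
Qed.

Lemma std_uniq k : uniq (std k).
Proof. exact: (filter_uniq _ V24_uniq). Qed.

Lemma std_faceV k : std k = faceV (vecR (weight k)) (dotz (weight k) e0)%:~R.
Proof. by apply: eq_filter => v; rewrite dot_vecR eqr_int. Qed.

Lemma std_face k : (k < 4)%N -> face P (hull (map vecR (std k))).
Proof.
move=> k4; apply/faceP; exists (vecR (weight k)), (dotz (weight k) e0)%:~R.
by rewrite std_faceV; split=> // v vV; rewrite dot_vecR ler_int weight_le.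
Qed.

(** Pairing with the dual basis [N] shows that the rows of [M] are independent and yields the
    coefficients of every vertex over them. *)
Lemma affine_dim_hull (d : nat) l : (d <= 4)%N -> uniq l -> {subset l <= V24} ->
  aff_check d l -> affine_dim d (hull (map vecR l)).
Proof.
move=> d4 ul lV /and3P[el /allP rl /allP yl].
pose M : 'M[R]_(d, 4) := \matrix_(i, j) ((nth [::] aff_basis i)`_j)%:~R.
pose N : 'M[R]_(4, d) := \matrix_(j, i) ((nth [::] aff_dual i)`_j)%:~R.
have rowM (i : 'I_d) : row i M = vecR (nth [::] aff_basis i).
  by apply/rowP => j; rewrite !mxE.
have vN u (i : 'I_d) : (vecR u *m N) 0 i = (dotz u (nth [::] aff_dual i))%:~R.
  by rewrite -dot_vecR dotE mxE; apply: eq_bigr => j _; rewrite !mxE.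
have MN : M *m N = 4%:M.
  apply/matrixP => i j.
  have -> : (M *m N) i j = (row i M *m N) 0 j by rewrite -row_mul [RHS]mxE.
  rewrite rowM vN mxE.
  have : all (fun i => all (fun j => dotz (nth [::] aff_basis i) (nth [::] aff_dual j)
     == if i == j then 4 else 0) (iota 0 4)) (iota 0 4) by vm_compute.
  move=> /allP /(_ (val i)); rewrite mem_iota (leq_trans (ltn_ord i) d4) => /(_ isT).
  move=> /allP /(_ (val j)); rewrite mem_iota (leq_trans (ltn_ord j) d4) => /(_ isT) /eqP ->.
  by rewrite (_ : (val i == val j) = (i == j)) //; case: eqP.
have addv u v : size u = 4%N -> size v = 4%N -> vecR [seq z.1 + z.2 | z <- zip u v] = vecR u + vecR v.
  move=> su sv; apply/rowP => j; rewrite !mxE (nth_map (0, 0)) ?size_zip ?su ?sv //.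
  by rewrite nth_zip ?su ?sv //= rmorphD.
have subv u v : size u = 4%N -> size v = 4%N -> vecR [seq z.1 - z.2 | z <- zip u v] = vecR u - vecR v.
  move=> su sv; apply/rowP => j; rewrite !mxE (nth_map (0, 0)) ?size_zip ?su ?sv //.
  by rewrite nth_zip ?su ?sv //= rmorphB.
have n4 : (4 : R) != 0 by rewrite pnatr_eq0.
exists (vecR e0), M; split.
- exact: mem_hull.
- by apply/row_freeP; exists (4^-1 *: N); rewrite -scalemxAr MN scale_scalar_mx mulVf.
- move=> i; rewrite rowM -addv //; last first.
    have : all (fun r => size r == 4%N) aff_basis by [].
    by move=> /all_nthP /(_ i) H; apply/eqP/H; apply: (leq_trans (ltn_ord i)).
  apply: mem_hull => //; apply: rl.
  by rewrite -(nth_take _ (ltn_ord i)) mem_nth // size_takel.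
- move=> y /(hull_mapP _ _ ul)[w [w0 w1 ->]].
  have -> : \sum_(t <- l) w t *: vecR t - vecR e0 = \sum_(t <- l) w t *: (vecR t - vecR e0).
    rewrite [RHS](eq_bigr (fun t => w t *: vecR t - w t *: vecR e0)); last first.
      by move=> t _; rewrite scalerBr.
    by rewrite sumrB -scaler_suml w1 scale1r.
  rewrite big_seq; apply: summx_sub => t tl; apply: scalemx_sub.
  rewrite -subv ?(V24_size (lV _ tl)) //; set z := [seq _ | _ <- _].
  have -> : vecR z = (4^-1 *: (vecR z *m N)) *m M; last exact: submxMl.
  apply/rowP => j; rewrite -scalemxAl !mxE.
  have /allP /(_ (val j)) := yl t tl; rewrite mem_iota ltn_ord => /(_ isT) /eqP.
  move=> /(congr1 (fun a : int => a%:~R : R)); rewrite rmorphM /= -/z => E.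
  apply: (mulfI n4); rewrite E mulrA mulfV // mul1r.
  rewrite (eq_bigr (fun i : 'I_d => (dotz z (nth [::] aff_dual i) * (nth [::] aff_basis i)`_j)%:~R)).
    by rewrite -(big_mkord xpredT (fun i => (dotz z (nth [::] aff_dual i) * (nth [::] aff_basis i)`_j)%:~R))
      -rmorph_sum /= unlock /index_iota subn0.
  by move=> i _; rewrite vN mxE rmorphM.
Qed.

Lemma affine_dim_std k : (k < 4)%N -> affine_dim k (hull (map vecR (std k))).
Proof.
move=> k4; apply: affine_dim_hull; [exact: ltnW|exact: std_uniq| |].
  by move=> v; rewrite mem_filter => /andP[].
by have /andP[/allP H _] := aff_checkT; apply: H; rewrite mem_iota.
Qed.

Lemma affine_dim_P24 : affine_dim 4 P.
Proof. by apply: affine_dim_hull; [|exact: V24_uniq| |case/andP: aff_checkT]. Qed.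

Lemma hull_nil n : hull [::] = set0 :> set 'rV[R]_n.
Proof.
apply/seteqP; split=> // x [w [_ + _]]; rewrite big_ord0 => /eqP.
by rewrite eq_sym oner_eq0.
Qed.

Lemma proper_face_std F : proper_face P F -> exists A k,
  [/\ is_sym A, (k < 4)%N & F = (fun x => x *m A) @` hull (map vecR (std k))].
Proof.
move=> [/faceP[c [b [cb FE]]] F0 FP]; have [A [sA ch]] := fold_chamber c.
have cAb v : v \in V24 -> dot (c *m A) (vecR v) <= b.
  move=> vV; rewrite dot_mulmx.
  by case: sA => _ _ /(_ v vV)[v' v'V ->] _ _; exact: cb.
have GE : (fun x => x *m A) @` F = hull (map vecR (faceV (c *m A) b)).
  rewrite FE -(hull_faceV cb) -(hull_faceV cAb); apply/seteqP; split=> [_ [x [Px cx] <-]|x [Px cx]].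
    by split; [exact: P24_sym|rewrite /= dot_sym].
  exists (x *m A^T); last exact: sym_mulmxKT.
  by split; [exact/P24_sym/Px/is_symT|rewrite /= -dot_mulmx].
have SN : faceV (c *m A) b != [::].
  apply/eqP => S0; rewrite S0 hull_nil in GE.
  by case: F0 => x Fx; have : ((fun x => x *m A) @` F) (x *m A) by [exists x]; rewrite GE.
have FT : F = (fun x => x *m A^T) @` hull (map vecR (faceV (c *m A) b)).
  by rewrite -GE image_symK.
have [SV|[k k4 Sk]] := chamber_face ch cAb SN.
  by case: FP; rewrite FT SV (P24_symE (is_symT sA)).
by exists A^T, k; split=> //; [exact: is_symT|rewrite FT Sk].
Qed.

(** Folding carries [F] to some standard face, and uniqueness of the dimension identifies which
    one. *)
Lemma dface_stdP k F : (k < 4)%N -> dface P k F <->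
  exists2 A, is_sym A & F = (fun x => x *m A) @` hull (map vecR (std k)).
Proof.
move=> k4; split=> [[fF dF]|[A sA ->]]; last first.
  by apply: dface_sym => //; split; [exact: std_face|exact: affine_dim_std].
have [|A [j [sA j4 FE]]] := @proper_face_std F.
  split=> //; first by case: dF => x [M [Fx _ _ _]]; exists x.
  by move=> FP; rewrite FP in dF; rewrite (affine_dim_uniq dF affine_dim_P24) in k4.
exists A => //; rewrite FE; congr (_ @` hull (map _ (std _))).
apply: affine_dim_uniq dF; rewrite FE; apply: affine_dim_sym => //.
exact: affine_dim_std.
Qed.

(** Such a list represents its face canonically, as a sublist of [V24] in the order of [V24];
    equality and inclusion of faces become equality and inclusion of lists. *)
Definition is_faceV (S : seq (seq int)) : Prop :=
  exists (c : 'rV[R]_4) b, (forall v, v \in V24 -> dot c (vecR v) <= b) /\ S = faceV c b.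

Lemma is_faceV_std k : (k < 4)%N -> is_faceV (std k).
Proof.
move=> k4; exists (vecR (weight k)), (dotz (weight k) e0)%:~R.
by rewrite std_faceV; split=> // v vV; rewrite dot_vecR ler_int weight_le.
Qed.

Lemma is_faceV_uniq S : is_faceV S -> uniq S.
Proof. by move=> [c [b [_ ->]]]; exact: faceV_uniq. Qed.

Lemma is_faceV_sub S : is_faceV S -> {subset S <= V24}.
Proof. by move=> [c [b [_ ->]]] v; rewrite mem_faceV => /andP[]. Qed.

Lemma is_faceV_mem S v : is_faceV S -> v \in V24 -> hull (map vecR S) (vecR v) <-> v \in S.
Proof.
move=> fS vV; split; last by apply: mem_hull; exact: is_faceV_uniq.
by case: fS => c [b [cb ->]]; exact: mem_faceV_hull.
Qed.

Lemma is_faceV_hull_sub S S' : is_faceV S -> is_faceV S' ->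
  hull (map vecR S) `<=` hull (map vecR S') <-> {subset S <= S'}.
Proof.
move=> fS fS'; split=> [SS' v vS|]; last by apply: hull_sub; exact: is_faceV_uniq.
have vV := is_faceV_sub fS vS.
by apply/(is_faceV_mem fS' vV)/SS'/(is_faceV_mem fS vV).
Qed.

Lemma is_faceV_ext S S' : is_faceV S -> is_faceV S' -> S =i S' -> S = S'.
Proof.
move=> [c [b [_ ->]]] [c' [b' [_ ->]]] E; apply: eq_in_filter => v vV.
by have := E v; rewrite (mem_faceV c b) (mem_faceV c' b') vV !andbT.
Qed.

Lemma is_faceV_hull_inj S S' : is_faceV S -> is_faceV S' ->
  hull (map vecR S) = hull (map vecR S') -> S = S'.
Proof.
move=> fS fS' E; apply: is_faceV_ext => // v.
by apply/idP/idP; move: v; apply/is_faceV_hull_sub => //; rewrite E.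
Qed.

End Chamber.

(** * Enumeration of the faces and regularity *)

Lemma mem_cliques k S l : subseq S l -> size S = k ->
  pairwise (fun u w => dotz u w == 2) S -> S \in cliques k l.
Proof.
elim: k S l => [|k IHk] S l; first by case: S.
elim: l S => [|u l IHl] S; first by rewrite subseq0 => /eqP ->.
case: S => // v S /=; case: eqVneq => [-> sub [sS] /andP[/allP pu pS]|_ sub sS pS].
  rewrite mem_cat map_f // IHk // subseq_filter sub andbT.
  by apply/allP => w /pu.
by rewrite mem_cat IHl ?orbT.
Qed.


Section FaceLattice.
Variable R : realType.
Implicit Types (u v : seq int) (S T : seq (seq int)) (F G : set 'rV[R]_4).
Local Notation vecR := (vecR R).
Local Notation P := (P24 R).
Local Notation faceR S := (hull (map vecR S)).

Lemma faces_checkP k : (k < 4)%N -> faces_check k.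
Proof. by move=> k4; apply: (allP faces_checkT); rewrite mem_iota. Qed.

Lemma faces_faceV k S : (k < 4)%N -> S \in faces k -> is_faceV R S.
Proof.
move=> /faces_checkP/and3P[_ _ /allP H] /H /and3P[_ /allP cb /eqP SE].
exists (vecR (vsum S)), (dotz (vsum S) (head [::] S))%:~R; split.
  by move=> v vV; rewrite dot_vecR ler_int cb.
by rewrite {1}SE; apply/eq_filter => v; rewrite dot_vecR eqr_int.
Qed.

Lemma faces_sizeP k S : (k < 4)%N -> S \in faces k -> size S = faces_size k.
Proof. by move=> /faces_checkP/and3P[_ _ /allP H] /H /and3P[/eqP]. Qed.

Lemma dface_faces k F : (k < 4)%N -> dface P k F -> exists2 S, S \in faces k & F = faceR S.
Proof.
move=> k4 dF; have [/faceP[c [b [cb FE]]] _] := dF.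
have [A sA FA] := (dface_stdP _ k4).1 dF.
set S := faceV c b in FE; have fS : is_faceV R S by exists c, b.
(* The integer vertex that the inverse symmetry assigns to [v], found by search. Through it the size
   and the inner products of [S] are those of [std k], which makes [S] a clique of the right
   size. *)
pose back v := nth [::] V24 (find (fun w => vecR w == vecR v *m A^T) V24).
have backP v : v \in V24 -> back v \in V24 /\ vecR (back v) = vecR v *m A^T.
  move=> vV; case: sA => _ _ /(_ v vV)[v' v'V E] _ _.
  have hv : has (fun w => vecR w == vecR v *m A^T) V24.
    by apply/hasP; exists v'; rewrite // E.
  by split; [rewrite mem_nth // -has_find|exact/eqP/(nth_find [::] hv)].
have backS v : v \in V24 -> (v \in S) = (back v \in std k).
  move=> vV; have [bV bE] := backP v vV.
  apply/idP/idP.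
    move=> /(is_faceV_mem fS vV); rewrite -FE FA => -[x xk xv].
    apply/(is_faceV_mem (is_faceV_std R k4) bV); rewrite bE -xv.
    by rewrite sym_mulmxK.
  move=> /(is_faceV_mem (is_faceV_std R k4) bV) H; apply/(is_faceV_mem fS vV).
  by rewrite -FE FA; exists (vecR (back v)); rewrite // bE sym_mulmxKT.
have SV := is_faceV_sub fS.
have dot_back u v : u \in V24 -> v \in V24 -> dotz (back u) (back v) = dotz u v.
  move=> uV vV; apply: (@intr_inj R); rewrite -!dot_vecR.
  by rewrite (backP u uV).2 (backP v vV).2 dot_sym //; exact: is_symT.
have back_inj : {in V24 &, injective back}.
  move=> u v uV vV E; apply: (@vecR_inj R); rewrite ?V24_size //.
  by apply: (can_inj (sym_mulmxKT sA)); rewrite -(backP u uV).2 -(backP v vV).2 E.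
have sizeS : size S = size (std k).
  rewrite -(size_map back); apply/perm_size/uniq_perm; rewrite ?std_uniq //.
    rewrite map_inj_in_uniq ?(is_faceV_uniq fS) // => u v /SV uV /SV vV; exact: back_inj.
  move=> w; apply/mapP/idP => [[v vS ->]|wk]; first by rewrite -backS // SV.
  have wV := is_faceV_sub (is_faceV_std R k4) wk.
  have [v vV E] : exists2 v, v \in V24 & vecR w *m A = vecR v by case: sA => _ /(_ w wV).
  have bw : back v = w.
    apply: (@vecR_inj R); rewrite ?V24_size ?(backP v vV).1 //.
    by rewrite (backP v vV).2 -E sym_mulmxK.
  by exists v; rewrite ?backS ?bw.
exists S => //.
have [k3|k3] := eqVneq k 3%N.
  have nR : weight 3 \in roots by compute_V24.
  have [n' n'R nE] : exists2 n', n' \in roots & vecR (weight 3) *m A = vecR n'.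
    by case: sA => _ _ _ /(_ _ nR).
  have -> : S = [seq v <- V24 | dotz n' v == 2].
    apply: eq_in_filter => v vV; have := backS v vV.
    rewrite mem_faceV vV andbT => ->; rewrite k3 /std mem_filter (backP v vV).1 andbT.
    congr (_ == _); apply: (@intr_inj R).
    by rewrite -!dot_vecR (backP v vV).2 -dot_mulmx nE.
  by rewrite k3; apply/mapP; exists n'.
have k2 : (k < 3)%N by rewrite ltn_neqAle k3 -ltnS.
rewrite /faces (negbTE k3); apply: mem_cliques; first exact: filter_subseq.
  have /and3P[_ /eqP szk _] := faces_checkP k4.
  by rewrite sizeS szk /faces_size (negbTE k3).
have := is_faceV_uniq fS; rewrite uniq_pairwise.
apply: (@sub_in_pairwise _ (mem S)); last exact/allP.
move=> u v uS vS /= uv; have uV := SV u uS; have vV := SV v vS.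
have := allP std_cliqueT k; rewrite mem_iota => /(_ k2) /allP /(_ (back u)).
rewrite -backS // => /(_ uS) /allP /(_ (back v)); rewrite -backS // => /(_ vS).
by rewrite dot_back // (inj_in_eq back_inj) // (negbTE uv).
Qed.

(** A listed set spans a proper face, having fewer than 24 vertices, so it is a face of some
    dimension [j]. The vertex numbers 1, 2, 3, 6 are distinct, hence [j] is [k]. *)
Lemma faces_dface k S : (k < 4)%N -> S \in faces k -> dface P k (faceR S).
Proof.
move=> k4 Sk; have fS := faces_faceV k4 Sk.
have sS : size S = faces_size k by exact: faces_sizeP.
have [A [j [sA j4 SA]]] : exists A j,
    [/\ is_sym A, (j < 4)%N & faceR S = (fun x => x *m A) @` faceR (std j)].
  apply: proper_face_std; split.
  - by apply/faceP; case: fS => c [b [cb ->]]; exists c, b.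
  - have /hasP[v vS _] : has predT S.
      by rewrite has_predT sS /faces_size; case: ifP.
    by exists (vecR v); apply/(is_faceV_mem fS (is_faceV_sub fS vS)).
  - move=> SP; have VS : {subset V24 <= S}.
      by move=> v vV; apply/(is_faceV_mem fS vV); rewrite SP; exact: P24_vec.
    have := uniq_leq_size V24_uniq VS; rewrite sS.
    have -> : size V24 = 24%N by compute_V24.
    by move: k4; rewrite /faces_size; case: k {Sk sS} => [|[|[|[|]]]].
have dj : dface P j (faceR S) by apply/(dface_stdP _ j4); exists A.
have [T Tj ST] := dface_faces j4 dj.
have TS := is_faceV_hull_inj fS (faces_faceV j4 Tj) ST.
have jk : faces_size j = faces_size k.
  by rewrite -sS TS (faces_sizeP j4 Tj).
suff -> : k = j by [].
by case: j j4 k k4 jk {sS Sk SA dj Tj} => [|[|[|[|//]]]] _ [|[|[|[|//]]]] _.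
Qed.

Lemma dfaceP k F : (k < 4)%N ->
  dface P k F <-> exists2 S, S \in faces k & F = faceR S.
Proof.
by move=> k4; split=> [/(dface_faces k4)//|[S Sk ->]]; exact: faces_dface.
Qed.

Lemma faceR_sub j k S T : (j < 4)%N -> (k < 4)%N -> S \in faces j -> T \in faces k ->
  faceR S `<=` faceR T <-> all (mem T) S.
Proof.
move=> j4 k4 Sj Tk.
rewrite (is_faceV_hull_sub (faces_faceV j4 Sj) (faces_faceV k4 Tk)).
by split=> [H|/allP]; [apply/allP|].
Qed.

Lemma card_faceR k l n : (k < 4)%N -> uniq l -> {subset l <= faces k} -> size l = n ->
  [set F | exists2 S, S \in l & F = faceR S] #= `I_n.
Proof.
move=> k4 ul lk <-.
rewrite (_ : [set F | _] = (fun i => faceR (nth [::] l i)) @` `I_(size l)).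
  apply: inj_card_eq => i j; rewrite !inE /= => il jl E.
  have : nth [::] l i = nth [::] l j.
    by apply: is_faceV_hull_inj E; apply: (faces_faceV k4); apply/lk/mem_nth.
  by move/eqP; rewrite nth_uniq // => /eqP.
apply/seteqP; split=> [_ [S Sl ->]|_ [i il <-]].
  by exists (index S l); rewrite /= ?index_mem ?nth_index.
by exists (nth [::] l i); rewrite // mem_nth.
Qed.

Lemma faces_uniq k : (k < 4)%N -> uniq (faces k).
Proof. by move=> /faces_checkP/and3P[]. Qed.

Lemma schlafli_P24 : schlafli P 3 4 3.
Proof.
have /and3P[/allP c1 /allP c2 /allP c3] := schlafli_checkT; split.
- move=> F2 /(dfaceP _ (isT : 2 < 4)%N)[S2 S2f ->].
  have := eqP (c1 _ S2f); set l := [seq _ <- _ | _] => szl; rewrite (_ : [set F | _] = [set F | exists2 S, S \in l & F = faceR S]).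
    apply: (@card_faceR 0) => //; first by rewrite filter_uniq ?faces_uniq.
    by move=> S; rewrite mem_filter => /andP[].
  apply/seteqP; split=> F.
    move=> [/(dfaceP _ (isT : 0 < 4)%N)[S Sf ->] /(@faceR_sub 0 2)]; move=> /(_ isT isT Sf S2f) SS.
    by exists S; rewrite // mem_filter SS.
  move=> [S]; rewrite mem_filter => /andP[SS Sf] ->.
  by split; [exact: faces_dface|apply/(@faceR_sub 0 2)].
- move=> F0 F3 /(dfaceP _ (isT : 0 < 4)%N)[S0 S0f ->] /(dfaceP _ (isT : 3 < 4)%N)[S3 S3f ->].
  move=> /(@faceR_sub 0 3); move=> /(_ isT isT S0f S3f) S03.
  have S3f' : S3 \in [seq S3 <- faces 3 | all (mem S3) S0] by rewrite mem_filter S03.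
  have := eqP (allP (c2 _ S0f) _ S3f'); set l := [seq _ <- _ | _] => szl; rewrite (_ : [set F | _] = [set F | exists2 S, S \in l & F = faceR S]).
    apply: (@card_faceR 2) => //; first by rewrite !filter_uniq ?faces_uniq.
    by move=> S; rewrite !mem_filter => /and3P[].
  apply/seteqP; split=> F.
    move=> [/(dfaceP _ (isT : 2 < 4)%N)[S Sf ->] [/(@faceR_sub 0 2) + /(@faceR_sub 2 3)]].
    move=> /(_ isT isT S0f Sf) S0S /(_ isT isT Sf S3f) SS3.
    by exists S; rewrite // !mem_filter SS3 S0S.
  move=> [S]; rewrite !mem_filter => /and3P[SS3 S0S Sf] ->.
  by split; [exact: faces_dface|split; [apply/(@faceR_sub 0 2)|apply/(@faceR_sub 2 3)]].
- move=> F1 /(dfaceP _ (isT : 1 < 4)%N)[S1 S1f ->].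
  have := eqP (c3 _ S1f); set l := [seq _ <- _ | _] => szl; rewrite (_ : [set F | _] = [set F | exists2 S, S \in l & F = faceR S]).
    apply: (@card_faceR 3) => //; first by rewrite filter_uniq ?faces_uniq.
    by move=> S; rewrite mem_filter => /andP[].
  apply/seteqP; split=> F.
    move=> [/(dfaceP _ (isT : 3 < 4)%N)[S Sf ->] /(@faceR_sub 1 3)]; move=> /(_ isT isT S1f Sf) SS.
    by exists S; rewrite // mem_filter SS.
  move=> [S]; rewrite mem_filter => /andP[SS Sf] ->.
  by split; [exact: faces_dface|apply/(@faceR_sub 1 3)].
Qed.

(** A quaternion moves the vertex of the flag to [e0], and [flag_checkT] then supplies the signed
    permutation. Any two flags are related by passing through the standard one. *)
Lemma flag_std (F : 'I_4 -> set 'rV[R]_4) : is_flag P F ->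
  exists2 A, is_sym A & forall i, (fun x => x *m A) @` F i = faceR (std i).
Proof.
move=> [dF sF].
have /(dfaceP _ (isT : 0 < 4)%N)[S0 S0f FS0] := dF ord0.
have fS0 := faces_faceV (isT : 0 < 4)%N S0f.
have [v S0v] : exists v, S0 = [:: v].
  have := faces_sizeP (isT : 0 < 4)%N S0f.
  by case: (S0) => // v [|//] _; exists v.
have vV : v \in V24 by apply: (is_faceV_sub fS0); rewrite S0v mem_head.
have [sA vA] := to_e0 R vV; set A := matR R _ in sA vA.
have Fv : F ord0 (vecR v) by rewrite FS0; apply/(is_faceV_mem fS0 vV); rewrite S0v mem_head.
pose G i := (fun x => x *m A) @` F i.
have dG (i : 'I_4) : dface P i (G i) by exact: dface_sym.
have sG (i j : 'I_4) : (i <= j)%N -> G i `<=` G j.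
  by move=> /sF ij _ [x /ij Fx <-]; exists x.
have Ge0 i : G i (vecR e0) by rewrite -vA; exists (vecR v) => //; exact: (sF ord0).
have /choice[S HS] : forall i : 'I_4, exists S, S \in faces i /\ G i = faceR S.
  by move=> i; have /(dfaceP _ (ltn_ord i))[S Sf GS] := dG i; exists S.
have Ssub (i j : 'I_4) : (i <= j)%N -> all (mem (S j)) (S i).
  move=> ij; have [Sif GSi] := HS i; have [Sjf GSj] := HS j.
  by apply/(faceR_sub (ltn_ord i) (ltn_ord j)) => //; rewrite -GSi -GSj; exact: sG.
have e0S i : e0 \in S i.
  have [Sif GSi] := HS i.
  by apply/(is_faceV_mem (faces_faceV (ltn_ord i) Sif) e0V); rewrite -GSi.
pose o1 : 'I_4 := Ordinal (isT : 1 < 4)%N.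
pose o2 : 'I_4 := Ordinal (isT : 2 < 4)%N.
pose o3 : 'I_4 := Ordinal (isT : 3 < 4)%N.
have /allP /(_ (S o1)) := flag_checkT; rewrite mem_filter e0S (HS o1).1 => /(_ isT).
move=> /allP /(_ (S o2)); rewrite mem_filter (Ssub o1 o2) // (HS o2).1 => /(_ isT).
move=> /allP /(_ (S o3)); rewrite mem_filter (Ssub o2 o3) // (HS o3).1 => /(_ isT).
move=> /mapP[h hS hE].
have sh : is_sym (matR R h) by apply: sym_checkP; exact: (allP signed_perm_mxs_sym).
have hsz : size h = 4%N by case/and4P: (allP signed_perm_mxs_sym h hS) => /eqP.
exists (A *m matR R h); first exact: is_symM.
have hstd (i : 'I_4) u : u \in S i -> exists2 w, w \in std i & vecR u *m matR R h = vecR w.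
  have nthE (j : nat) : (j < 3)%N -> nth [::] [:: S o1; S o2; S o3] j =
      [seq v <- V24 | actz h v \in map (map (fun a => 2 * a)) (std j.+1)].
    by move=> j3; rewrite hE; case: j j3 => [|[|[|]]].
  have main (j : nat) : (j < 3)%N -> u \in nth [::] [:: S o1; S o2; S o3] j ->
      exists2 w, w \in std j.+1 & vecR u *m matR R h = vecR w.
    move=> j3; rewrite nthE // mem_filter => /andP[/mapP[w wk E] _].
    by exists w => //; exact: vecR_matR.
  case: i => -[|[|[|[|//]]]] i4; first last.
  - by rewrite (_ : Ordinal i4 = o3); [exact: (main 2%N)|exact: val_inj].
  - by rewrite (_ : Ordinal i4 = o2); [exact: (main 1%N)|exact: val_inj].
  - by rewrite (_ : Ordinal i4 = o1); [exact: (main 0%N)|exact: val_inj].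
  set o := Ordinal i4 => uS.
  have uv : u = e0.
    have := faces_sizeP (isT : 0 < 4)%N (HS o).1; have := e0S o.
    case: (S o) uS => // a [|//]; rewrite !inE => /eqP -> /eqP -> //.
  exists e0; first by rewrite /std mem_filter eqxx e0V.
  rewrite uv; apply: vecR_matR => //.
  by have /andP[/eqP -> _] := allP fold_checkT h hS.
move=> i; have [Sif GSi] := HS i.
have -> : (fun x => x *m (A *m matR R h)) @` F i = (fun x => x *m matR R h) @` G i.
  rewrite /G; apply/seteqP; split=> [_ [x Fx <-]|_ [_ [x Fx <-] <-]].
    by exists (x *m A); [exists x|rewrite mulmxA].
  by exists x; rewrite // mulmxA.
have dH : dface P i ((fun x => x *m matR R h) @` G i) by exact: dface_sym.
have [T Tf HT] := (dfaceP _ (ltn_ord i)).1 dH.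
have fT := faces_faceV (ltn_ord i) Tf.
have fst := is_faceV_std R (ltn_ord i).
rewrite HT; congr (hull (map _ _)); apply: (is_faceV_ext fT fst).
(* Only the inclusion is shown; both faces have the same number of vertices, which makes it an
   equality. *)
have Tstd : {subset T <= std i}.
  apply/(is_faceV_hull_sub fT fst); rewrite -HT GSi => _ [x xS <-].
  move: xS => /(hull_mapP _ _ (is_faceV_uniq (faces_faceV (ltn_ord i) Sif)))[w [w0 w1 ->]].
  rewrite mulmx_suml; under eq_bigr do rewrite -scalemxAl.
  apply: hull_convex => // u /hstd[u' u'k ->].
  by apply: mem_hull => //; exact: std_uniq.
apply: (uniq_min_size (is_faceV_uniq fT) Tstd _).2.
rewrite (faces_sizeP (ltn_ord i) Tf).
by have /and3P[_ /eqP -> _] := faces_checkP (ltn_ord i).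
Qed.

Lemma is_24_cell_P24 : is_24_cell P.
Proof.
split; last exact: schlafli_P24.
split; first by split; [exists (map vecR V24)|exact: affine_dim_P24].
move=> F G /flag_std[A sA FA] /flag_std[B sB GB].
exists (fun x => x *m (A *m B^T)); split.
  split; last by apply: P24_symE; apply: is_symM => //; exact: is_symT.
  exists (A *m B^T), 0; split=> [|x]; last by rewrite addr0.
  by case: (is_symM sA (is_symT sB)).
move=> i; rewrite -(image_symK (G i) sB) GB -FA.
apply/seteqP; split=> [_ [x Fx <-]|_ [_ [x Fx <-] <-]].
  by exists (x *m A); [exists x|rewrite mulmxA].
by exists x; rewrite // mulmxA.
Qed.

Lemma vecR_opp u : vecR (map -%R u) = - vecR u.
Proof.
apply/rowP => j; rewrite !mxE.
have [ju|uj] := ltnP j (size u); first by rewrite (nth_map 0) // rmorphN.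
by rewrite !nth_default ?oppr0 ?size_map.
Qed.

Lemma P24_opp x : P x -> P (- x).
Proof.
move=> /(hull_mapP _ _ V24_uniq)[w [w0 w1 ->]].
rewrite -sumrN; under eq_bigr do rewrite -scalerN.
apply: hull_convex => // v vV.
have : all (fun v => map -%R v \in V24) V24 by compute_V24.
by move=> /allP /(_ v vV) oV; rewrite -vecR_opp; exact: P24_vec.
Qed.

End FaceLattice.

(** * The fan over the lifted tetrahedra *)

(* The labels of the cube are read in binary with the bits 8, 1, 2, 4 as
   coordinates 0, 1, 2, 3: these are the bits that are constant on the cubes
   with centers p_0, p_1, p_2, p_3. *)
Definition lift_vec (v : nat) : seq int :=
  nth [::] [:: [:: 1; 1; 1; 1]; [:: 1; -1; 1; 1]; [:: 1; 1; -1; 1]; [:: 1; -1; -1; 1];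
               [:: 1; 1; 1; -1]; [:: 1; -1; 1; -1]; [:: 1; 1; -1; -1]; [:: 1; -1; -1; -1];
               axis 0 2; axis 1 2; axis 2 2; axis 3 2] v.

(* The lift of the vertex v to the star of the vector 2 e_i. *)
Definition lift_at (i v : nat) : seq int :=
  if (v < 8)%N then [seq (lift_vec v)`_i * a | a <- lift_vec v] else lift_vec v.

Definition apex (t : seq nat) : nat := (last 0 t - 8)%N.

Definition lifts (t : seq nat) : seq (seq int) := [seq lift_at (apex t) v | v <- t].

(** Half of this root is the coordinate of [v] with respect to the lifted vertices of [t]. Should
    the search fail, [nth] returns its default, which [dual_check] excludes. *)
Definition dual_root (t : seq nat) (v : nat) : seq int :=
  nth [::] roots (find (fun r => all (fun w =>
    dotz r (lift_at (apex t) w) == if w == v then 2 else 0) t) roots).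

Definition dual_check (t : seq nat) : bool :=
  let ds := map (dual_root t) t in let us := lifts t in
  [&& size t == 4%N, uniq t, (apex t < 4)%N, all (fun v => v < 8 + 4)%N t
    & [seq [seq dotz d u | u <- us] | d <- ds] ==
      [seq [seq if w == v then 2 else 0 | w <- t] | v <- t]].

Lemma dual_checkT : all dual_check tetrahedra.
Proof. by rewrite /dual_check /dual_root roots.unlock; lazy. Qed.

Definition pair_root (a : int) (i : nat) (b : int) (j : nat) : seq int :=
  mkseq (fun m => (if m == i then a else 0) + (if m == j then b else 0)) 4.

(** A permutation and a sign stand for the region where coordinate [i] dominates, the absolute
    values decrease along [i], [j], [k], [l], and [s] is the sign of coordinate [j]. The pool holds
    roots that are nonnegative there. Some further root in coordinates [k] and [l] splits the region
    so that on either side all dual roots of one tetrahedron are known to be nonnegative. *)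
Definition cover_check (duals : seq (seq (seq int))) : bool :=
  all (fun p => all (fun s =>
    let i := nth 0%N p 0 in let j := nth 0%N p 1 in
    let k := nth 0%N p 2 in let l := nth 0%N p 3 in
    let pool := [:: pair_root 1 i (- s) j; pair_root s j 1 k; pair_root s j (-1) k;
                    pair_root s j 1 l; pair_root s j (-1) l] in
    has (fun e =>
      has (all (mem (pair_root 1 k e l :: pool))) duals &&
      has (all (mem (pair_root (-1) k (- e) l :: pool))) duals) [:: 1; -1])
  [:: 1; -1]) (permutations (iota 0 4)).

Lemma cover_checkT : cover_check [seq [seq dual_root t v | v <- t] | t <- tetrahedra].
Proof. by rewrite /dual_root roots.unlock; lazy. Qed.

Definition opp_if (e : bool) (u : seq int) : seq int := if e then map -%R u else u.

(* Tabulated once per tetrahedron, since agree_check runs over all pairs. *)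
Definition root_table (t : seq nat) : seq (seq int * (bool * bool)) :=
  [seq let s := [seq dotz r u | u <- lifts t] in
       (s, (all (fun a => 0 <= a) s, all (fun a => a <= 0) s)) | r <- roots].

(** The list [seps] holds the values on [T] of the roots that weakly separate [T] from [T'], or from
    its negative if [e] is set. A vertex with nonzero value under one of them carries no weight at a
    common point; every other vertex must be a vertex of [T'] with matching lift. *)
Definition agree_half (e : bool) (T T' : seq nat * (seq (seq int) * seq (seq int * (bool * bool)))) : bool :=
  let seps := [seq q.1.1 | q <- zip T.2.2 T'.2.2
              & q.1.2.1 && (if e then q.2.2.1 else q.2.2.2)
                || q.1.2.2 && (if e then q.2.2.2 else q.2.2.1)] in
  all (fun p =>
    has (fun s : seq int => s`_p != 0) seps ||
    (nth 0%N T.1 p \in T'.1) &&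
    (nth [::] T.2.1 p == opp_if e (nth [::] T'.2.1 (index (nth 0%N T.1 p) T'.1))))
  (iota 0 4).

Definition agree_check (l : seq (seq nat * (seq (seq int) * seq (seq int * (bool * bool))))) :=
  all (fun T => all (fun T' => agree_half false T T' && agree_half true T T') l) l.

Lemma agree_checkT : agree_check [seq (t, (lifts t, root_table t)) | t <- tetrahedra].
Proof. by rewrite /root_table roots.unlock; lazy. Qed.

Definition facet_root (t : seq nat) : seq int :=
  nth [::] roots (find (fun r => all (fun u => dotz r u == 2) (lifts t)) roots).

(** The second test places the lifted tetrahedron in one facet of the 24-cell; the third places its
    cone over the equilibrium set of its apex. *)
Definition facet_check (t : seq nat) : bool :=
  [&& facet_root t \in roots, all (fun u => dotz (facet_root t) u == 2) (lifts t)
    & all (fun u => all (fun j => - u`_(apex t) <= u`_j <= u`_(apex t)) (iota 0 4)) (lifts t)].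

Lemma facet_checkT : all facet_check tetrahedra.
Proof. by rewrite /facet_check /facet_root roots.unlock; lazy. Qed.

Lemma lift_V24T :
  all (fun i => all (fun v => lift_at i v \in V24) (iota 0 12)) (iota 0 4).
Proof. rewrite V24.unlock; by lazy. Qed.

Lemma roots_leT : all (fun r => all (fun v => dotz r v <= 2) V24) roots.
Proof. rewrite V24.unlock roots.unlock; by lazy. Qed.

Definition subz (u v : seq int) := [seq x.1 - x.2 | x <- zip u v].

Definition squarez (a b c d : seq int) : bool :=
  [&& a != b, subz b a == subz c d, dotz (subz b a) (subz d a) == 0
    & dotz (subz b a) (subz b a) == dotz (subz d a) (subz d a)].

(** For a vertex of the octahedron with normal [r], this picks the sign that puts the lift on the
    facet itself and not on the opposite one. *)
Definition lift_in (r : seq int) (v : nat) : seq int :=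
  if dotz r (lift_vec v) == -2 then map -%R (lift_vec v) else lift_vec v.

(* For each facet normal: the square a b d c with diagonal b c, and the indices
   of the two apexes. *)
Definition octahedra : seq (seq int * seq nat * seq nat) :=
  [:: ([:: 1; 1; 0; 0], [:: 0; 2; 4; 6]%N, [:: 0; 1]%N);
     ([:: 1; -1; 0; 0], [:: 3; 1; 7; 5]%N, [:: 0; 1]%N);
     ([:: -1; 1; 0; 0], [:: 3; 1; 7; 5]%N, [:: 0; 1]%N);
     ([:: -1; -1; 0; 0], [:: 0; 2; 4; 6]%N, [:: 0; 1]%N);
     ([:: 1; 0; 1; 0], [:: 0; 1; 4; 5]%N, [:: 0; 2]%N);
     ([:: 1; 0; -1; 0], [:: 3; 2; 7; 6]%N, [:: 0; 2]%N);
     ([:: -1; 0; 1; 0], [:: 3; 2; 7; 6]%N, [:: 0; 2]%N);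
     ([:: -1; 0; -1; 0], [:: 0; 1; 4; 5]%N, [:: 0; 2]%N);
     ([:: 1; 0; 0; 1], [:: 0; 1; 2; 3]%N, [:: 0; 3]%N);
     ([:: 1; 0; 0; -1], [:: 5; 4; 7; 6]%N, [:: 0; 3]%N);
     ([:: -1; 0; 0; 1], [:: 5; 4; 7; 6]%N, [:: 0; 3]%N);
     ([:: -1; 0; 0; -1], [:: 0; 1; 2; 3]%N, [:: 0; 3]%N);
     ([:: 0; 1; 1; 0], [:: 4; 0; 3; 7]%N, [:: 1; 2]%N);
     ([:: 0; 1; -1; 0], [:: 1; 5; 6; 2]%N, [:: 1; 2]%N);
     ([:: 0; -1; 1; 0], [:: 1; 5; 6; 2]%N, [:: 1; 2]%N);
     ([:: 0; -1; -1; 0], [:: 4; 0; 3; 7]%N, [:: 1; 2]%N);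
     ([:: 0; 1; 0; 1], [:: 2; 0; 5; 7]%N, [:: 1; 3]%N);
     ([:: 0; 1; 0; -1], [:: 1; 3; 6; 4]%N, [:: 1; 3]%N);
     ([:: 0; -1; 0; 1], [:: 1; 3; 6; 4]%N, [:: 1; 3]%N);
     ([:: 0; -1; 0; -1], [:: 2; 0; 5; 7]%N, [:: 1; 3]%N);
     ([:: 0; 0; 1; 1], [:: 1; 0; 6; 7]%N, [:: 2; 3]%N);
     ([:: 0; 0; 1; -1], [:: 2; 3; 5; 4]%N, [:: 2; 3]%N);
     ([:: 0; 0; -1; 1], [:: 2; 3; 5; 4]%N, [:: 2; 3]%N);
     ([:: 0; 0; -1; -1], [:: 1; 0; 6; 7]%N, [:: 2; 3]%N)].

Definition octahedron_tetrahedra (q ij : seq nat) : seq (seq nat) :=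
  [seq [:: tr.1.1; tr.1.2; tr.2; (8 + k)%N] | k <- ij,
    tr <- [:: (nth 0 q 0, nth 0 q 1, nth 0 q 2); (nth 0 q 1, nth 0 q 2, nth 0 q 3)]]%N.

(** The last two tests are converse to each other: the four listed tetrahedra lie over the facet,
    and no other tetrahedron of [K] does. *)
Definition octahedron_check (o : seq int * seq nat * seq nat) : bool :=
  let: (r, q, ij) := o in
  let L := lift_in r in let T := octahedron_tetrahedra q ij in
  let A := L (nth 0 q 0)%N in let B := L (nth 0 q 1)%N in
  let C := L (nth 0 q 2)%N in let D := L (nth 0 q 3)%N in
  let U := L (8 + nth 0 ij 0)%N in let W := L (8 + nth 0 ij 1)%N in
  [&& [&& size q == 4, uniq q, all (fun a => a < 8) q, size ij == 2, uniq ij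
        & all (fun k => k < 4) ij]%N,
      [&& uniq [:: A; B; C; D; U; W], all (fun v => v \in [:: A; B; C; D; U; W])
            [seq v <- V24 | dotz r v == 2]
        & all (fun v => (v \in V24) && (dotz r v == 2)) [:: A; B; C; D; U; W]],
      [&& squarez A B D C, squarez A U D W & squarez B U C W],
      all (fun s => has (fun t => perm_eq t s && has (fun e =>
        all (fun v => L v == opp_if e (lift_at (apex t) v)) t) [:: false; true]) tetrahedra) T
    & all (fun t => has (perm_eq t) T) [seq t <- tetrahedra |
        all (fun u => dotz r u == 2) (lifts t) || all (fun u => dotz r u == -2) (lifts t)]].

Lemma octahedra_checkT : all octahedron_check octahedra.
Proof. rewrite /octahedron_check V24.unlock; by lazy. Qed.

Lemma octahedra_roots : all (fun r => has (fun o => o.1.1 == r) octahedra) roots.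
Proof. rewrite roots.unlock; by lazy. Qed.

(** One sign must serve all common vertices at once; vertexwise agreement up to sign would not make
    the two affine lifts agree on the common face modulo the antipodal map. *)
Definition sign_check : bool :=
  all (fun t => all (fun t' =>
    has (fun e => all (fun v => (v \in t') ==> (lift_at (apex t) v == opp_if e (lift_at (apex t') v))) t)
      [:: false; true]) tetrahedra) tetrahedra.

Lemma sign_checkT : sign_check.
Proof. by lazy. Qed.

Lemma dual_rootP t v w : t \in tetrahedra -> v \in t -> w \in t ->
  dotz (dual_root t v) (lift_at (apex t) w) = if w == v then 2 else 0.
Proof.
move=> /(allP dual_checkT)/and5P[_ _ _ _ /eqP +] vt wt.
rewrite -map_comp => /eq_in_map /(_ v vt) /=; rewrite -map_comp => /eq_in_map.
exact.
Qed.

(** * Linear coordinates on the cones of the fan *)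

Section Fan.
Variable R : realType.
Implicit Types (x : 'rV[R]_(8 + 4)) (y : 'rV[R]_4) (t : seq nat) (e : bool).
Local Notation vecR := (vecR R).

Definition MR (i : nat) : 'M[R]_(8 + 4, 4) := \matrix_(v, j) ((lift_at i v)`_j)%:~R.

Definition NR t : 'M[R]_(4, 8 + 4) :=
  \matrix_(j, v) (if val v \in t then ((dual_root t v)`_j)%:~R / 2 else 0).

Definition supp x t := forall v : 'I_(8 + 4), val v \notin t -> x 0 v = 0.

Definition in_cone t y := forall v, v \in t -> 0 <= dot (vecR (dual_root t v)) y.

Lemma row_MR i v : row v (MR i) = vecR (lift_at i v).
Proof. by apply/rowP => j; rewrite !mxE. Qed.

Lemma mul_MR x i : x *m MR i = \sum_v x 0 v *: vecR (lift_at i v).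
Proof. by rewrite mulmx_sum_row; apply: eq_bigr => v _; rewrite row_MR. Qed.

Lemma mul_NR y t v : (y *m NR t) 0 v =
  if val v \in t then dot (vecR (dual_root t v)) y / 2 else 0.
Proof.
rewrite mxE; case: ifPn => vt; last first.
  by rewrite big1 // => j _; rewrite mxE (negbTE vt) mulr0.
rewrite dotE mulr_suml; apply: eq_bigr => j _.
by rewrite !mxE vt mulrA [y 0 j * _]mulrC.
Qed.

Lemma supp_NR y t : supp (y *m NR t) t.
Proof. by move=> v vt; rewrite mul_NR (negbTE vt). Qed.

Lemma MRK t x : t \in tetrahedra -> supp x t -> x *m MR (apex t) *m NR t = x.
Proof.
move=> tT xt; apply/rowP => v; rewrite mul_NR; case: ifPn => [vt|/xt //].
have D := dual_rootP tT vt.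
rewrite mul_MR dot_sumr (bigD1 v) //= big1 ?addr0.
  rewrite dotZr dot_vecR D // eqxx.
  by rewrite -mulrA divff ?mulr1 // pnatr_eq0.
move=> w wv; rewrite dotZr dot_vecR.
have [wt|/xt ->] := boolP (val w \in t); last by rewrite mul0r.
by rewrite D // (_ : (val w == val v) = false) ?mulr0 //; apply: negbTE.
Qed.

Lemma sum_ord_seq (V : nmodType) (n : nat) (f : nat -> V) (t : seq nat) :
  uniq t -> all (fun v => v < n)%N t ->
  \sum_(v < n) (if val v \in t then f v else 0) = \sum_(v <- t) f v.
Proof.
move=> ut /allP tn; rewrite -(big_mkord xpredT (fun v => if v \in t then f v else 0)).
rewrite -big_mkcond -big_filter; apply: perm_big; apply: uniq_perm => //.
  by rewrite filter_uniq ?iota_uniq.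
by move=> v; rewrite mem_filter mem_index_iota andb_idr // => /tn.
Qed.

(** Restricted to the four vertices of [t] the matrices become square, and a one-sided inverse of a
    square matrix is two-sided. *)
Lemma NRK t y : t \in tetrahedra -> y *m NR t *m MR (apex t) = y.
Proof.
move=> tT; have /and5P[/eqP st ut _ tn _] := allP dual_checkT t tT.
pose tp (p : 'I_4) := nth 0%N t p.
have tpt p : tp p \in t by rewrite mem_nth ?st.
pose M : 'M[R]_4 := \matrix_(p, k) ((lift_at (apex t) (tp p))`_k)%:~R.
pose N : 'M[R]_4 := \matrix_(j, p) (((dual_root t (tp p))`_j)%:~R / 2).
have MN : M *m N = 1%:M.
  apply/matrixP => p q; rewrite !mxE.
  have -> : \sum_j M p j * N j q = dot (vecR (dual_root t (tp q))) (vecR (lift_at (apex t) (tp p))) / 2.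
    by rewrite dotE mulr_suml; apply: eq_bigr => j _; rewrite !mxE mulrA mulrAC mulrC mulrA.
  rewrite dot_vecR dual_rootP // /tp nth_uniq ?st // (_ : (val p == val q) = (p == q)) //.
  by case: eqP; rewrite ?mul0r // divff // pnatr_eq0.
suff NM : NR t *m MR (apex t) = 1%:M by rewrite -mulmxA NM mulmx1.
rewrite -(mulmx1C MN); apply/matrixP => j k; rewrite !mxE.
transitivity (\sum_(v < 8 + 4) (if val v \in t then
    ((dual_root t v)`_j)%:~R / 2 * ((lift_at (apex t) v)`_k)%:~R else 0 : R)).
  by apply: eq_bigr => v _; rewrite !mxE; case: ifP; rewrite ?mul0r.
rewrite (sum_ord_seq (fun v => ((dual_root t v)`_j)%:~R / 2 * ((lift_at (apex t) v)`_k)%:~R : R)) //.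
by rewrite (big_nth 0%N) st big_mkord; apply: eq_bigr => p _; rewrite !mxE.
Qed.

Lemma in_cone_NR t y : in_cone t y -> forall v, 0 <= (y *m NR t) 0 v.
Proof. by move=> yt v; rewrite mul_NR; case: ifP => // /yt ?; rewrite divr_ge0. Qed.

Lemma in_cone_MR t x : t \in tetrahedra -> supp x t -> (forall v, 0 <= x 0 v) ->
  in_cone t (x *m MR (apex t)).
Proof.
move=> tT xt x0 v vt.
have /and5P[_ _ _ /allP tn _] := allP dual_checkT t tT.
have := x0 (Ordinal (tn v vt)); rewrite -{1}(MRK tT xt) mul_NR /= vt.
by rewrite pmulr_lge0 ?invr_gt0.
Qed.

Lemma dot_pair_root a i b j y : (i < 4)%N -> (j < 4)%N ->
  dot (vecR (pair_root a i b j)) y = a%:~R * y 0 (inord i) + b%:~R * y 0 (inord j).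
Proof.
move=> i4 j4; rewrite dotE.
have E (c : int) k : (k < 4)%N -> \sum_(m < 4) (if val m == k then c else 0)%:~R * y 0 m = c%:~R * y 0 (inord k).
  move=> k4; rewrite (bigD1 (inord k)) //= inordK // eqxx big1 ?addr0 // => m mk.
  case: eqP => [mk'|_]; last by rewrite mul0r.
  by rewrite -mk' inord_val eqxx in mk.
rewrite -!E // -big_split /=; apply: eq_bigr => m _.
by rewrite !mxE nth_mkseq // rmorphD mulrDl.
Qed.

Lemma cover_checkP (D : seq (seq (seq int))) y : cover_check D ->
  exists2 ds, ds \in D & exists e : bool, forall d, d \in ds -> 0 <= dot (vecR d) ((-1) ^+ e *: y).
Proof.
move=> cov; pose yn m := y 0 (inord m : 'I_4).
(* Sorting by decreasing absolute value selects the permutation of the certificate that applies to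
   [y]. *)
pose le a b := `|yn b| <= `|yn a|.
have le_total : total le by move=> a b; exact: le_total.
have : sort le (iota 0 4) \in permutations (iota 0 4) by rewrite mem_permutations perm_sort.
have := sort_sorted le_total (iota 0 4); have := size_sort le (iota 0 4).
have : all (fun m => m < 4)%N (sort le (iota 0 4)).
  by apply/allP => m; rewrite mem_sort mem_iota.
case: (sort le (iota 0 4)) => [|i [|j [|k [|l [|//]]]]] //=.
move=> /and5P[i4 j4 k4 l4 _] _ /and4P[ij jk kl _] pP.
(* The fan is symmetric, so [y] may be replaced by its negative to make its largest coordinate
   nonnegative. *)
pose e := yn i < 0; pose z := (-1) ^+ e *: y; pose zn m := z 0 (inord m : 'I_4).
have znE m : `|zn m| = `|yn m| by rewrite /zn mxE normrM normrX normrN1 expr1n mul1r.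
have zi : zn i = `|yn i|.
  rewrite /zn mxE -/(yn i) /e; case: ltrP => [yi|yi]; rewrite ?expr1 ?expr0 ?mul1r.
    by rewrite mulN1r ltr0_norm.
  by rewrite ger0_norm.
pose s : int := if zn j < 0 then -1 else 1.
have sj : s%:~R * zn j = `|zn j|.
  rewrite /s; case: ltrP => zj; first by rewrite ltr0_norm // mulN1r.
  by rewrite ger0_norm // mul1r.
have /andP[k1 k2] : - `|zn j| <= zn k <= `|zn j| by rewrite -ler_norml !znE.
have /andP[l1 l2] : - `|zn j| <= zn l <= `|zn j|.
  by rewrite -ler_norml !znE; exact: le_trans kl jk.
have sS : s \in [:: 1; -1] by rewrite /s; case: ifP.
have := allP (allP cov _ pP) s sS; rewrite [nth _ _ 0]/= [nth _ _ 1]/= [nth _ _ 2]/= [nth _ _ 3]/=.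
cbv zeta; set pool := [:: pair_root 1 i _ _; _; _; _; _].
have pool_ge0 r : r \in pool -> 0 <= dot (vecR r) z.
  rewrite !inE => /or4P[/eqP->|/eqP->|/eqP->|/orP[/eqP->|/eqP->]];
    rewrite dot_pair_root // -/(zn i) -/(zn j) -/(zn k) -/(zn l)
      ?rmorphN ?mulNr ?mul1r ?sj ?zi ?subr_ge0 ?znE // -?znE.
  - by rewrite -lerBlDr sub0r lerNl.
  - by [].
  - by rewrite -lerBlDr sub0r lerNl.
  - by [].
have step d : has (all (mem (d :: pool))) D -> 0 <= dot (vecR d) z ->
    exists2 ds, ds \in D & exists e : bool, forall d, d \in ds -> 0 <= dot (vecR d) ((-1) ^+ e *: y).
  move=> /hasP[ds dsD /allP dp] dz; exists ds => //; exists e => c /dp.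
  by rewrite inE => /orP[/eqP -> //|]; exact: pool_ge0.
have both (f : int) : has (all (mem (pair_root 1 k f l :: pool))) D &&
   has (all (mem (pair_root (-1) k (- f) l :: pool))) D ->
    exists2 ds, ds \in D & exists e : bool, forall d, d \in ds -> 0 <= dot (vecR d) ((-1) ^+ e *: y).
  move=> /andP[h1 h2]; have [d0|d0] := leP 0 (dot (vecR (pair_root 1 k f l)) z).
    exact: step h1 d0.
  apply: step h2 _; move: d0; rewrite !dot_pair_root // !rmorphN !mulNr mul1r => d0.
  by rewrite -opprD oppr_ge0 ltW.
by move=> /or3P[/both //|/both //|].
Qed.

Lemma cone_cover y : exists2 t, t \in tetrahedra & exists e : bool, in_cone t ((-1) ^+ e *: y).
Proof.
have [_ /mapP[t tT ->] [e H]] := cover_checkP y cover_checkT.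
by exists t => //; exists e => v vt; apply/H/map_f.
Qed.

Lemma dot_mul_MR r x i : dot (vecR r) (x *m MR i) = \sum_v x 0 v * (dotz r (lift_at i v))%:~R.
Proof. by rewrite mul_MR dot_sumr; apply: eq_bigr => v _; rewrite dotZr dot_vecR. Qed.

Lemma vecR_opp_if e u : vecR (opp_if e u) = (-1) ^+ e *: vecR u.
Proof. by case: e; rewrite /= ?vecR_opp ?expr1 ?scaleN1r ?expr0 ?scale1r. Qed.

(* If a root separates the lifted tetrahedra, a point of both cones lies on
   its hyperplane. *)
Lemma agree_halfP t t' e x x' : t \in tetrahedra -> t' \in tetrahedra ->
  supp x t -> supp x' t' -> (forall v, 0 <= x 0 v) -> (forall v, 0 <= x' 0 v) ->
  x *m MR (apex t) = (-1) ^+ e *: (x' *m MR (apex t')) ->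
  forall v, x 0 v != 0 -> (val v \in t') /\
    lift_at (apex t) v = opp_if e (lift_at (apex t') v).
Proof.
move=> tT tT' xt xt' x0 x0' E v xv.
have vt : val v \in t by apply: contraNT xv => /xt ->.
have /and5P[/eqP st ut _ _ _] := allP dual_checkT t tT.
have /and5P[_ ut' _ _ _] := allP dual_checkT t' tT'.
have agr : agree_half e (t, (lifts t, root_table t)) (t', (lifts t', root_table t')).
  have := allP (allP agree_checkT _ (map_f _ tT)) _ (map_f _ tT').
  by case: (e) => /andP[].
have vI : index (val v) t \in iota 0 4 by move: vt; rewrite mem_iota -index_mem st.
have := allP agr _ vI; rewrite /= nth_index // => /orP[|/andP[vt' /eqP lv]]; last first.
  split=> //; move: lv; rewrite /lifts !(nth_map 0%N) ?index_mem //.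
  by rewrite !nth_index.
move=> /hasP[sv /mapP[q]]; rewrite mem_filter /root_table zip_map.
move=> /andP[+ /mapP[r rR qE]] ->; rewrite {}qE /=.
rewrite (nth_map [::]) ?size_map ?index_mem // /lifts !all_map.
rewrite (nth_map 0%N) ?index_mem // nth_index // => sep rv.
exfalso; move/negP: rv; apply; rewrite -(intr_eq0 R).
have dE : \sum_w x 0 w * (dotz r (lift_at (apex t) w))%:~R =
  (-1) ^+ e * \sum_w x' 0 w * (dotz r (lift_at (apex t') w))%:~R.
  by rewrite -!dot_mul_MR E dotZr.
(* A sum of nonnegative terms equal to a sum of nonpositive ones is 0 term by term, so the root
   vanishes at every vertex that carries weight. *)
have main (x1 x2 : 'rV[R]_(8 + 4)) t1 t2 (a b : R) : supp x1 t1 -> supp x2 t2 ->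
    (forall v, 0 <= x1 0 v) -> (forall v, 0 <= x2 0 v) ->
    (forall w, w \in t1 -> 0 <= a * (dotz r (lift_at (apex t1) w))%:~R) ->
    (forall w, w \in t2 -> b * (dotz r (lift_at (apex t2) w))%:~R <= 0) ->
    a * (\sum_w x1 0 w * (dotz r (lift_at (apex t1) w))%:~R) =
    b * (\sum_w x2 0 w * (dotz r (lift_at (apex t2) w))%:~R) ->
    forall v, x1 0 v != 0 -> a * (dotz r (lift_at (apex t1) v))%:~R = 0.
  move=> s1 s2 p1 p2 r1 r2 S12 u xu.
  have T1 w : 0 <= x1 0 w * (a * (dotz r (lift_at (apex t1) w))%:~R).
    have [wt|/s1 ->] := boolP (val w \in t1); last by rewrite mul0r.
    by rewrite mulr_ge0 // r1.
  have T2 w : x2 0 w * (b * (dotz r (lift_at (apex t2) w))%:~R) <= 0.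
    have [wt|/s2 ->] := boolP (val w \in t2); last by rewrite mul0r.
    by rewrite mulr_ge0_le0 // r2.
  have : \sum_w x1 0 w * (a * (dotz r (lift_at (apex t1) w))%:~R) == 0.
    rewrite eq_le sumr_ge0 // andbT.
    under eq_bigr do rewrite mulrCA.
    rewrite -mulr_sumr S12 mulr_sumr; apply: sumr_le0 => w _.
    by rewrite mulrCA.
  rewrite psumr_eq0 // => /allP /(_ u (mem_index_enum _)) /=.
  by rewrite mulf_eq0 (negbTE xu) => /eqP.
have rge0 (l : seq nat) i : all (fun w => 0 <= dotz r (lift_at i w)) l ->
    forall w, w \in l -> 0 <= (dotz r (lift_at i w))%:~R :> R.
  by move=> /allP H w /H; rewrite ler0z.
have rle0 (l : seq nat) i : all (fun w => dotz r (lift_at i w) <= 0) l ->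
    forall w, w \in l -> (dotz r (lift_at i w))%:~R <= 0 :> R.
  by move=> /allP H w /H; rewrite lerz0.
case/orP: sep => /andP[h1 h2].
  have -> : (dotz r (lift_at (apex t) v))%:~R = 1 * (dotz r (lift_at (apex t) v))%:~R :> R.
    by rewrite mul1r.
  apply/eqP; apply: (main x x' t t' 1 ((-1) ^+ e)) => //.
  - by move=> w wt; rewrite mul1r; exact: rge0 h1 w wt.
  - move=> w wt; case: (e) h2 => h2; rewrite ?expr1 ?expr0 ?mul1r ?mulN1r.
      by rewrite oppr_le0; exact: rge0 h2 w wt.
    exact: rle0 h2 w wt.
  - by rewrite mul1r.
have -> : (dotz r (lift_at (apex t) v))%:~R = - ((-1) * (dotz r (lift_at (apex t) v))%:~R) :> R.
  by rewrite mulN1r opprK.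
apply/eqP; rewrite (main x x' t t' (-1) (- (-1) ^+ e)) ?oppr0 //.
- by move=> w wt; rewrite mulN1r oppr_ge0; exact: rle0 h1 w wt.
- move=> w wt; case: (e) h2 => h2; rewrite ?expr1 ?expr0 ?opprK ?mul1r ?mulN1r.
    exact: rle0 h2 w wt.
  by rewrite oppr_le0; exact: rge0 h2 w wt.
- by rewrite dE mulN1r mulNr.
Qed.

(** By [agree_halfP] with the roles exchanged, the coordinates with respect to [t'] live on vertices
    of [t] whose lifts match up to the sign [e]. They are thus coordinates with respect to [t] as
    well, and those are unique. *)
Lemma cone_agree t t' e y : t \in tetrahedra -> t' \in tetrahedra ->
  in_cone t y -> in_cone t' ((-1) ^+ e *: y) -> y *m NR t = ((-1) ^+ e *: y) *m NR t'.
Proof.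
move=> tT tT' yt yt'; set x := y *m NR t; set x' := _ *m NR t'.
have xE : x *m MR (apex t) = y by exact: NRK.
have xE' : x' *m MR (apex t') = (-1) ^+ e *: y by exact: NRK.
have ee : (-1) ^+ e * (-1) ^+ e = 1 :> R by rewrite -expr2 sqrr_sign.
have x0 : forall v, 0 <= x 0 v by exact: in_cone_NR.
have x0' : forall v, 0 <= x' 0 v by exact: in_cone_NR.
have H' v : x' 0 v != 0 -> (val v \in t) /\
    lift_at (apex t') v = opp_if e (lift_at (apex t) v).
  apply: (@agree_halfP t' t e x' x) => //; rewrite ?xE //; exact: supp_NR.
have st : supp x' t.
  by move=> v vt; apply/eqP; apply: contraNT vt => /H'[].
suff -> : x = x' *m MR (apex t) *m NR t by rewrite MRK.
rewrite /x -xE NRK //; congr (_ *m NR t).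
have -> : y = (-1) ^+ e *: (x' *m MR (apex t')).
  by rewrite xE' scalerA ee scale1r.
rewrite !mul_MR scaler_sumr; apply: eq_bigr => v _; rewrite scalerA mulrC -scalerA.
have [->|/H'[_ ->]] := eqVneq (x' 0 v) 0; first by rewrite !scale0r.
by rewrite vecR_opp_if (scalerA _ _ (vecR _)) ee scale1r.
Qed.

Lemma cone_coverT : exists f : 'rV[R]_4 -> seq nat * bool,
  forall y, (f y).1 \in tetrahedra /\ in_cone (f y).1 ((-1) ^+ (f y).2 *: y).
Proof.
have /choice[f fP] : forall y, exists te : seq nat * bool,
    te.1 \in tetrahedra /\ in_cone te.1 ((-1) ^+ te.2 *: y).
  by move=> y; have [t tT [e yt]] := cone_cover y; exists (t, e).
by exists f.
Qed.

(* The barycentric coordinates of y, or -y, in a cone of the fan. *)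
Definition Lam y : 'rV[R]_(8 + 4) :=
  let te := projT1 (cid cone_coverT) y in ((-1) ^+ te.2 *: y) *m NR te.1.

Lemma LamE t e y : t \in tetrahedra -> in_cone t ((-1) ^+ e *: y) ->
  Lam y = ((-1) ^+ e *: y) *m NR t.
Proof.
move=> tT yt; rewrite /Lam; case: (cid _) => f /= /(_ y)[].
case: (f y) => t' e' /= tT' yt'.
have := cone_agree (e := e (+) e') tT tT' yt; rewrite scalerA signr_addb mulrAC -expr2 sqrr_sign mul1r.
by move=> ->.
Qed.

Lemma Lam_cone y : exists2 t, t \in tetrahedra & exists2 e : bool, in_cone t ((-1) ^+ e *: y) &
  Lam y = ((-1) ^+ e *: y) *m NR t.
Proof.
have [t tT [e yt]] := cone_cover y; exists t => //; exists e => //.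
exact: LamE.
Qed.

Lemma Lam_ge0 y v : 0 <= Lam y 0 v.
Proof. by have [t tT [e yt ->]] := Lam_cone y; exact: in_cone_NR. Qed.

Lemma Lam_MR t x : t \in tetrahedra -> supp x t -> (forall v, 0 <= x 0 v) ->
  Lam (x *m MR (apex t)) = x.
Proof.
move=> tT xt x0; rewrite (@LamE t false) ?expr0 ?scale1r ?MRK //.
exact: in_cone_MR.
Qed.

Lemma LamZ (a : R) y : Lam (a *: y) = `|a| *: Lam y.
Proof.
have [t tT [e yt ->]] := Lam_cone y.
have aE : `|a| = (-1) ^+ (a < 0)%R * a by rewrite -normrEsign.
rewrite (@LamE t (e (+) (a < 0)) (a *: y)) //; last first.
  move=> v vt; rewrite scalerA signr_addb -mulrA -aE mulrC -scalerA dotZr.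
  by rewrite mulr_ge0 // yt.
by rewrite scalerA signr_addb -mulrA -aE mulrC -scalerA -scalemxAl.
Qed.

Lemma Lam_sum_gt0 y : y <> 0 -> 0 < \sum_v Lam y 0 v.
Proof.
move=> y0; rewrite lt_def sumr_ge0 ?andbT => [|v _]; last exact: Lam_ge0.
apply/eqP => /eqP; rewrite psumr_eq0 => [/allP L0|v _]; last exact: Lam_ge0.
apply: y0; have [t tT [e yt LE]] := Lam_cone y.
have : Lam y *m MR (apex t) = 0.
  suff -> : Lam y = 0 by rewrite mul0mx.
  by apply/rowP => v; rewrite [RHS]mxE; apply/eqP; exact: (L0 v (mem_index_enum v)).
by rewrite LE NRK // => /eqP; rewrite scaler_eq0 signr_eq0 => /eqP.
Qed.

End Fan.

(** * Homeomorphisms onto quotients by radial projection *)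

Section Topology.
Variable R : realType.

Lemma mulmx_continuous m n (M : 'M[R]_(m, n)) : continuous (fun x : 'rV[R]_m => x *m M).
Proof.
rewrite (_ : (fun x => _) = (fun x : 'rV[R]_m => \sum_i x 0 i *: row i M)); last first.
  by apply/funext => x; rewrite mulmx_sum_row.
apply: continuous_big; first exact: add_continuous.
move=> i _ x; apply: (@continuous_comp _ _ _ (fun x : 'rV[R]_m => x 0 i) (fun k => k *: row i M)).
  exact: coord_continuous.
exact: scalel_continuous.
Qed.

Lemma closed_cover_continuous (X Z : topologicalType) (I : choiceType) (s : seq I)
    (A : I -> set X) (f : X -> Z) :
  (forall x, exists2 i, i \in s & A i x) ->
  (forall i C, i \in s -> closed C -> closed (A i `&` f @^-1` C)) -> continuous f.
Proof.
move=> cov clC; apply/continuous_closedP => C cC.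
rewrite (_ : f @^-1` C = \big[setU/set0]_(i <- s) (A i `&` f @^-1` C)).
  by apply: closed_bigsetU => i ?; exact: clC.
rewrite -bigcup_seq; apply/seteqP; split=> [x Cx|x [i _ [_ //]]].
by have [i si Ax] := cov x; exists i.
Qed.

Lemma dot_continuous n (c : 'rV[R]_n) : continuous (dot c).
Proof.
rewrite (_ : dot c = fun x => (x *m c^T) 0 0); last first.
  by apply/funext => x; rewrite dotC.
move=> x; apply: (@continuous_comp _ _ _ (fun x : 'rV[R]_n => x *m c^T) (fun M : 'M[R]_1 => M 0 0)).
  exact: mulmx_continuous.
exact: coord_continuous.
Qed.

Lemma in_cone_closed t : closed [set y : 'rV[R]_4 | in_cone t y].
Proof.
rewrite (_ : [set y | _] = \bigcap_(v in [set` t]) (dot (vecR R (dual_root t v)) @^-1` [set a | 0 <= a])).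
  apply: closed_bigI => v _; apply: closed_comp; last exact: closed_ge.
  by move=> y _; exact: dot_continuous.
by apply/seteqP; split=> y H v vt; exact: H.
Qed.

(** [Lam] is linear on each of finitely many closed cones that cover the space. *)
Lemma Lam_continuous : continuous (@Lam R).
Proof.
apply: (@closed_cover_continuous _ _ _ [seq (t, e) | t <- tetrahedra, e <- [:: false; true]]
  (fun te => [set y | in_cone te.1 ((-1) ^+ te.2 *: y)])).
  move=> y; have [t tT [e yt]] := cone_cover y; exists (t, e) => //.
  by apply/allpairsP; exists (t, e); split=> //; case: (e).
move=> _ C /allpairsP[[t e] [/= tT _ ->]] cC /=.
rewrite (_ : _ `&` _ = [set y | in_cone t ((-1) ^+ e *: y)] `&`
   (fun y : 'rV[R]_4 => ((-1) ^+ e *: y) *m NR R t) @^-1` C); last first.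
  by apply/seteqP; split=> y [/= yt]; rewrite /= (LamE tT yt).
have cs : continuous (fun y : 'rV[R]_4 => (-1) ^+ e *: y) by exact: scaler_continuous.
apply: closedI.
  apply: (preimage_closed (f := fun y : 'rV[R]_4 => (-1) ^+ e *: y)); last exact: in_cone_closed.
  by move=> y _; exact: cs.
apply: preimage_closed => // y _.
apply: (@continuous_comp _ _ _ (fun y : 'rV[R]_4 => (-1) ^+ e *: y) (fun y => y *m NR R t)).
  exact: cs.
exact: mulmx_continuous.
Qed.

Lemma Lam_normalized_continuous (z : 'rV[R]_4) : z <> 0 ->
  {for z, continuous (fun y => (\sum_v Lam y 0 v)^-1 *: Lam y)}.
Proof.
move=> z0; apply: (@continuousZ _ _ _ (fun y => (\sum_v Lam y 0 v)^-1) (@Lam R)); last first.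
  exact: Lam_continuous.
apply: (@continuousV _ _ (fun y => \sum_v Lam y 0 v)).
  by rewrite gt_eqF // Lam_sum_gt0.
have : continuous (fun y : 'rV[R]_4 => \sum_v Lam y 0 v); last exact.
apply: continuous_big; first exact: add_continuous.
move=> v _ y; apply: (@continuous_comp _ _ _ (@Lam R) (fun M : 'rV[R]_(8 + 4) => M 0 v)).
  exact: Lam_continuous.
exact: coord_continuous.
Qed.

Lemma lift_sign t t' (x : 'rV[R]_(8 + 4)) : t \in tetrahedra -> t' \in tetrahedra ->
  supp x t -> supp x t' ->
  exists b : bool, x *m MR R (apex t) = (-1) ^+ b *: (x *m MR R (apex t')).
Proof.
move=> tT tT' xt xt'.
have /hasP[b _ /allP tb] := allP (allP sign_checkT t tT) t' tT'; exists b.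
rewrite !mul_MR scaler_sumr; apply: eq_bigr => v _.
rewrite scalerA mulrC -scalerA -vecR_opp_if.
have [vt|/xt ->] := boolP (val v \in t); last by rewrite !scale0r.
have [vt'|/xt' ->] := boolP (val v \in t'); last by rewrite !scale0r.
by have := tb _ vt; rewrite vt' => /eqP ->.
Qed.

Lemma realizationK (x : 'rV[R]_(8 + 4)) : realization R K x <->
  [/\ forall v, 0 <= x 0 v, \sum_v x 0 v = 1 & exists2 t, t \in tetrahedra & supp x t].
Proof. exact: realization_facets. Qed.

Local Notation Qt e := (quotient_topology {eq_quot e}).

(** Stated for both targets: [Y] is the set of nonzero vectors under proportionality, or the
    boundary of the 24-cell under the antipodal map. The last two hypotheses say that the relation
    stays within lines and identifies a vector, up to sign, with its normalisation by the total of
    [Lam]. *)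
Lemma fan_homeomorphism (Y : set 'rV[R]_4) (e : equiv_rel Y) :
  (forall t x, t \in tetrahedra -> supp x t -> (forall v, 0 <= x 0 v) ->
    \sum_v x 0 v = 1 -> Y (x *m MR R (apex t))) ->
  (forall y : Y, set_val y <> 0) ->
  (forall y y' : Y, e y y' -> exists2 c : R, c != 0 & set_val y' = c *: set_val y) ->
  (forall (y y1 : Y) (b : bool),
    set_val y1 = ((-1) ^+ b / \sum_v Lam (set_val y) 0 v) *: set_val y -> e y1 y) ->
  exists h : realization R K -> Qt e,
    homeomorphism h /\
    forall x t (y : Y), t \in tetrahedra -> supp (set_val x) t ->
      set_val y = set_val x *m MR R (apex t) -> h x = \pi_(Qt e) y.
Proof.
move=> Yfan Yn0 Yprop Ynorm.
have /choice[phi phiP] : forall x : realization R K, exists y : Y,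
    exists2 t, t \in tetrahedra & supp (set_val x) t /\ set_val y = set_val x *m MR R (apex t).
  move=> x; have /realizationK[x0 x1 [t tT xt]] := set_valP x.
  by exists (SigSub (mem_set (Yfan t _ tT xt x0 x1))); exists t.
pose h (x : realization R K) : Qt e := \pi_(Qt e) (phi x).
have hE x t (y : Y) : t \in tetrahedra -> supp (set_val x) t ->
    set_val y = set_val x *m MR R (apex t) -> h x = \pi_(Qt e) y.
  move=> tT xt yE; have [t' tT' [xt' yE']] := phiP x.
  have /realizationK[x0 x1 _] := set_valP x.
  apply/eqmodP; have [b E] := lift_sign tT' tT xt' xt.
  by apply: (Ynorm _ _ b); rewrite yE yE' Lam_MR // x1 divr1.
have GP (y : Y) : realization R K ((\sum_v Lam (set_val y) 0 v)^-1 *: Lam (set_val y)).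
  have s0 := Lam_sum_gt0 (Yn0 y).
  apply/realizationK; split.
  - by move=> v; rewrite mxE mulr_ge0 ?Lam_ge0 // invr_ge0 ltW.
  - by under eq_bigr do rewrite mxE; rewrite -mulr_sumr mulVf // gt_eqF.
  - have [t tT [b yt LE]] := Lam_cone (set_val y); exists t => // v vt.
    by rewrite mxE LE supp_NR ?mulr0.
pose G (y : Y) : realization R K := SigSub (mem_set (GP y)).
have GE (y y' : Y) : e y y' -> G y = G y'.
  move=> /Yprop[c c0 yE]; apply: val_inj => /=; rewrite yE LamZ.
  have s0 := Lam_sum_gt0 (Yn0 y).
  have -> : \sum_v (`|c| *: Lam (set_val y)) 0 v = `|c| * \sum_v Lam (set_val y) 0 v.
    by rewrite mulr_sumr; apply: eq_bigr => v _; rewrite mxE.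
  rewrite scalerA; congr (_ *: _); field.
  by rewrite normr_eq0 c0 gt_eqF.
have Gc : continuous G.
  apply: (@continuous_comp_initial _ _ _ set_val).
  rewrite (_ : _ \o _ = (fun y : Y => (\sum_v Lam (set_val y) 0 v)^-1 *: Lam (set_val y))) //.
  move=> y; apply: (@continuous_comp _ _ _ (set_val : Y -> 'rV[R]_4)
    (fun z => (\sum_v Lam z 0 v)^-1 *: Lam z)); first exact: initial_continuous.
  exact: Lam_normalized_continuous.
exists h; split; last exact: hE.
split; last first.
  (* The normalised coordinates [G] are constant on classes, so they descend to the quotient. *)
  exists (G \o repr); split.
  - apply: repr_comp_continuous => // y y' /eqP/eqmodP yy'; apply/eqP; exact: GE.
  - move=> x /=; have /realizationK[x0 x1 _] := set_valP x.
    have -> : G (repr (h x)) = G (phi x).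
      by apply: GE; apply/eqmodP; rewrite reprK.
    have [t tT [xt yE]] := phiP x.
    by apply: val_inj => /=; rewrite yE Lam_MR // x1 invr1 scale1r.
  - move=> q /=; set y := repr q; have [t tT [b yt LE]] := Lam_cone (set_val y).
    have gt : supp (set_val (G y)) t.
      by move=> v vt; rewrite /= mxE LE supp_NR ?mulr0.
    have /realizationK[x0 x1 _] := GP y.
    rewrite (hE _ t (SigSub (mem_set (Yfan t _ tT gt x0 x1))) tT gt) // -[RHS]reprK.
    apply/eqmodP; apply: (Ynorm _ _ b) => /=.
    transitivity (((\sum_v Lam (set_val y) 0 v)^-1 *: Lam (set_val y)) *m MR R (apex t)) => //.
    by rewrite -scalemxAl [X in _ *: (X *m _)]LE NRK // scalerA mulrC.
apply: (@closed_cover_continuous _ _ _ tetrahedra (fun t => [set x | supp (set_val x) t])).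
  by move=> x; have /realizationK[_ _ [t tT xt]] := set_valP x; exists t.
move=> t C tT cC.
(* A closed set of the quotient pulls back to the trace on [Y] of an ambient closed set, whose
   preimage under the linear map on the simplex is closed. *)
have [W oW WE] : open (~` ((\pi_(Qt e) : Y -> Qt e) @^-1` C)).
  apply: closed_openC; have /continuous_closedP := @pi_continuous _ {eq_quot e}; exact.
rewrite (_ : _ `&` _ = [set x : realization R K | supp (set_val x) t] `&`
   (fun x : realization R K => set_val x *m MR R (apex t)) @^-1` (~` W)); last first.
  apply/seteqP; split=> x [/= xt xC]; split=> //=.
    have /realizationK[x0 x1 _] := set_valP x.
    pose y : Y := SigSub (mem_set (Yfan t _ tT xt x0 x1)).
    have : ~ (set_val @^-1` W) y by rewrite WE => -[]; rewrite /= -(hE x t y).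
    by [].
  have /realizationK[x0 x1 _] := set_valP x.
  pose y : Y := SigSub (mem_set (Yfan t _ tT xt x0 x1)).
  rewrite (hE x t y) //; apply: contrapT => yC; apply: xC.
  by have : (~` ((\pi_(Qt e) : Y -> Qt e) @^-1` C)) y := yC; rewrite -WE.
have vc : continuous (set_val : realization R K -> 'rV[R]_(8 + 4)) by exact: initial_continuous.
apply: closedI.
  rewrite (_ : [set x | _] = \bigcap_(v in [set v : 'I_(8 + 4) | val v \notin t])
     ((fun x : realization R K => (set_val x : 'rV[R]_(8 + 4)) 0 v) @^-1` [set 0])); last first.
    by apply/seteqP; split=> x H v; [move=> vt; exact: H|exact: H].
  apply: closed_bigI => v _; apply: preimage_closed; last exact: closed_eq.
  move=> x _; apply: (@continuous_comp _ _ _ (set_val : realization R K -> 'rV[R]_(8 + 4)) (fun M : 'rV[R]_(8 + 4) => M 0 v)).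
    exact: vc.
  exact: coord_continuous.
apply: preimage_closed; last exact: open_closedC.
move=> x _; apply: (@continuous_comp _ _ _ (set_val : realization R K -> 'rV[R]_(8 + 4)) (fun M : 'rV[R]_(8 + 4) => M *m _)).
  exact: vc.
exact: mulmx_continuous.
Qed.

End Topology.

(** * Equilibrium sets as subcomplexes *)

Section Subcomplexes.
Variable R : realType.

(** The subcomplex consists of the simplices mapped into [X]. The hypothesis says that [X] contains
    the image of the whole simplex as soon as it contains the image of a point with full support in
    it. *)
Lemma subcomplex_image (T : Type) (h : realization R K -> T) (X : set T) :
  (forall q, exists x, h x = q) ->
  (forall x x' : realization R K, X (h x) ->
    (forall v, (set_val x' : 'rV[R]_(8 + 4)) 0 v != 0 -> (set_val x : 'rV[R]_(8 + 4)) 0 v != 0) -> X (h x')) ->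
  exists L, is_subcomplex L K /\ h @` subpolyhedron L = X.
Proof.
move=> hsurj Xh; have [K0 Ks] : is_complex K := is_complex_of_facets _ _.
pose L := [set s in K | `[< forall x : realization R K, closed_simplex s x -> X (h x) >]]%SET.
have LP s : (s \in L) <-> (s \in K /\ forall x : realization R K, closed_simplex s x -> X (h x)).
  by rewrite inE; split=> [/andP[? /asboolP]|[-> /asboolP]].
exists L; split; first split; first split.
- by apply/negP => /LP[]; rewrite (negbTE K0).
- move=> s t /LP[sK sX] ts t0; apply/LP; split; first exact: Ks sK ts t0.
  move=> x xt; apply: sX => v vs; apply: xt; apply: contra vs.
  by move/fintype.subsetP: ts => /[apply].
- by apply/fintype.subsetP => s /LP[].
apply/seteqP; split=> [_ [x [_ [_ /LP[_ +]]] <-]|q Xq].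
  by apply=> v; rewrite inE negbK => /eqP.
have [x xq] := hsurj q; exists x => //; have [x0 [x1 xK]] := set_valP x.
split=> //; split=> //; apply/LP; split=> // x' x's.
apply: (Xh x); first by rewrite xq.
by move=> v; apply: contraNneq => xv; apply/eqP/x's; rewrite inE xv eqxx.
Qed.

Lemma facet_dot t (x : 'rV[R]_(8 + 4)) : t \in tetrahedra -> supp x t ->
  dot (vecR R (facet_root t)) (x *m MR R (apex t)) = 2 * \sum_v x 0 v.
Proof.
move=> tT xt; rewrite dot_mul_MR mulr_sumr; apply: eq_bigr => v _.
have [vt|/xt ->] := boolP (val v \in t); last by rewrite mul0r mulr0.
have /and3P[_ /allP H _] := allP facet_checkT t tT.
by rewrite (eqP (H _ (map_f _ vt))) mulrC.
Qed.

Lemma facet_neq0 t (x : 'rV[R]_(8 + 4)) : t \in tetrahedra -> supp x t ->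
  \sum_v x 0 v = 1 -> x *m MR R (apex t) <> 0.
Proof.
move=> tT xt x1 x0; have := facet_dot tT xt.
by rewrite x0 x1 mulr1 dot0r => /eqP; rewrite eq_sym pnatr_eq0.
Qed.

Lemma homeomorphism_surj (X Z : topologicalType) (h : X -> Z) : homeomorphism h ->
  forall q, exists x, h x = q.
Proof. by move=> [_ [g [_ _ gK]]] q; exists (g q). Qed.

Lemma MR_coord (x : 'rV[R]_(8 + 4)) i j :
  (x *m MR R i) 0 j = \sum_v x 0 v * ((lift_at i v)`_j)%:~R.
Proof. by rewrite mxE; apply: eq_bigr => v _; rewrite mxE. Qed.

Lemma apex_ge t (x : 'rV[R]_(8 + 4)) (b : bool) (k j : 'I_4) : t \in tetrahedra -> supp x t ->
  (forall v, 0 <= x 0 v) -> val k = apex t ->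
  forall v, 0 <= x 0 v * (((lift_at (apex t) v)`_k)%:~R - (-1) ^+ b * ((lift_at (apex t) v)`_j)%:~R).
Proof.
move=> tT xt x0 kE v.
have [vt|/xt ->] := boolP (val v \in t); last by rewrite mul0r.
have /and3P[_ _ /allP H] := allP facet_checkT t tT.
have := allP (H _ (map_f _ vt)) (val j); rewrite mem_iota ltn_ord => /(_ isT).
rewrite -kE => /andP[l1 l2]; rewrite mulr_ge0 // subr_ge0.
by case: b; rewrite ?expr1 ?expr0 ?mulN1r ?mul1r -?rmorphN ler_int // lerNl.
Qed.

(** Over a tetrahedron with apex [k], membership forces coordinate [i] in [I] to equal coordinate
    [k] up to sign. The difference of the two is a sum of nonnegative contributions of the vertices,
    so its vanishing depends only on the support and passes from [x] to [x']. *)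
Lemma equilibrium_triangulation_K : equilibrium_triangulation R 3 K.
Proof.
split; first exact: combinatorial_manifold_K.
have [|||| h [hom hE]] := @fan_homeomorphism R (@nonzero R 3) (proportional_equiv R 3).
- by move=> t x tT xt x0 x1; exact: facet_neq0.
- by move=> y; exact: (set_valP y).
- by move=> y y' /asboolP[c c0 ->]; exists c.
- move=> y y1 b yE; apply/asboolP.
  have s0 := Lam_sum_gt0 (set_valP y : set_val y <> 0).
  exists (((-1) ^+ b / \sum_v Lam (set_val y) 0 v)^-1).
    by rewrite invr_eq0 mulf_neq0 ?signr_eq0 // invr_eq0 gt_eqF.
  by rewrite yE scalerA mulVf ?scale1r // mulf_neq0 ?signr_eq0 // invr_eq0 gt_eqF.
exists h; split=> // I /set0Pn[i0 Ii0].
apply: subcomplex_image; first exact: homeomorphism_surj.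
move=> x x' [z [hz zI]] xx'.
have /realizationK[x0 x1 [t tT xt]] := set_valP x.
have /realizationK[x0' x1' _] := set_valP x'.
have xt' : supp (set_val x') t.
  by move=> v vt; apply: contrapT => /eqP /xx'; rewrite xt ?eqxx.
have nz : @nonzero R 3 (set_val x *m MR R (apex t)) := facet_neq0 tT xt x1.
have nz' : @nonzero R 3 (set_val x' *m MR R (apex t)) := facet_neq0 tT xt' x1'.
pose y : @nonzero R 3 := SigSub (mem_set nz).
pose y' : @nonzero R 3 := SigSub (mem_set nz').
exists y'; split; first exact: (hE _ t).
have yI i j : i \in I -> `|(set_val y : 'rV[R]_4) 0 j| <= `|(set_val y : 'rV[R]_4) 0 i|.
  have /eqmodP/asboolP[c c0 ->] : \pi_(RP R 3) z = \pi_(RP R 3) y.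
    by rewrite -hz; exact: (hE _ t).
  by move=> Ii; rewrite !mxE !normrM ler_pM2l ?normr_gt0 // zI.
have /and5P[_ _ k4 _ _] := allP dual_checkT t tT.
pose k : 'I_4 := Ordinal k4.
have diffE (w : 'rV[R]_(8 + 4)) (b : bool) j :
    (w *m MR R (apex t)) 0 k - (-1) ^+ b * (w *m MR R (apex t)) 0 j =
    \sum_v w 0 v * (((lift_at (apex t) v)`_k)%:~R - (-1) ^+ b * ((lift_at (apex t) v)`_j)%:~R).
  rewrite !MR_coord mulr_sumr -sumrB; apply: eq_bigr => v _.
  by rewrite mulrBr mulrCA.
have le_apex (w : 'rV[R]_(8 + 4)) (b : bool) j : supp w t -> (forall v, 0 <= w 0 v) ->
    (-1) ^+ b * (w *m MR R (apex t)) 0 j <= (w *m MR R (apex t)) 0 k.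
  move=> wt w0; rewrite -subr_ge0 diffE sumr_ge0 // => v _; exact: apex_ge.
move=> i j Ii.
pose b := (set_val y : 'rV[R]_4) 0 i < 0.
have bE : (-1) ^+ b * (set_val y : 'rV[R]_4) 0 i = `|(set_val y : 'rV[R]_4) 0 i|.
  by rewrite [RHS]normrEsign.
have /eqP : (set_val y : 'rV[R]_4) 0 k - (-1) ^+ b * (set_val y : 'rV[R]_4) 0 i = 0.
  apply/eqP; rewrite eq_le subr_ge0 subr_le0 le_apex // andbT bE.
  by apply: le_trans (yI i k Ii); exact: ler_norm.
rewrite /= diffE psumr_eq0 => [/allP xz|v _]; last exact: apex_ge.
have E' : (set_val y' : 'rV[R]_4) 0 k = (-1) ^+ b * (set_val y' : 'rV[R]_4) 0 i.
  apply/eqP; rewrite -subr_eq0 /= diffE big1 // => v _.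
  have [->|/xx' xv] := eqVneq ((set_val x' : 'rV[R]_(8 + 4)) 0 v) 0; first by rewrite mul0r.
  have := xz v (mem_index_enum _); rewrite /= mulf_eq0 (negbTE xv) /= => /eqP ->.
  by rewrite mulr0.
have le1 : `|(set_val y' : 'rV[R]_4) 0 j| <= (set_val y' : 'rV[R]_4) 0 k.
  by rewrite normrEsign le_apex.
apply: (le_trans le1); rewrite E'.
by apply: le_trans (ler_norm _) _; rewrite normrM normr_sign mul1r.
Qed.

End Subcomplexes.

(** * The subdivision of the quotient of the 24-cell *)

Section Cell.
Variable R : realType.
Local Notation vecR := (vecR R).
Local Notation P := (P24 R).
Local Notation bP := (boundary P).

Lemma P24_sign (b : bool) (y : 'rV[R]_4) : P y -> P ((-1) ^+ b *: y).
Proof. by case: b => Py; rewrite ?expr1 ?scaleN1r ?expr0 ?scale1r //; exact: P24_opp. Qed.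

Lemma lift_P24 i v : (i < 4)%N -> (v < 12)%N -> P (vecR (lift_at i v)).
Proof.
move=> i4 v12; apply: P24_vec.
by have /allP /(_ i) := lift_V24T; rewrite mem_iota i4 => /(_ isT) /allP; apply; rewrite mem_iota.
Qed.

Lemma apex_lt t : t \in tetrahedra -> (apex t < 4)%N.
Proof. by move=> /(allP dual_checkT)/and5P[]. Qed.

Lemma MR_P24 t (x : 'rV[R]_(8 + 4)) : t \in tetrahedra -> (forall v, 0 <= x 0 v) ->
  \sum_v x 0 v = 1 -> P (x *m MR R (apex t)).
Proof.
move=> tT x0 x1; rewrite mul_MR; apply: hull_convex => // v _.
by apply: lift_P24; [exact: apex_lt|exact: (ltn_ord v)].
Qed.

Definition facetR (r : seq int) : set 'rV[R]_4 := P `&` [set y | dot (vecR r) y = 2].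

Lemma facetR_face r : r \in roots -> face P (facetR r).
Proof.
move=> rR; exists (vecR r), 2; split=> // x; apply: P24_le => v vV.
by rewrite dot_vecR (ler_int _ _ 2) (allP (allP roots_leT r rR)).
Qed.

Lemma facetR_proper r y : r \in roots -> facetR r y -> proper_face P (facetR r).
Proof.
move=> rR [Py ry]; split; [exact: facetR_face|by exists y|].
move=> FP; have : facetR r (- y) by rewrite FP; exact: P24_opp.
move=> [_ /=]; rewrite dotNr ry => /eqP; rewrite eqNr pnatr_eq0.
by [].
Qed.

Lemma MR_facetR t (x : 'rV[R]_(8 + 4)) : t \in tetrahedra -> supp x t ->
  (forall v, 0 <= x 0 v) -> \sum_v x 0 v = 1 -> facetR (facet_root t) (x *m MR R (apex t)).
Proof.
by move=> tT xt x0 x1; split; [exact: MR_P24|rewrite /= facet_dot // x1 mulr1].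
Qed.

Lemma MR_boundary t (x : 'rV[R]_(8 + 4)) : t \in tetrahedra -> supp x t ->
  (forall v, 0 <= x 0 v) -> \sum_v x 0 v = 1 -> bP (x *m MR R (apex t)).
Proof.
move=> tT xt x0 x1; have Fx := MR_facetR tT xt x0 x1.
exists (facetR (facet_root t)); split=> //; apply: facetR_proper Fx.
by case/and3P: (allP facet_checkT t tT).
Qed.

(** By central symmetry, a bound [b <= 0] would force [c] to vanish on all of [P], and the face
    would be [P] itself. *)
Lemma proper_face_gt0 c (b : R) : (forall x, P x -> dot c x <= b) ->
  P `&` [set x | dot c x = b] <> P -> 0 < b.
Proof.
move=> cb FP; rewrite ltNge; apply/negP => b0; apply: FP.
apply/seteqP; split=> [x []//|x Px]; split=> //=.
have h1 := cb x Px; have := cb _ (P24_opp Px); rewrite dotNr => h2.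
have bz : b = 0.
  apply/eqP; rewrite eq_le b0 /=; move: (lerD h1 h2); rewrite subrr -mulr2n.
  by rewrite pmulrn_lge0.
by apply/eqP; rewrite eq_le h1 bz /=; rewrite bz lerNl oppr0 in h2.
Qed.

(** The facet root of the cone is at most 2 on [P], which bounds the sum by 1 from above. The
    functional supporting a face through [y] is at most [b] at all lifted vertices and equals [b] at
    [y], which bounds it from below. *)
Lemma boundary_sumLam (y : 'rV[R]_4) : bP y -> \sum_v Lam y 0 v = 1.
Proof.
move=> [F [[[c [b [cb FE]]] _ FP] Fy]]; rewrite FE in FP Fy.
have b0 := proper_face_gt0 cb FP; case: Fy => Py /= cy.
have [t tT [e yt LE]] := Lam_cone y.
have yE : Lam y *m MR R (apex t) = (-1) ^+ e *: y by rewrite LE NRK.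
apply/eqP; rewrite eq_le; apply/andP; split.
  have : dot (vecR (facet_root t)) ((-1) ^+ e *: y) <= 2.
    have rR : facet_root t \in roots by case/and3P: (allP facet_checkT t tT).
    have [c' [b' [c'b' E]]] := facetR_face rR.
    apply: P24_le (P24_sign e Py) => v vV.
    by rewrite dot_vecR (ler_int _ _ 2) (allP (allP roots_leT _ rR)).
  rewrite -yE facet_dot //; last by rewrite LE; exact: supp_NR.
  by rewrite -{2}[2]mulr1 ler_pM2l.
have bE : b = \sum_v Lam y 0 v * dot c ((-1) ^+ e *: vecR (lift_at (apex t) v)).
  have -> : b = dot c ((-1) ^+ e *: (Lam y *m MR R (apex t))).
    by rewrite yE scalerA -expr2 sqrr_sign scale1r.
  rewrite mul_MR scaler_sumr dot_sumr; apply: eq_bigr => v _.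
  by rewrite scalerA mulrC -scalerA dotZr.
rewrite -(ler_pM2r b0) mul1r mulr_suml {1}bE; apply: ler_sum => v _.
rewrite ler_wpM2l ?Lam_ge0 //; apply: cb; apply: P24_sign.
by apply: lift_P24; [exact: apex_lt|exact: (ltn_ord v)].
Qed.

Lemma boundary_neq0 (y : 'rV[R]_4) : bP y -> y <> 0.
Proof.
move=> [F [[[c [b [cb FE]]] _ FP] Fy]] y0; rewrite FE in FP Fy.
have := proper_face_gt0 cb FP; case: Fy => _ /= <-.
by rewrite y0 dot0r ltxx.
Qed.

(** A supporting functional that is maximal at a convex combination is maximal at each vertex of
    positive weight; the face therefore meets the simplex in a face of it. *)
Lemma face_simplex c (b0 : R) t (b : bool) (x : 'rV[R]_(8 + 4)) : (forall y, P y -> dot c y <= b0) ->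
  t \in tetrahedra -> (forall v, 0 <= x 0 v) -> \sum_v x 0 v = 1 ->
  dot c ((-1) ^+ b *: (x *m MR R (apex t))) = b0 ->
  forall v, x 0 v != 0 -> dot c ((-1) ^+ b *: vecR (lift_at (apex t) v)) = b0.
Proof.
move=> cb tT x0 x1 cx v xv.
have ge0 w : 0 <= x 0 w * (b0 - dot c ((-1) ^+ b *: vecR (lift_at (apex t) w))).
  rewrite mulr_ge0 // subr_ge0; apply/cb/P24_sign/lift_P24; first exact: apex_lt.
  exact: (ltn_ord w).
have : \sum_w x 0 w * (b0 - dot c ((-1) ^+ b *: vecR (lift_at (apex t) w))) == 0.
  under eq_bigr do rewrite mulrBr.
  rewrite sumrB -mulr_suml x1 mul1r -cx mul_MR scaler_sumr dot_sumr subr_eq0.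
  by apply/eqP/eq_bigr => w _; rewrite scalerA mulrC -scalerA dotZr.
rewrite psumr_eq0 // => /allP /(_ v (mem_index_enum _)) /=.
by rewrite mulf_eq0 (negbTE xv) subr_eq0 => /eqP.
Qed.

Lemma face_simplexW c (b0 : R) t (b : bool) (x : 'rV[R]_(8 + 4)) : 
  (forall v, x 0 v != 0 -> dot c ((-1) ^+ b *: vecR (lift_at (apex t) v)) = b0) ->
  \sum_v x 0 v = 1 -> dot c ((-1) ^+ b *: (x *m MR R (apex t))) = b0.
Proof.
move=> cx x1; rewrite mul_MR scaler_sumr dot_sumr -[RHS]mul1r -[X in _ = X * _]x1 mulr_suml.
apply: eq_bigr => v _; rewrite scalerA mulrC -scalerA dotZr.
by have [->|/cx ->//] := eqVneq (x 0 v) 0; rewrite !mul0r.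
Qed.

Lemma antipodal_sign (y y' : bP) (b : bool) :
  set_val y' = (-1) ^+ b *: set_val y -> antipodal y y'.
Proof.
rewrite /antipodal => ->; case: b; rewrite ?expr1 ?scaleN1r ?expr0 ?scale1r ?opprK ?eqxx //.
by rewrite orbT.
Qed.

Lemma antipodalP (y y' : bP) : antipodal y y' ->
  exists b : bool, set_val y' = (-1) ^+ b *: set_val y.
Proof.
move=> /orP[/eqP ->|/eqP ->]; [exists false|exists true];
  by rewrite ?expr0 ?scale1r ?expr1 ?scaleN1r ?opprK.
Qed.

Lemma antipodal_homeomorphism : exists h : realization R K -> antipodal_quotient bP,
  homeomorphism h /\
  forall x t (y : bP), t \in tetrahedra -> supp (set_val x) t ->
    set_val y = set_val x *m MR R (apex t) -> h x = \pi_(antipodal_quotient bP) y.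
Proof.
apply: (@fan_homeomorphism R bP (antipodal_equiv bP)).
- by move=> t x tT xt x0 x1; exact: MR_boundary.
- by move=> y; apply: boundary_neq0; exact: (set_valP y).
- by move=> y y' /antipodalP[b ->]; exists ((-1) ^+ b); rewrite ?signr_eq0.
- move=> y y1 b; rewrite (boundary_sumLam (set_valP y)) divr1 => yE.
  by have := antipodal_sign yE; rewrite antipodal_sym.
Qed.

Lemma K_facet s : s \in K -> exists2 t, t \in tetrahedra &
  s \subset [set v : 'I_(8 + 4) | val v \in t]%SET.
Proof. by rewrite inE => /andP[_ /hasP[t tT st]]; exists t. Qed.

(** The smaller of the weights at [p] and [s] can be moved from both points to [q] and [r], which
    eliminates one of the two. *)
Lemma hull_exchange n (T : eqType) (f : T -> 'rV[R]_n) (p s q r : T) (l : seq T) :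
  uniq (p :: s :: l) -> q \in l -> r \in l -> f p + f s = f q + f r ->
  hull (map f (p :: s :: l)) = hull (map f (p :: l)) `|` hull (map f (s :: l)).
Proof.
move=> u ql rl fE; have /= /and3P[] := u; rewrite inE negb_or => /andP[ps pl] sl ul.
have up : uniq (p :: l) by rewrite /= pl.
have us : uniq (s :: l) by rewrite /= sl.
have sumd (V : nmodType) (L : seq T) t0 (g : V) : uniq L -> t0 \in L ->
    \sum_(t <- L) (if t == t0 then g else 0) = g.
  move=> uL tL; rewrite (bigD1_seq t0) //= eqxx big1 ?addr0 // => t /negbTE -> //.
(* Here [a] is the point to be eliminated: its weight is added at [q] and [r] and taken off at
   [b]. *)
have main a b w x : uniq (b :: l) -> f a + f b = f q + f r -> (forall t, t \in b :: l -> 0 <= w t) ->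
    0 <= w a <= w b -> w a + \sum_(t <- b :: l) w t = 1 ->
    x = w a *: f a + \sum_(t <- b :: l) w t *: f t -> hull (map f (b :: l)) x.
  move=> ub fab w0 /andP[wa wab] w1 ->; apply/hull_mapP => //.
  have ql' : q \in b :: l by rewrite inE ql orbT.
  have rl' : r \in b :: l by rewrite inE rl orbT.
  have bl' : b \in b :: l by rewrite mem_head.
  exists (fun t => w t + ((if t == q then w a else 0) + (if t == r then w a else 0)
                   - (if t == b then w a else 0))); split.
  - have /= /andP[bl _] := ub.
    move=> t tl; have [->|tb] := eqVneq t b.
      case: eqP => [bq|_]; first by rewrite bq ql in bl.
      case: eqP => [br|_]; first by rewrite br rl in bl.
      by rewrite addr0 sub0r subr_ge0.
    by rewrite subr0 addr_ge0 ?w0 // addr_ge0 //; case: ifP.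
  - rewrite big_split sumrB big_split /= !sumd // addrK -w1.
    by rewrite addrC.
  - rewrite [RHS](eq_bigr (fun t => w t *: f t + ((if t == q then w a *: f q else 0) +
      (if t == r then w a *: f r else 0) - (if t == b then w a *: f b else 0)))).
      rewrite big_split sumrB big_split /= !sumd //.
      by rewrite -scalerDr -fab scalerDr addrK addrC.
    move=> t _; rewrite scalerDl scalerBl scalerDl.
    by congr (_ + (_ + _ - _)); case: eqP => [->|_]; rewrite ?scale0r.
apply/seteqP; split=> x; last first.
  case=> H; [apply: (hull_sub up u _ H)|apply: (hull_sub us u _ H)] => t;
    by rewrite !inE => /orP[->|->]; rewrite ?orbT.
move=> /(hull_mapP _ _ u)[w [w0 w1 xE]].
have wp : 0 <= w p by apply: w0; rewrite mem_head.
have ws : 0 <= w s by apply: w0; rewrite !inE eqxx orbT.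
have [le|/ltW le] := leP (w p) (w s); [right|left].
  apply: (main p s w) => //; rewrite ?wp ?le //.
  - by move=> t tl; apply: w0; rewrite inE tl orbT.
  - by rewrite -w1 [RHS]big_cons.
  - by rewrite xE big_cons.
apply: (main s p w) => //; rewrite ?ws ?le //.
- by rewrite addrC.
- by move=> t; rewrite inE => tl; apply: w0; rewrite !inE orbCA tl orbT.
- by rewrite -w1 !big_cons addrCA.
- by rewrite xE !big_cons addrCA.
Qed.

(** The three diagonals have a common midpoint, and each decomposition exchanges one diagonal for
    another. Points are named by position, so that distinctness of names holds by computation. *)
Lemma octahedron_hull n (A B C D U W : 'rV[R]_n) : A + D = B + C -> U + W = A + D ->
  [/\ hull [:: A; B; C; D] = hull [:: A; B; C] `|` hull [:: B; C; D],
      hull [:: A; B; C; D; U] = hull [:: A; B; C; U] `|` hull [:: B; C; D; U],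
      hull [:: A; B; C; D; W] = hull [:: A; B; C; W] `|` hull [:: B; C; D; W]
    & hull [:: A; B; C; D; U; W] = hull [:: A; B; C; D; U] `|` hull [:: A; B; C; D; W]].
Proof.
move=> AD UW; pose f k := nth 0 [:: A; B; C; D; U; W] k.
pose eqh (l l' : seq nat) (u : uniq l) (u' : uniq l') (ll : perm_eq l l') :=
  hull_eq f u u' (perm_mem ll).
have E := @hull_exchange n _ f; split.
- have := @E 0%N 3%N 1%N 2%N [:: 1; 2]%N isT isT isT AD.
  rewrite (@eqh [:: 0; 3; 1; 2]%N [:: 0; 1; 2; 3]%N isT isT isT) => ->.
  by rewrite (@eqh [:: 3; 1; 2]%N [:: 1; 2; 3]%N isT isT isT).
- have := @E 0%N 3%N 1%N 2%N [:: 1; 2; 4]%N isT isT isT AD.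
  rewrite (@eqh [:: 0; 3; 1; 2; 4]%N [:: 0; 1; 2; 3; 4]%N isT isT isT) => ->.
  by rewrite (@eqh [:: 3; 1; 2; 4]%N [:: 1; 2; 3; 4]%N isT isT isT).
- have := @E 0%N 3%N 1%N 2%N [:: 1; 2; 5]%N isT isT isT AD.
  rewrite (@eqh [:: 0; 3; 1; 2; 5]%N [:: 0; 1; 2; 3; 5]%N isT isT isT) => ->.
  by rewrite (@eqh [:: 3; 1; 2; 5]%N [:: 1; 2; 3; 5]%N isT isT isT).
- have := @E 4%N 5%N 0%N 3%N [:: 0; 1; 2; 3]%N isT isT isT UW.
  rewrite (@eqh [:: 4; 5; 0; 1; 2; 3]%N [:: 0; 1; 2; 3; 4; 5]%N isT isT isT) => ->.
  rewrite (@eqh [:: 4; 0; 1; 2; 3]%N [:: 0; 1; 2; 3; 4]%N isT isT isT).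
  by rewrite (@eqh [:: 5; 0; 1; 2; 3]%N [:: 0; 1; 2; 3; 5]%N isT isT isT).
Qed.

Lemma square_diagonals n (A B C D : 'rV[R]_n) : is_square A B C D -> A + C = B + D.
Proof. by case=> _ /eqP; rewrite subr_eq addrAC -subr_eq opprK addrC => /eqP <-. Qed.

Lemma vecR_sub u v : size u = 4%N -> size v = 4%N -> vecR (subz u v) = vecR u - vecR v.
Proof.
move=> su sv; apply/rowP => j; rewrite !mxE (nth_map (0, 0)) ?size_zip ?su ?sv //.
by rewrite nth_zip ?su ?sv //= rmorphB.
Qed.

Lemma squarezP u v w z : size u = 4%N -> size v = 4%N -> size w = 4%N -> size z = 4%N ->
  squarez u v w z -> is_square (vecR u) (vecR v) (vecR w) (vecR z).
Proof.
move=> su sv sw sz /and4P[/eqP uv /eqP E1 /eqP E2 /eqP E3].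
split; rewrite -?vecR_sub ?E1 //.
- by move=> /(vecR_inj su sv).
- by rewrite -E1 dot_vecR E2.
- by rewrite -E1 !dot_vecR E3.
Qed.

Definition label_set (l : seq nat) : {set 'I_(8 + 4)} := [set v | val v \in l]%SET.

Lemma label_set_perm l l' : perm_eq l l' -> label_set l = label_set l'.
Proof. by move=> /perm_mem ll'; apply/setP => v; rewrite !inE ll'. Qed.

Lemma card_label_set t : t \in tetrahedra -> #|label_set t| = 4%N.
Proof.
move=> tT; have /and5P[/eqP st ut _ tn _] := allP dual_checkT t tT.
transitivity (size t) => //.
rewrite -sum1_card big_mkcond -sum1_size -(sum_ord_seq (fun=> 1%N) ut tn).
by apply: eq_bigr => v _; rewrite inE.
Qed.

Lemma tetrahedronE (a b c : 'I_8) (i : 'I_4) :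
  tetrahedron a b c i = label_set [:: val a; val b; val c; (8 + val i)%N].
Proof. by apply/setP => v; rewrite !inE -!val_eqE /= -!orbA. Qed.

Section Subdivision.
Variable h : realization R K -> antipodal_quotient bP.
Hypothesis hom : homeomorphism h.
Hypothesis hE : forall x t (y : bP), t \in tetrahedra -> supp (set_val x) t ->
  set_val y = set_val x *m MR R (apex t) -> h x = \pi_(antipodal_quotient bP) y.

Let hE_sign x t (y : bP) (b : bool) : t \in tetrahedra -> supp (set_val x) t ->
  set_val y = (-1) ^+ b *: (set_val x *m MR R (apex t)) ->
  h x = \pi_(antipodal_quotient bP) y.
Proof.
move=> tT xt yE; have /realizationK[x0 x1 _] := set_valP x.
pose y0 : bP := SigSub (mem_set (MR_boundary tT xt x0 x1)).
rewrite (hE (y := y0) tT xt) //; apply/eqmodP.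
exact: (@antipodal_sign y0 y b).
Qed.

(** The quotient determines a representative only up to sign, so one of the two opposite lifts lies
    in [F]. *)
Let imageP x t F : t \in tetrahedra -> supp (set_val x) t -> antipodal_image F (h x) ->
  exists b : bool, F ((-1) ^+ b *: (set_val x *m MR R (apex t))).
Proof.
move=> tT xt [y [Fy hy]]; have /realizationK[x0 x1 _] := set_valP x.
pose y0 : bP := SigSub (mem_set (MR_boundary tT xt x0 x1)).
have /eqmodP/antipodalP[b yE] : \pi_(antipodal_quotient bP) y0 = \pi_(antipodal_quotient bP) y.
  by rewrite -hy (hE (y := y0) tT xt).
by exists b; rewrite yE in Fy.
Qed.

Lemma antipodal_subdivision_K : antipodal_subdivision h.
Proof.
split=> // [s /K_facet[t tT /fintype.subsetP st]|F pF].
  have tR : facet_root t \in roots by case/and3P: (allP facet_checkT t tT).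
  exists (facetR (facet_root t)), (MR R (apex t)); split.
    have /and5P[/eqP st4 _ _ /allP tn _] := allP dual_checkT t tT.
    have hdt : head 0%N t \in t by case: (t) st4 => // a l _; exact: mem_head.
    pose v0 : 'I_(8 + 4) := Ordinal (tn _ hdt).
    have v0t : val v0 \in t by [].
    (* A vertex of the tetrahedron, as the point that witnesses that the facet is proper. *)
    pose x : 'rV[R]_(8 + 4) := delta_mx 0 v0.
    have xE v : x 0 v = (v == v0)%:R by rewrite mxE eqxx.
    apply: (@facetR_proper _ (x *m MR R (apex t))) => //; apply: MR_facetR => //.
    - by move=> v vt; rewrite xE; case: eqP => // vv; rewrite vv v0t in vt.
    - by move=> v; rewrite xE.
    - by rewrite (bigD1 v0) //= xE eqxx big1 ?addr0 // => v /negbTE vv; rewrite xE vv.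
  move=> x xs; have xt : supp (set_val x) t.
    by move=> v vt; apply: xs; apply: contra vt => /st; rewrite inE.
  have /realizationK[x0 x1 _] := set_valP x.
  exists (SigSub (mem_set (MR_boundary tT xt x0 x1))); split=> //.
    exact: MR_facetR.
  exact: (hE tT xt).
apply: subcomplex_image; first exact: homeomorphism_surj.
move=> x x' hx xx'; have [[c [b0 [cb FE]]] _ _] := pF.
have /realizationK[x0 x1 [t tT xt]] := set_valP x.
have /realizationK[x0' x1' _] := set_valP x'.
have xt' : supp (set_val x') t.
  by move=> v vt; apply: contrapT => /eqP /xx'; rewrite xt ?eqxx.
have [b Fb] := imageP tT xt hx; move: (Fb); rewrite {1}FE => -[_ /= cx].
have Fx' : F ((-1) ^+ b *: (set_val x' *m MR R (apex t))).
  rewrite FE; split; first exact/P24_sign/MR_P24.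
  apply: face_simplexW => // v /xx' xv.
  exact: (face_simplex cb tT x0 x1 cx).
have bx' : bP ((-1) ^+ b *: (set_val x' *m MR R (apex t))) by exists F.
exists (SigSub (mem_set bx')); split; first exact: Fx'.
exact: (hE_sign (b := b) tT xt').
Qed.

Lemma octahedra_from_pyramids_K : octahedra_from_pyramids h.
Proof.
move=> F /(dfaceP _ (isT : 3 < 4)%N)[S /mapP[r rR SE] FS].
have FE : F = facetR r.
  rewrite FS SE /facetR (@hull_faceV R (vecR r) 2); last first.
    by move=> v vV; rewrite dot_vecR (ler_int _ _ 2) (allP (allP roots_leT r rR)).
  by congr (hull (map _ _)); apply: eq_filter => v; rewrite dot_vecR (eqr_int _ _ 2).
have /hasP[[[r' q] ij] oO /= /eqP rr] := allP octahedra_roots r rR.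
have := allP octahedra_checkT _ oO; rewrite /octahedron_check rr => {r' oO rr}.
move=> /and5P[/and5P[/eqP sq uq /allP q8 /eqP sij /andP[uij /allP ij4]]].
case: q sq uq q8 => [|a [|b [|c [|d [|//]]]]] // _ uq q8.
case: ij sij uij ij4 => [|i [|j [|//]]] // _ uij ij4.
rewrite [nth _ _ 0]/= [nth _ _ 1]/= [nth _ _ 2]/= [nth _ _ 3]/= [nth _ [:: i; j] 0]/= [nth _ [:: i; j] 1]/=.
set L := lift_in r.
move=> /and3P[uL /allP SL /allP LS] /and3P[sq1 sq2 sq3] T1 T2.
have a8 : (a < 8)%N by apply: q8; rewrite !inE eqxx.
have b8 : (b < 8)%N by apply: q8; rewrite !inE eqxx !orbT.
have c8 : (c < 8)%N by apply: q8; rewrite !inE eqxx !orbT.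
have d8 : (d < 8)%N by apply: q8; rewrite !inE eqxx !orbT.
have i4 : (i < 4)%N by apply: ij4; rewrite !inE eqxx.
have j4 : (j < 4)%N by apply: ij4; rewrite !inE eqxx !orbT.
(* Within one facet the signs can be chosen for all vertices together, so a single matrix serves the
   four tetrahedra; on each it agrees with [MR] up to a sign. *)
pose M : 'M[R]_(8 + 4, 4) := \matrix_(v, k) ((L v)`_k)%:~R.
have rowM v : row v M = vecR (L v) by apply/rowP => k; rewrite !mxE.
exists (Ordinal a8), (Ordinal b8), (Ordinal c8), (Ordinal d8), (Ordinal i4), (Ordinal j4), M.
set A := row (cube_vertex (Ordinal a8)) M; set B := row (cube_vertex (Ordinal b8)) M.
set C := row (cube_vertex (Ordinal c8)) M; set D := row (cube_vertex (Ordinal d8)) M.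
set U := row (center_vertex (Ordinal i4)) M; set W := row (center_vertex (Ordinal j4)) M.
set T := [:: tetrahedron _ _ _ _; _; _; _].
have AE : A = vecR (L a) by rewrite /A rowM.
have BE : B = vecR (L b) by rewrite /B rowM.
have CE : C = vecR (L c) by rewrite /C rowM.
have DE : D = vecR (L d) by rewrite /D rowM.
have UE : U = vecR (L (8 + i)%N) by rewrite /U rowM.
have WE : W = vecR (L (8 + j)%N) by rewrite /W rowM.
have L6 v : v \in [:: L a; L b; L c; L d; L (8 + i)%N; L (8 + j)%N] ->
  v \in V24 /\ dotz r v = 2 by move=> /LS/andP[? /eqP].
have Lq v : v \in [:: a; b; c; d; (8 + i)%N; (8 + j)%N] -> L v \in V24 /\ dotz r (L v) = 2.
  by move=> vq; apply: L6; exact: (map_f L vq).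
have Lsz v : v \in [:: a; b; c; d; (8 + i)%N; (8 + j)%N] -> size (L v) = 4%N.
  by move=> /Lq[/V24_size].
have sABDC : is_square A B D C.
  by rewrite AE BE CE DE; apply: squarezP => //; apply: Lsz; rewrite !inE eqxx ?orbT.
have sAUDW : is_square A U D W.
  by rewrite AE UE DE WE; apply: squarezP => //; apply: Lsz; rewrite !inE eqxx ?orbT.
have sBUCW : is_square B U C W.
  by rewrite BE UE CE WE; apply: squarezP => //; apply: Lsz; rewrite !inE eqxx ?orbT.
have F6 : F = hull [:: A; B; C; D; U; W].
  rewrite FS SE AE BE CE DE UE WE.
  rewrite -[RHS]/(hull (map vecR [:: L a; L b; L c; L d; L (8 + i)%N; L (8 + j)%N])).
  apply: hull_eq => //; first by rewrite filter_uniq // V24_uniq.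
  move=> v; apply/idP/idP => [/SL //|/L6[vV rv]].
  by rewrite mem_filter rv eqxx.
have [H1 H2 H3 H4] := octahedron_hull (square_diagonals sABDC) (esym (square_diagonals sAUDW)).
have TE : T = map label_set (octahedron_tetrahedra [:: a; b; c; d] [:: i; j]).
  by rewrite /T !tetrahedronE.
have Tt s : s \in T -> exists2 t, t \in tetrahedra &
    s = label_set t /\ exists e : bool, forall v, v \in t ->
      L v = opp_if e (lift_at (apex t) v) /\ dotz r (L v) = 2.
  rewrite TE => /mapP[t' t'O ->].
  have /hasP[t tT /andP[tt' /hasP[e _ /allP te]]] := allP T1 t' t'O.
  exists t => //; split; first by rewrite (label_set_perm tt').
  exists e => v vt; split; first exact/eqP/te.
  apply: (Lq _ _).2; rewrite (perm_mem tt') in vt; move: t'O vt.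
  rewrite !inE => /or4P[] /eqP -> /=; rewrite !inE => /or4P[] /eqP ->; by rewrite eqxx ?orbT.
have straightT s : s \in T -> straight_in h F M s.
  move=> /Tt[t tT [-> [e te]]] x xs; have /realizationK[x0 x1 _] := set_valP x.
  have xt : supp (set_val x) t by move=> v vt; apply: xs; rewrite inE.
  have xM : set_val x *m M = (-1) ^+ e *: (set_val x *m MR R (apex t)).
    rewrite mul_MR mulmx_sum_row scaler_sumr; apply: eq_bigr => v _; rewrite rowM.
    have [vt|/xt ->] := boolP (val v \in t); last by rewrite !scale0r scaler0.
    by rewrite (te _ vt).1 vecR_opp_if !scalerA mulrC.
  have Fx : F (set_val x *m M).
    rewrite FE; split; first by rewrite xM; exact/P24_sign/MR_P24.
    rewrite /= mulmx_sum_row dot_sumr -[RHS]mul1r -[X in _ = X * _]x1 mulr_suml.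
    apply: eq_bigr => v _; rewrite rowM dotZr.
    have [vt|/xt ->] := boolP (val v \in t); last by rewrite !mul0r.
    by rewrite dot_vecR (te _ vt).2.
  have bx : bP (set_val x *m M).
    by exists F; split=> //; rewrite FE; apply: facetR_proper; rewrite // -FE; exact: Fx.
  exists (SigSub (mem_set bx)); split=> //.
  exact: (hE_sign (b := e) tT xt).
split=> //; last by rewrite -H4.
- split; last by rewrite -val_eqE; move: uij; rewrite /= inE andbT.
  exact: (@map_uniq _ _ (@nat_of_ord 8) [:: Ordinal a8; Ordinal b8; Ordinal c8; Ordinal d8] uq).
- move=> s; split; last first.
    move=> sT; have [t tT [sE _]] := Tt s sT; split; last split.
    - rewrite in_complex_of_facets -card_gt0 sE card_label_set //.
      by apply/andP; split=> //; apply/hasP; exists t.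
    - by rewrite sE card_label_set.
    - by move=> _ [x xs <-]; have [y [_ Fy hy]] := straightT s sT x xs; exists y.
  move=> [/K_facet[t tT st] [s4 hs]].
  have {st} sE : s = label_set t.
    by apply/eqP; rewrite eqEcard st s4 card_label_set.
  have /and5P[/eqP st ut _ tn _] := allP dual_checkT t tT.
  (* The barycentre of the tetrahedron: once it is mapped into [F], the four vertices lie in [F]
     with one common sign, and the last test of [octahedron_check] applies. *)
  pose x0 : 'rV[R]_(8 + 4) := \row_v (if val v \in t then 4^-1 else 0).
  have x0E (v : 'I_(8 + 4)) : val v \in t -> x0 0 v = 4^-1 by move=> vt; rewrite mxE vt.
  have x0ge0 v : 0 <= x0 0 v by rewrite mxE; case: ifP => // _; rewrite invr_ge0.
  have x01 : \sum_v x0 0 v = 1.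
    under eq_bigr do rewrite mxE.
    rewrite (sum_ord_seq (fun=> 4^-1) ut tn) big_const_seq count_predT st.
    by rewrite iter_addr_0 -[LHS]mulr_natr mulVf // pnatr_eq0.
  have x0t : supp x0 t by move=> v /negbTE vt; rewrite mxE vt.
  have x0K : realization R K x0 by apply/realizationK; split=> //; exists t.
  pose x : realization R K := SigSub (mem_set x0K).
  have [|e Fe] := @imageP x t F tT x0t.
    by apply: hs; exists x => // v; rewrite sE inE => /x0t.
  move: Fe; rewrite FE => -[_ /= Fe].
  have r2 y : P y -> dot (vecR r) y <= 2.
    apply: P24_le => v vV.
    by rewrite dot_vecR (ler_int _ _ 2) (allP (allP roots_leT r rR)).
  have rv v : v \in t -> (-1) ^+ e * dotz r (lift_at (apex t) v) = 2.
    move=> vt; pose v' : 'I_(8 + 4) := Ordinal (allP tn _ vt).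
    have := @face_simplex _ _ t e x0 r2 tT x0ge0 x01 Fe v'.
    rewrite x0E // invr_eq0 pnatr_eq0 => /(_ isT).
    rewrite dotZr dot_vecR -(intr_sign _ e) -intrM => /eqP.
    by rewrite (eqr_int _ _ 2) => /eqP.
  have /(allP T2)/hasP[t' t'O tt'] :
      t \in [seq t <- tetrahedra | all (fun u => dotz r u == 2) (lifts t)
                               || all (fun u => dotz r u == -2) (lifts t)].
    rewrite mem_filter tT andbT; apply/orP; case: e rv {Fe} => rv; [right|left];
      apply/allP => u /mapP[v vt ->]; have := rv v vt; rewrite ?expr1 ?expr0 ?mul1r.
      by rewrite mulN1r => /eqP; rewrite eqr_oppLR.
    by move=> ->.
  by rewrite TE sE (label_set_perm tt'); exact: map_f.
Qed.

End Subdivision.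

End Cell.

Theorem theorem4p6 (R : realType) :
  [/\ #|vertices K| = 12,
      equilibrium_triangulation R 3 K
    & exists P : set 'rV[R]_4,
        [/\ is_24_cell P,
            centrally_symmetric P
          & exists h : realization R K -> antipodal_quotient (boundary P),
              antipodal_subdivision h /\ octahedra_from_pyramids h]].
Proof.
split; [exact: card_vertices_K|exact: equilibrium_triangulation_K|].
exists (P24 R); split; [exact: is_24_cell_P24|by move=> x; exact: P24_opp|].
have [h [hom hE]] := antipodal_homeomorphism R; exists h; split.
- exact: antipodal_subdivision_K.
- exact: octahedra_from_pyramids_K.
Qed.
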